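(* Let $\mathcal{S}=(S_m)_{m\in\mathcal{M}}$ be an at most countable collection of Gaussian regression mixture models (as defined in the context) satisfying Assumption (K), with weights $(x_m)_{m\in\mathcal{M}}$ and constant $\Xi$, and Assumption (DIM), both stated in the context. Then there is a constant $C$ (depending only on the collection) such that for any $\rho\in(0,1)$ and any $C_1>1$ there is a constant $\kappa_0$, depending only on $\rho$ and $C_1$, such that, as soon as for every index $m\in\mathcal{M}$ $$\mathrm{pen}(m)=\kappa\big((C+\ln n)\dim(S_m)+x_m\big)\quad\text{with } \kappa>\kappa_0,$$ the penalized likelihood estimate $\widehat{s}_{\widehat{m}}$, with $\widehat{m}\in\mathcal{M}$ such that $$\sum_{i=1}^n-\ln(\widehat{s}_{\widehat{m}}(Y_i|X_i))+\mathrm{pen}(\widehat{m})\le\inf_{m\in\mathcal{M}}\left(\sum_{i=1}^n-\ln(\widehat{s}_m(Y_i|X_i))+\mathrm{pen}(m)\right)+\eta',$$ satisfies $$\mathbb{E}\left[\mathrm{JKL}_{\rho}^{\otimes n}(s_0,\widehat{s}_{\widehat{m}})\right]\le C_1\inf_{m\in\mathcal{M}}\left(\inf_{s_m\in S_m}\mathrm{KL}^{\otimes n}(s_0,s_m)+\frac{\mathrm{pen}(m)}{n}+\frac{\kappa_0\Xi+\eta+\eta'}{n}\right).$$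
   Context: **Data.** One observes $n\ge 1$ pairs $(X_i,Y_i)_{1\le i\le n}$ with $X_i\in\mathcal{X}=[0,1]^d$ and $Y_i\in\mathbb{R}^p$; the $X_i$ are independent and the $Y_i$ are independent conditionally on the $X_i$'s, $Y_i$ having conditional density $s_0(\cdot|X_i)$ with respect to the Lebesgue measure. The conditional density $s_0$ is unknown and arbitrary (it need not belong to any model). **Divergences.** For densities $f,g$ on $\mathbb{R}^p$, $\mathrm{KL}(f,g)$ is the Kullback-Leibler divergence ($\int f\ln(f/g)$, possibly $+\infty$). For conditional densities $s,t$ and $\rho\in(0,1)$, $$\mathrm{KL}^{\otimes n}(s,t)=\mathbb{E}\Big[\tfrac1n\sum_{i=1}^n\mathrm{KL}(s(\cdot|X_i),t(\cdot|X_i))\Big],$$ $$\mathrm{JKL}_\rho^{\otimes n}(s,t)=\mathbb{E}\Big[\tfrac1n\sum_{i=1}^n\tfrac1\rho\mathrm{KL}\big(s(\cdot|X_i),(1-\rho)s(\cdot|X_i)+\rho\, t(\cdot|X_i)\big)\Big],$$ where the expectation is over the $X_i$'s only (when $t$ is an estimator it is regarded as fixed in this definition, and the outer expectation in the claim is over the sample). **Models.** $\Phi_{\upsilon,\Sigma}$ is the Gaussian density on $\mathbb{R}^p$ with mean $\upsilon$ and covariance $\Sigma$. For functions $w_1,\dots,w_K:\mathcal{X}\to\mathbb{R}$ put $\pi_{w,k}(x)=e^{w_k(x)}/\sum_{l=1}^K e^{w_l(x)}$. Each model is $$S_m=\Big\{(x,y)\mapsto\sum_{k=1}^K\pi_{w,k}(x)\Phi_{\upsilon_k(x),\Sigma_k}(y)\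 \Big|\ w\in W_K,\ (\upsilon_1,\dots,\upsilon_K)\in\Upsilon_K,\ (\Sigma_1,\dots,\Sigma_K)\in V_K\Big\},$$ where the index $m$ specifies $K\in\mathbb{N}^*$, $W_K$, $\Upsilon_K$ and $V_K$. Here $K\le K_{\max}$ for some fixed $K_{\max}$; $W_K$ is a compact set (for the sup norm) of $K$-tuples of (measurable) functions $\mathcal{X}\to\mathbb{R}$; $\Upsilon_K$ is a compact set (for the sup norm) of $K$-tuples of (measurable) functions $\mathcal{X}\to\mathbb{R}^p$. The set $V_K$ consists of $K$-tuples $(L_kD_kA_kD_k')_{1\le k\le K}$ with $L_k\in[L_-,L_+]$, $D_k\in SO(p)$ and $A_k\in\mathcal{A}(\lambda_-,\lambda_+)$, the set of diagonal $p\times p$ matrices $A$ with $|A|=1$ (determinant) and $\lambda_-\le A_{i,i}\le\lambda_+$ for all $i$; the constants $0<L_-\le L_+$ and $0<\lambda_-\le\lambda_+$ are common to all models. For each of the three components (volume $L$, eigenvectors $D$, normalized eigenvalues $A$), the structure $V_K$ specifies that it is either fixed to a known value, or unknown and common to all $K$ classes, or unknown and free for each class; the corresponding numbers $Z_L,Z_D,Z_A$ are $0$, $1$ or $K$ respectively. **Dimension.** $\dim(V_K)$ is the dimension of its parameter set, $Z_L+\frac{p(p-1)}2Z_D+(p-1)Z_A$. For a metric $\mathsf d$, $H_{\mathsf d}(\sigma,F)$ denotes the metric entropy, i.e. the logarithm of the minimal cardinality of a $\sigma$-net of $F$ for $\mathsf d$. For a set $F_K$ of $K$-tuples of functions, $\dim(F_K)$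 is the smallest $D$ for which there is a constant $c$ with $H(\sigma,F_K)\le D(c+\ln\frac1\sigma)$ for all $\sigma\in(0,\sqrt2]$, the entropy being with respect to the distance $\sup_{x\in\mathcal X}\max_{1\le k\le K}|s_k(x)-t_k(x)|$ (Euclidean norm $\|\cdot\|_2$ in place of $|\cdot|$ for $\mathbb{R}^p$-valued functions). Finally $\dim(S_m)=\dim(W_K)+\dim(\Upsilon_K)+\dim(V_K)$. **Assumption (DIM).** There are two constants $C_W$ and $C_\Upsilon$ such that, for every model $S_m$ in the collection and all $\sigma\in(0,\sqrt2]$, $$H_{\max_k\|\cdot\|_\infty}(\sigma,W_K)\le\dim(W_K)\Big(C_W+\ln\tfrac1\sigma\Big),\qquad H_{\max_k\sup_x\|\cdot\|_2}(\sigma,\Upsilon_K)\le\dim(\Upsilon_K)\Big(C_\Upsilon+\ln\tfrac1\sigma\Big).$$ **Assumption (K).** There is a family $(x_m)_{m\in\mathcal{M}}$ of non-negative numbers such that $\sum_{m\in\mathcal{M}}e^{-x_m}\le\Xi<+\infty$. **Estimators.** $\eta,\eta'\ge0$ are fixed. For each $m$, $\widehat{s}_m\in S_m$ is an $\eta$-minimizer of the negative log-likelihood: $\sum_{i=1}^n-\ln\widehat{s}_m(Y_i|X_i)\le\inf_{s_m\in S_m}\sum_{i=1}^n-\ln s_m(Y_i|X_i)+\eta$. *)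

(* Defs.v *)
From HB Require Import structures.
From mathcomp Require Import all_boot all_order all_algebra.
From mathcomp Require Import all_classical all_reals all_analysis.
From mathcomp Require Import measurable_realfun.

Set Implicit Arguments.
Unset Strict Implicit.
Unset Printing Implicit Defensive.

Import Order.TTheory GRing.Theory Num.Theory.
Import numFieldNormedType.Exports.

Local Open Scope classical_set_scope.
Local Open Scope ring_scope.

(* R^q is represented by q.-tuple R, which carries the product sigma-algebra,
   when it is the range of an observation. *)

Section lebesgue_tuple.
Variable R : realType.

Definition cons_tuple q (z : R * q.-tuple R) : q.+1.-tuple R :=
  [tuple of z.1 :: z.2].

Definition uncons_tuple q (t : q.+1.-tuple R) : R * q.-tuple R :=
  (thead t, [tuple of behead t]).

Lemma uncons_tupleK q : cancel (@uncons_tuple q) (@cons_tuple q).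
Proof. by move=> t; rewrite [RHS]tuple_eta; exact/val_inj. Qed.

Lemma cons_tupleK q : cancel (@cons_tuple q) (@uncons_tuple q).
Proof. by move=> [x t]; congr pair; exact/val_inj. Qed.

Lemma measurable_cons_tuple q :
  measurable_fun [set: R * q.-tuple R] (@cons_tuple q).
Proof. exact: measurable_cons. Qed.

Lemma measurable_uncons_tuple q :
  measurable_fun [set: q.+1.-tuple R] (@uncons_tuple q).
Proof.
apply: measurable_fun_pair; last exact: measurable_behead.
exact: measurable_tnth.
Qed.

(* lebesgue_measure lives on measurableTypeR R, whose sigma-algebra is that of
   R but whose display differs; the products below need the display of R. *)
Definition lebesgue1 : set R -> \bar R := @lebesgue_measure R.

Let lebesgue1_0 : lebesgue1 set0 = 0%E.
Proof. exact: (measure0 (@lebesgue_measure R)). Qed.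

Let lebesgue1_ge0 A : (0 <= lebesgue1 A)%E.
Proof. exact: (measure_ge0 (@lebesgue_measure R)). Qed.

Let lebesgue1_sigma_additive : semi_sigma_additive lebesgue1.
Proof. exact: (@measure_semi_sigma_additive _ _ _ (@lebesgue_measure R)). Qed.

HB.instance Definition _ := isMeasure.Build _ _ _ lebesgue1
  lebesgue1_0 lebesgue1_ge0 lebesgue1_sigma_additive.

Let lebesgue1_sigma_finite : sigma_finite setT lebesgue1.
Proof. exact: (sigma_finiteT (@lebesgue_measure R)). Qed.

HB.instance Definition _ := Measure_isSigmaFinite.Build _ _ _ lebesgue1
  lebesgue1_sigma_finite.

Section lebesgue_cons.
Variables (q : nat) (mu : {sigma_finite_measure set (q.-tuple R) -> \bar R}).

Definition lebesgue_cons : set (q.+1.-tuple R) -> \bar R :=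
  pushforward (lebesgue1 \x mu)%E (@cons_tuple q).

Let mcons : measurable_fun [set: R * q.-tuple R] (@cons_tuple q).
Proof. exact: measurable_cons_tuple. Qed.

Let lebesgue_cons0 : lebesgue_cons set0 = 0%E.
Proof. by rewrite /lebesgue_cons /pushforward preimage_set0 measure0. Qed.

Let lebesgue_cons_ge0 A : (0 <= lebesgue_cons A)%E.
Proof. exact: measure_ge0. Qed.

Let lebesgue_cons_sigma_additive : semi_sigma_additive lebesgue_cons.
Proof. exact: measure_semi_sigma_additive. Qed.

HB.instance Definition _ := isMeasure.Build _ _ _ lebesgue_cons
  lebesgue_cons0 lebesgue_cons_ge0 lebesgue_cons_sigma_additive.

Let lebesgue_cons_sigma_finite : sigma_finite setT lebesgue_cons.
Proof.
have /sigma_finiteP[F [TF ndF Foo]] := sigma_finiteT lebesgue1.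
have /sigma_finiteP[G [TG ndG Goo]] := sigma_finiteT mu.
exists (fun i => @uncons_tuple q @^-1` (F i `*` G i)).
  rewrite -preimage_bigcup -(preimage_setT (@uncons_tuple q)) -setXTT TF TG.
  congr (_ @^-1` _); apply/seteqP; split=> [[x y]|[x y]].
    move=> [/= [n _ Fnx] [k _ Gky]]; exists (maxn n k) => //; split.
    - by move: x Fnx; exact/subsetPset/ndF/leq_maxl.
    - by move: y Gky; exact/subsetPset/ndG/leq_maxr.
  by move=> [n _ []/= ? ?]; split; exists n.
move=> k; have [mF Fk] := Foo k; have [mG Gk] := Goo k; split.
  rewrite -[X in measurable X]setTI.
  by apply: measurable_uncons_tuple => //; exact: measurableX.
rewrite /lebesgue_cons /pushforward -comp_preimage.
rewrite (_ : _ \o _ = id); last by apply/funext => z; exact: cons_tupleK.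
by rewrite preimage_id product_measure1E// lte_mul_pinfty// ge0_fin_numE.
Qed.

HB.instance Definition _ := Measure_isSigmaFinite.Build _ _ _ lebesgue_cons
  lebesgue_cons_sigma_finite.

End lebesgue_cons.

Fixpoint lebesgue_tuple q : {sigma_finite_measure set (q.-tuple R) -> \bar R} :=
  match q with
  | 0 => [the {sigma_finite_measure set (0.-tuple R) -> \bar R} of \d_[tuple]]
  | q'.+1 => [the {sigma_finite_measure set (q'.+1.-tuple R) -> \bar R}
               of lebesgue_cons (lebesgue_tuple q')]
  end.

Lemma lebesgue_tuple_box q (A : 'I_q -> set R) :
  (forall i, measurable (A i)) ->
  (lebesgue_tuple q [set t | forall i, A i (tnth t i)] =
   \prod_(i < q) lebesgue_measure (A i))%E.
Proof.
elim: q A => [|q IHq] A mA.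
  rewrite big_ord0 /= diracE (_ : [set _ | _] = setT) ?in_setT//.
  by apply/seteqP; split => // t _ [].
have mbox : measurable
    [set t : q.-tuple R | forall i, A (lift ord0 i) (tnth t i)].
  rewrite (_ : [set _ | _] = \bigcap_(i in [set: 'I_q])
    ((fun t : q.-tuple R => tnth t i) @^-1` A (lift ord0 i))).
    apply: fin_bigcap_measurable => // i _; rewrite -[X in measurable X]setTI.
    exact: measurable_tnth.
  by apply/seteqP; split=> [t At i _|t At i]; [exact: At|exact: (At i)].
rewrite big_ord_recl -IHq// /= /lebesgue_cons /pushforward.
rewrite -[RHS](product_measure1E lebesgue1)//.
congr (_ _); apply/seteqP; split=> [[x t]/= At|[x t]/= [Ax At] i].
  by split=> [|i]; [have := At ord0|have := At (lift ord0 i)]; rewrite ?tnthS.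
by case: (unliftP ord0 i) => [j|] ->; rewrite ?tnthS.
Qed.

End lebesgue_tuple.

Section cube.
Variables (R : realType) (d : nat).

Definition in_cube (t : d.-tuple R) : bool := all (fun u => 0 <= u <= 1) t.

Definition cube := {t : d.-tuple R | in_cube t}.

Let in_cube0 : in_cube [tuple of nseq d 0].
Proof. by apply/allP => u /nseqP[-> _]; rewrite lexx ler01. Qed.

HB.instance Definition _ := Choice.on cube.
HB.instance Definition _ := isPointed.Build cube (exist (fun t : d.-tuple R => is_true (in_cube t)) _ in_cube0).
HB.instance Definition _ := Measurable.copy cube
  (g_sigma_algebra_preimageType (val : cube -> d.-tuple R)).

End cube.

Section divergences.
Variables (R : realType) (d p : nat).

(* s x y stands for s(y|x). *)
Definition cond_fun := cube R d -> p.-tuple R -> R.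

Definition cond_density (s : cond_fun) : Prop :=
  [/\ measurable_fun [set: cube R d * p.-tuple R] (fun z => s z.1 z.2),
      forall x y, 0 <= s x y &
      forall x, (\int[lebesgue_tuple R p]_y (s x y)%:E = 1)%E].

(* a ln (a / b) with the conventions 0 ln (0 / b) = 0 and a ln (a / 0) = +oo
   for a != 0; ln and division are total in R and do not give the latter. *)
Definition kl_integrand (a b : R) : \bar R :=
  if a == 0 then 0%E else if b == 0 then +oo%E else (a * ln (a / b))%:E.

Definition KL (f g : p.-tuple R -> R) : \bar R :=
  (\int[lebesgue_tuple R p]_y kl_integrand (f y) (g y))%E.

Section tensorized.
Context {disp : measure_display} {Omega : measurableType disp}.
Variables (P : probability Omega R) (n : nat).
Variable X : 'I_n -> {RV P >-> cube R d}.

Definition KLn (s t : cond_fun) : \bar R :=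
  (\int[P]_omega ((n%:R^-1)%:E *
     \sum_(i < n) KL (s (X i omega)) (t (X i omega))))%E.

Definition JKLn (rho : R) (s t : cond_fun) : \bar R :=
  (\int[P]_omega ((n%:R^-1)%:E *
     \sum_(i < n) ((rho^-1)%:E *
       KL (s (X i omega))
          (fun y => ((1 - rho) * s (X i omega) y
                     + rho * t (X i omega) y)%R))))%E.

End tensorized.

End divergences.

Section sampling.
Context {R : realType} {d p : nat}.
Context {disp : measure_display} {Omega : measurableType disp}.
Variables (P : probability Omega R) (n : nat).
Variables (X : 'I_n -> {RV P >-> cube R d}) (Y : 'I_n -> {RV P >-> p.-tuple R}).

Definition independent_covariates : Prop :=
  forall A : 'I_n -> set (cube R d), (forall i, measurable (A i)) ->
    (P (\bigcap_i (X i @^-1` A i)) = \prod_(i < n) P (X i @^-1` A i))%E.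

(* A version of P(Y_1 in B_1, ..., Y_n in B_n | X_1, ..., X_n) is
   \prod_i \int_(B_i) s0(y|X_i) dy: it is integrated against every event
   of the sigma-algebra generated by (X_1, ..., X_n). *)
Definition cond_independent_responses (s0 : cond_fun R d p) : Prop :=
  forall (A : set (n.-tuple (cube R d))) (B : 'I_n -> set (p.-tuple R)),
    measurable A -> (forall i, measurable (B i)) ->
    let XA := (fun omega => [tuple X i omega | i < n]) @^-1` A in
    (P (XA `&` \bigcap_i (Y i @^-1` B i)) =
     \int[P]_(omega in XA)
       \prod_(i < n) \int[lebesgue_tuple R p]_(y in B i) (s0 (X i omega) y)%:E)%E.

Definition neg_loglik (s : cond_fun R d p) (omega : Omega) : R :=
  \sum_(i < n) - ln (s (X i omega) (Y i omega)).

End sampling.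

Section models.
Variables (R : realType) (d p : nat).

Definition vec (y : p.-tuple R) : 'cV[R]_p := \col_i tnth y i.

Definition norm2 (v : 'cV[R]_p) : R := Num.sqrt (\sum_(i < p) v i 0 ^+ 2).

Definition gaussian_density (u : 'cV[R]_p) (S : 'M[R]_p) (y : p.-tuple R) : R :=
  expR (- ((vec y - u)^T *m invmx S *m (vec y - u)) 0 0 / 2)
  / Num.sqrt ((2 * pi) ^+ p * \det S).

Definition logistic_weight K (w : 'I_K -> cube R d -> R) (k : 'I_K)
    (x : cube R d) : R :=
  expR (w k x) / \sum_(l < K) expR (w l x).

Definition gaussian_mixture K (w : 'I_K -> cube R d -> R)
    (u : 'I_K -> cube R d -> 'cV[R]_p) (S : 'I_K -> 'M[R]_p) : cond_fun R d p :=
  fun x y => \sum_(k < K) logistic_weight w k x * gaussian_density (u k x) (S k) y.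

(* What a model prescribes about a K-tuple of parameters. A known component
   has known values, which may depend on the class. *)
Inductive component (K : nat) (T : Type) : Type :=
  | Known of ('I_K -> T)
  | Common
  | Free.
Arguments Common {K T}.
Arguments Free {K T}.

Definition component_set K T (c : component K T) (range : set T) :
    set ('I_K -> T) :=
  [set t | (forall k, range (t k)) /\
    match c with
    | Known t0 => t = t0
    | Common => forall k l, t k = t l
    | Free => True
    end].

Definition component_count K T (c : component K T) : nat :=
  match c with Known _ => 0 | Common => 1 | Free => K end.

Definition special_orthogonal : set 'M[R]_p :=
  [set D | D *m D^T = 1%:M /\ \det D = 1].

Definition normalized_eigenvalues (lm lp : R) : set 'M[R]_p :=
  [set A | [/\ is_diag_mx A, \det A = 1 & forall i, lm <= A i i <= lp]].

Record model := Model {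
  ncomp : nat;
  weight_set : set ('I_ncomp -> cube R d -> R);
  mean_set : set ('I_ncomp -> cube R d -> 'cV[R]_p);
  volume : component ncomp R;
  eigenvectors : component ncomp 'M[R]_p;
  eigenvalues : component ncomp 'M[R]_p }.
Arguments weight_set m _ : clear implicits.
Arguments mean_set m _ : clear implicits.

Definition cov_set (Lm Lp lm lp : R) (m : model) : set ('I_(ncomp m) -> 'M[R]_p) :=
  [set S | exists L D A,
    [/\ component_set (volume m) `[Lm, Lp] L,
        component_set (eigenvectors m) special_orthogonal D,
        component_set (eigenvalues m) (normalized_eigenvalues lm lp) A &
        S = fun k => L k *: (D k *m A k *m (D k)^T)]].

Definition densities (Lm Lp lm lp : R) (m : model) : set (cond_fun R d p) :=
  [set s | exists w u S,
    [/\ weight_set m w, mean_set m u, cov_set Lm Lp lm lp S &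
        s = gaussian_mixture w u S]].

(* The sup norm is a norm on bounded functions; on these,
   {uniform _ -> {uniform _ -> _}} carries the topology of
   max_k sup_x |s_k(x) - t_k(x)|. *)
Definition admissible_model (Kmax : nat) (m : model) : Prop :=
  [/\ (0 < ncomp m <= Kmax)%N,
      forall w, weight_set m w ->
        (forall k, measurable_fun [set: cube R d] (w k)) /\
        (exists b, forall k x, `|w k x| <= b),
      @compact {uniform 'I_(ncomp m) -> {uniform cube R d -> R}} (weight_set m),
      forall u, mean_set m u ->
        (forall k i, measurable_fun [set: cube R d] (fun x => u k x i 0)) /\
        (exists b, forall k x, norm2 (u k x) <= b) &
      @compact {uniform 'I_(ncomp m) -> {uniform cube R d -> 'cV[R]_p}}
        (mean_set m)].

End models.
Arguments weight_set {R d p} m _.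
Arguments mean_set {R d p} m _.
Arguments Common {K T}.
Arguments Free {K T}.

Section entropy.
Variable R : realType.

Definition has_net T (dist : T -> T -> \bar R) (sigma : R) (F : set T) (N : nat) :
    Prop :=
  exists c : 'I_N -> T, (forall i, F (c i)) /\
    forall f, F f -> exists i, (dist f (c i) <= sigma%:E)%E.

(* +oo when F has no finite net. *)
Definition metric_entropy T (dist : T -> T -> \bar R) (sigma : R) (F : set T) :
    \bar R :=
  lne (ereal_inf [set (N%:R)%:E | N in has_net dist sigma F]).

Definition entropy_bound T (dist : T -> T -> \bar R) (F : set T) (D c : R) :
    Prop :=
  forall sigma, 0 < sigma <= Num.sqrt 2 ->
    (metric_entropy dist sigma F <= (D * (c + ln (1 / sigma)))%:E)%E.

(* entropy_bound _ F (metric_dim _ F) c, for some c, says that this infimum is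
   attained; in particular it fails when no D is admissible. *)
Definition metric_dim T (dist : T -> T -> \bar R) (F : set T) : R :=
  inf [set D | exists c, entropy_bound dist F D c].

Variables (d p : nat).

Definition sup_dist (V : zmodType) (nrm : V -> R) K
    (s t : 'I_K -> cube R d -> V) : \bar R :=
  ereal_sup [set (nrm (s kx.1 kx.2 - t kx.1 kx.2))%:E
            | kx in [set: 'I_K * cube R d]].

Definition weight_dist K (s t : 'I_K -> cube R d -> R) : \bar R :=
  sup_dist (fun a : R => `|a|) s t.

Definition mean_dist K (s t : 'I_K -> cube R d -> 'cV[R]_p) : \bar R :=
  sup_dist (@norm2 R p) s t.

Definition dim_cov (m : model R d p) : nat :=
  component_count (volume m)
  + (p * (p - 1)) %/ 2 * component_count (eigenvectors m)
  + (p - 1) * component_count (eigenvalues m).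

Definition dim_model (m : model R d p) : R :=
  metric_dim (@weight_dist _) (weight_set m)
  + metric_dim (@mean_dist _) (mean_set m) + (dim_cov m)%:R.

Definition assumption_DIM (M : Type) (S : M -> model R d p) : Prop :=
  exists CW CU : R, forall m,
    entropy_bound (@weight_dist _) (weight_set (S m))
      (metric_dim (@weight_dist _) (weight_set (S m))) CW /\
    entropy_bound (@mean_dist _) (mean_set (S m))
      (metric_dim (@mean_dist _) (mean_set (S m))) CU.

Definition assumption_K (M : choiceType) (x : M -> R) (Xi : R) : Prop :=
  (forall m, 0 <= x m) /\ (\esum_(m in [set: M]) (expR (- x m))%:E <= Xi%:E)%E.

End entropy.

(* Main.v *)
Require Import Defs.
From HB Require Import structures.
From mathcomp Require Import all_boot all_order all_algebra.
From mathcomp Require Import all_classical all_reals all_analysis.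
From mathcomp Require Import measurable_realfun.
From mathcomp Require Import ring lra zify.

Set Implicit Arguments.
Unset Strict Implicit.
Unset Printing Implicit Defensive.

Import Order.TTheory GRing.Theory Num.Theory.
Import numFieldNormedType.Exports.

Local Open Scope classical_set_scope.
Local Open Scope ring_scope.

(** The selected estimator is compared with finitely many functions that lie
    above the models, so that a union bound takes the place of any control of
    an empirical process.

    Let [theta = 1 / C1] and [a = (1 - theta) (1 - rho)]. Every model lies below
    finitely many functions of integral at most [1 + 1 / n], and the logarithm
    of their number is at most [4 (C + ln n) dim (S m)] ([upper_net]). Indeed,
    once the parameters are discretized at a scale of order [1 / n], inflating a
    covariance slightly makes a Gaussian density dominate all those with nearby
    parameters, up to a factor close to 1 ([gaussian_density_le]).

    For one function [t] of such a family put [q = (1 - rho) s0 + rho t]. Since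
    [q / s0 >= 1 - rho], the inequality [powR_le_ln_affine] bounds the
    expectation of [(q / s0) ^ a] under [s0] by [1 - a theta KL(s0, q)] up to
    [a / n]: the exponential moment of the likelihood ratio is controlled by the
    divergence that has to be estimated, whatever [s0] is. Both independence
    assumptions then give, for the product of the [(q / s0) ^ a] over the sample
    divided by the exponential of the sum of these bounds, an expectation at
    most 1 ([expectation_exp_moment]).

    Let [V] be the mixture of these products, with weights [e ^ (- x m)] on the
    models and uniform weights inside each family; its expectation is at most
    [Xi]. At the function [t] above the selected estimator [s'], [V] is at least
    [e ^ (- x m)] times the product over the cardinality of the family. Taking
    logarithms, and using [ln (q / s0) >= rho ln (t / s0) >= rho ln (s' / s0)],
    one gets ([selection_bound]) that [a theta] times the sum of the divergences
    from [s0] to [(1 - rho) s0 + rho s'] is at most [a rho] times the sum of the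
    [ln (s0 / s')] at the observations, plus [x m], the logarithm of the
    cardinality, and [e ^ 2 V]. The penalty pays for [x m] and the cardinality,
    and near-minimality replaces [s'] by an arbitrary competitor [s]
    ([pointwise_oracle]). The expectation of the sum of the [ln (s0 / s)] is [n]
    times the divergence from [s0] to [s], and dividing by [a theta rho n] gives
    the constant [1 / theta = C1] ([oracle_inequality]). *)

(** * A power bounded by a logarithm and an affine function *)

Section pointwise.
Variable R : realType.
Implicit Types a b h r theta u : R.

Let gap a theta u : R :=
  a * (theta * u + (1 - theta) * (expR u - 1)) - (expR (a * u) - 1).

Let gap_derive a theta u : is_derive u 1 (gap a theta)
  (a * (theta + (1 - theta) * expR u - expR (a * u))).
Proof.
rewrite /gap.
have ? : is_derive u 1 (fun u => expR (a * u)) (a * expR (a * u)).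
  have ? : is_derive u 1 (fun u => a * u) a.
    by apply: is_derive_eq => /=; rewrite /GRing.scale/=; ring.
  by rewrite mulrC; exact: (@is_derive1_comp R expR (fun u => a * u)).
apply: is_derive_eq => /=.
rewrite /GRing.scale/=; ring.
Qed.

Let gap_cont a theta : continuous (gap a theta).
Proof. by move=> u; apply/differentiable_continuous/derivable1_diffP; exact: ex_derive. Qed.

Let gap0 a theta : gap a theta 0 = 0.
Proof. by rewrite /gap !mulr0 expR0 subrr mulr0 addr0 mulr0 subrr. Qed.

Let gap_ge0 a theta r u : 0 < theta < 1 -> 0 < r < 1 ->
  0 <= a <= (1 - theta) * (1 - r) -> 1 - r <= expR u -> 0 <= gap a theta u.
Proof.
move=> /andP[t0 t1] /andP[r0 r1] /andP[a0 ale] ru.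
have a1t : a <= 1 - theta by nra.
have cont b c : {within `[b, c], continuous (gap a theta)}.
  exact/continuous_subspaceT/gap_cont.
rewrite -(gap0 a theta); have [u0|u0] := leP 0 u.
  apply: (@ger0_derive1_le_cc _ _ 0 u) => //.
  - move=> v /itvP v0; rewrite derive1E (@derive_val _ _ _ _ _ _ _ (gap_derive a theta v)).
    have v1 : 1 <= expR v by rewrite -expR0 ler_expR v0.
    (* e^(av) <= 1 - a + a e^v by convexity *)
    have cvx : expR (a * v) <= (1 - a) + a * expR v.
      have a01 : 0 <= a <= 1 by apply/andP; split => //; lra.
      have := @convex_expR R (Itv01 a0 (andP a01).2) v 0.
      rewrite !convRE/= mulr0 addr0 expR0 mulr1 /unstable.onem; lra.
    apply: mulr_ge0 => //; nra.
  - by rewrite in_itv/= lexx u0.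
  - by rewrite in_itv/= lexx u0.
apply: (@ler0_derive1_le_cc _ _ u 0) => //.
- move=> v /itvP vI; rewrite derive1E (@derive_val _ _ _ _ _ _ _ (gap_derive a theta v)).
  have v0 : v < 0 by rewrite vI.
  have rv : 1 - r <= expR v by apply: le_trans ru _; rewrite ler_expR ltW// vI.
  have h1 : 1 + a * v <= expR (a * v) := expR_ge1Dx _.
  (* 1 - e^v >= - v e^v *)
  have h2 : expR v * (1 - v) <= 1.
    have := expR_ge1Dx (- v); rewrite expRN => h.
    by rewrite mulrC -ler_pdivlMr ?expR_gt0// div1r.
  rewrite mulr_ge0_le0//.
  have : 1 - expR v >= (1 - r) * (- v) by nra.
  nra.
- by rewrite in_itv/= lexx ltW.
- by rewrite in_itv/= lexx ltW.
- exact: ltW.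
Qed.

(** Substituting [u = ln h], the difference of the two sides vanishes at
    [u = 0], decreases before and increases after: for [u > 0] the sign of the
    derivative comes from convexity of the exponential, and for [u < 0] from
    [e ^ u >= 1 - r], which keeps [1 - e ^ u] of the order of [- u]. *)
Lemma powR_le_ln_affine a theta r h : 0 < theta < 1 -> 0 < r < 1 ->
  0 <= a <= (1 - theta) * (1 - r) -> 1 - r <= h ->
  h `^ a <= 1 + a * theta * ln h + a * (1 - theta) * (h - 1).
Proof.
move=> th rI aI rh; have h0 : 0 < h by case/andP: rI => ? ?; lra.
have hE : expR (ln h) = h by rewrite lnK.
have := @gap_ge0 a theta r (ln h) th rI aI; rewrite /gap hE => /(_ rh).
rewrite /powR gt_eqF//; lra.
Qed.

End pointwise.

(** * Expectations of products determined by rectangles *)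

Import HBNNSimple.

Section weighted_image.
Local Open Scope ereal_scope.
Context d d' (T : measurableType d) (T' : measurableType d') (R : realType).
Variables (mu : {measure set T -> \bar R}) (G : T -> R) (phi : T -> T').
Hypotheses (mG : measurable_fun setT G) (G0 : forall x, (0 <= G x)%R).
Hypothesis mphi : measurable_fun setT phi.

(** The image under [phi] of the measure with density [G]. The proofs are
    arguments so that the measure structure declared below can be inferred
    from the term. *)
Definition weighted_image (mG : measurable_fun setT G)
    (G0 : forall x, (0 <= G x)%R) (mphi : measurable_fun setT phi)
    (E : set T') : \bar R := \int[mu]_(x in phi @^-1` E) (G x)%:E.

Local Notation nu := (weighted_image mG G0 mphi).

Let mGE : measurable_fun setT (EFin \o G).
Proof. exact/measurable_EFinP. Qed.

Let nu0 : nu set0 = 0.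
Proof. by rewrite /weighted_image preimage_set0 integral_set0. Qed.

Let nu_ge0 E : 0 <= nu E.
Proof. by apply: integral_ge0 => x _; rewrite lee_fin. Qed.

Let nu_sigma_additive : semi_sigma_additive nu.
Proof.
move=> F mF tF mUF; rewrite /weighted_image preimage_bigcup.
rewrite ge0_integral_bigcup//.
- apply: is_cvg_ereal_nneg_natsum_cond => n _ _; exact: nu_ge0.
- by move=> k; rewrite -[X in measurable X]setTI; exact: mphi.
- exact: measurable_funTS.
- by move=> x _; rewrite lee_fin.
- apply/trivIsetP => i j _ _ ij; have /trivIsetP tF' := tF; rewrite -preimage_setI tF'// preimage_set0.
Qed.

HB.instance Definition _ := isMeasure.Build _ _ _ nu nu0 nu_ge0 nu_sigma_additive.

(** Linearity gives the case of simple functions, and monotone convergence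
    along an approximating sequence the general case. *)
Lemma ge0_integral_weighted_image (f : T' -> \bar R) :
  measurable_fun setT f -> (forall y, 0 <= f y) ->
  \int[nu]_y f y = \int[mu]_x ((G x)%:E * f (phi x)).
Proof.
move=> mf f0; pose f_ := nnsfun_approx measurableT mf.
have mf_phi n : measurable_fun setT (fun x => (f_ n (phi x))%:E).
  by apply/measurable_EFinP; apply: measurableT_comp.
transitivity (limn (fun n => \int[nu]_y (f_ n y)%:E)).
  rewrite -monotone_convergence//.
  - by apply: eq_integral => y _; apply/esym/cvg_lim => //; exact: cvg_nnsfun_approx.
  - by move=> n; exact/measurable_EFinP.
  - by move=> n y _; rewrite lee_fin.
  - by move=> y _ m n mn; rewrite lee_fin; exact/lefP/nd_nnsfun_approx.
transitivity (limn (fun n => \int[mu]_x ((G x)%:E * (f_ n (phi x))%:E))); last first.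
  rewrite -monotone_convergence//.
  - apply: eq_integral => x _; apply/cvg_lim => //.
    apply: cvgeZl => //.
    by apply: (cvg_nnsfun_approx measurableT mf) => //.
  - by move=> n; exact: emeasurable_funM.
  - by move=> n x _; rewrite mule_ge0// lee_fin.
  - move=> x _ m n mn; rewrite lee_wpmul2l ?lee_fin//.
    by have /lefP := nd_nnsfun_approx measurableT mf mn; exact.
congr (limn _); apply/funext => n.
have mfn r : measurable (f_ n @^-1` [set r]) by [].
transitivity (\sum_(k \in range (f_ n))
    \int[mu]_x ((G x)%:E * (k * \1_(f_ n @^-1` [set k]) (phi x))%:E)).
  under eq_integral do rewrite fimfunE -fsumEFin//.
  rewrite ge0_integral_fsum//; last 2 first.
  - by move=> y; exact/measurable_EFinP/measurable_funM.
  - by move=> y x _; rewrite nnfun_muleindic_ge0.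
  apply: eq_fsbigr => r; rewrite inE => -[y _ fyr].
  have r0 : (0 <= r)%R by rewrite -fyr.
  rewrite integralZl_indic_nnsfun// integral_indic//= setIT.
  rewrite /weighted_image integral_mkcond -ge0_integralZl_EFin//.
  - apply: eq_integral => x _; rewrite patchE indicE EFinM.
    rewrite -[x \in _]/(phi x \in f_ n @^-1` [set r]); case: ifPn => _; last by rewrite !mule0.
    by rewrite mule1 muleC.
  - by move=> x _; rewrite patchE; case: ifPn => // _; rewrite lee_fin.
  - apply/(measurable_restrictT _ _).1; last exact: measurable_funTS.
    by rewrite -[X in measurable X]setTI; exact: mphi.
rewrite -ge0_integral_fsum//.
- apply: eq_integral => x _; rewrite -ge0_mule_fsumr//; last first.
    by move=> r; rewrite EFinM nnfun_muleindic_ge0.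
  by rewrite fsumEFin// -fimfunE.
- move=> r; apply: emeasurable_funM => //; apply/measurable_EFinP.
  apply: measurable_funM => //; exact: measurableT_comp.
- by move=> r x _; rewrite mule_ge0 ?lee_fin// -lee_fin EFinM nnfun_muleindic_ge0.
Qed.

End weighted_image.

Section disintegration.
Local Open Scope ereal_scope.
Context (R : realType) d0 (Omega : measurableType d0) (P : probability Omega R).
Context d1 (T1 : measurableType d1) d2 (T2 : measurableType d2).
Variables (mu : {sigma_finite_measure set T2 -> \bar R}) (s : T1 -> T2 -> R).
Hypotheses (ms : measurable_fun setT (fun z => s z.1 z.2)).
Hypothesis s0 : forall x y, (0 <= s x y)%R.

(** The two sides of [agree F] are the integrals of [F] against the images on
    [T1 * T2] of the measures with density [U] on [Omega] and
    [V(omega) s(y | Z omega)] on [Omega * T2]. These are finite, and rectangles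
    form a pi-system that generates the sigma-algebra. *)
Lemma weighted_disintegration (U V : Omega -> R) (Z : Omega -> T1)
    (W : Omega -> T2) :
  measurable_fun setT U -> measurable_fun setT V ->
  (forall w, (0 <= U w)%R) -> (forall w, (0 <= V w)%R) ->
  measurable_fun setT Z -> measurable_fun setT W ->
  \int[P]_w (U w)%:E < +oo ->
  let agree (F : T1 * T2 -> \bar R) :=
    \int[P]_w ((U w)%:E * F (Z w, W w)) =
    \int[P]_w ((V w)%:E * \int[mu]_y ((s (Z w) y)%:E * F (Z w, y))) in
  (forall A B, measurable A -> measurable B ->
     agree (fun z => (\1_(A `*` B) z)%:E)) ->
  forall F, measurable_fun setT F -> (forall z, 0 <= F z) -> agree F.
Proof.
move=> mU mV U0 V0 mZ mW Uoo agree H F mF F0.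
pose phi1 w := (Z w, W w).
have mphi1 : measurable_fun setT phi1 by exact: measurable_fun_pair.
pose phi2 (z : Omega * T2) := (Z z.1, z.2).
have mphi2 : measurable_fun setT phi2.
  by apply: measurable_fun_pair => //; exact: measurableT_comp.
have mpair w : measurable_fun setT (fun y : T2 => (Z w, y)).
  exact: measurable_fun_pair.
pose G z := (V z.1 * s (Z z.1) z.2)%R.
have mG : measurable_fun setT G.
  apply: measurable_funM; first exact: measurableT_comp.
  exact: (measurableT_comp ms mphi2).
have G0 z : (0 <= G z)%R by rewrite mulr_ge0.
pose nu1 := weighted_image P mU U0 mphi1.
pose nu2 := weighted_image (P \x mu) mG G0 mphi2.
have int2 f : measurable_fun setT f -> (forall z, 0 <= f z) ->
    \int[nu2]_z f z =
    \int[P]_w ((V w)%:E * \int[mu]_y ((s (Z w) y)%:E * f (Z w, y))).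
  move=> mf f0; rewrite ge0_integral_weighted_image// fubini_tonelli1/=.
  - apply: eq_integral => w _; rewrite /fubini_F/= -ge0_integralZl//.
    + by apply: eq_integral => y _; rewrite /G EFinM muleA.
    + apply: emeasurable_funM.
        apply/measurable_EFinP.
        exact: (measurableT_comp ms (mpair w)).
      exact: (measurableT_comp mf (mpair w)).
    + by move=> y _; rewrite mule_ge0// lee_fin.
    + by rewrite lee_fin.
  - apply: emeasurable_funM; first exact/measurable_EFinP.
    exact: (measurableT_comp mf mphi2).
  - by move=> z; rewrite mule_ge0// lee_fin.
have nu12 E : measurable E -> nu1 E = nu2 E.
  apply: (measure_unique
      [set A `*` B | A in (@measurable _ T1) & B in (@measurable _ T2)]
      (fun _ => setT)).
  - exact: measurable_prod_measurableType.
  - move=> _ _ [A1 mA1 [A2 mA2 <-]] [B1 mB1 [B2 mB2 <-]].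
    exists (A1 `&` B1); first exact: measurableI.
    by exists (A2 `&` B2); [exact: measurableI|rewrite setXI].
  - by move=> _; exists setT => //; exists setT => //; rewrite setXTT.
  - by rewrite bigcup_const.
  - move=> _ [A mA [B mB <-]]; have mAB := measurableX mA mB.
    rewrite -(setIT (A `*` B)) -!integral_indic//.
    rewrite int2 ?ge0_integral_weighted_image//; first exact: H.
    + exact/measurable_EFinP.
    + exact/measurable_EFinP.
  - by move=> _; rewrite /nu1/= /weighted_image preimage_setT.
rewrite /agree -int2// -ge0_integral_weighted_image//.
by apply: eq_measure_integral => E mE _; exact: nu12.
Qed.

End disintegration.

Section kernel_expectation.
Local Open Scope ereal_scope.
Context (R : realType) d1 (T1 : measurableType d1) d2 (T2 : measurableType d2).
Implicit Types (mu : {sigma_finite_measure set T2 -> \bar R}) (s : T1 -> T2 -> R).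

(** The expectation of [F(x, Y)] when [Y] has density [s x] with respect to
    [mu]. *)
Definition kernel_exp mu s (F : T1 * T2 -> \bar R) x :=
  \int[mu]_y ((s x y)%:E * F (x, y)).

Lemma measurable_section d' (T : measurableType d') (F : T1 * T2 -> T) x :
  measurable_fun setT F -> measurable_fun setT (fun y => F (x, y)).
Proof.
move=> mF; have m2 : measurable_fun setT (fun y : T2 => (x, y)).
  exact: measurable_fun_pair.
exact: (measurableT_comp mF m2).
Qed.

Section one_kernel.
Variables (mu : {sigma_finite_measure set T2 -> \bar R}) (s : T1 -> T2 -> R).
Hypotheses (ms : measurable_fun [set: T1 * T2] (fun z => s z.1 z.2))
  (s0 : forall x y, (0 <= s x y)%R) (s1 : forall x, \int[mu]_y (s x y)%:E = 1).

Lemma measurable_kernel_exp F : measurable_fun setT F -> (forall z, 0 <= F z) ->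
  measurable_fun setT (kernel_exp mu s F).
Proof.
move=> mF F0.
apply: (@measurable_fun_fubini_tonelli_F _ _ _ _ _ mu (fun z => (s z.1 z.2)%:E * F z)).
- by apply: emeasurable_funM => //; exact/measurable_EFinP.
- by move=> z; rewrite mule_ge0// lee_fin.
Qed.

Lemma kernel_exp_ge0 F x : (forall z, 0 <= F z) -> 0 <= kernel_exp mu s F x.
Proof.
by move=> F0; apply: integral_ge0 => y _; rewrite mule_ge0// lee_fin.
Qed.

Lemma kernel_exp_indic A B x : measurable A -> measurable B ->
  kernel_exp mu s (fun z => (\1_(A `*` B) z)%:E) x =
  (\1_A x)%:E * \int[mu]_(y in B) (s x y)%:E.
Proof.
move=> mA mB; rewrite /kernel_exp [in RHS]integral_mkcond epatch_indic.
rewrite -ge0_integralZl//; last 2 first.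
- apply: emeasurable_funM; last exact/measurable_EFinP.
  by apply/measurable_EFinP; exact: (measurable_section (F := fun z => s z.1 z.2)).
- by move=> y _; rewrite mule_ge0// lee_fin.
apply: eq_integral => y _ /=; rewrite muleCA; congr (_ * _).
by rewrite -EFinM !indicE in_setX -natrM mulnb.
Qed.

Lemma kernel_exp_indic_le1 A B x : measurable A -> measurable B ->
  kernel_exp mu s (fun z => (\1_(A `*` B) z)%:E) x <= 1.
Proof.
move=> mA mB; have mAB := measurableX mA mB; rewrite -(s1 x).
apply: ge0_le_integral => //.
- by move=> y _; rewrite mule_ge0// lee_fin.
- apply: emeasurable_funM; apply/measurable_EFinP.
    exact: (measurable_section (F := fun z => s z.1 z.2)).
  exact: measurable_section.
- apply/measurable_EFinP; exact: (measurable_section (F := fun z => s z.1 z.2)).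
- by move=> y _; rewrite -[leRHS]mule1 lee_wpmul2l ?lee_fin// indicE; case: (_ \in _).
Qed.

End one_kernel.

Context {disp : measure_display} {Omega : measurableType disp}.
Variables (P : probability Omega R) (n : nat).
Variables (mu : 'I_n -> {sigma_finite_measure set T2 -> \bar R}).
Variables (s : 'I_n -> T1 -> T2 -> R) (Z : 'I_n -> Omega -> T1) (W : 'I_n -> Omega -> T2).
Hypotheses (ms : forall i, measurable_fun [set: T1 * T2] (fun z => s i z.1 z.2))
  (s0 : forall i x y, (0 <= s i x y)%R)
  (s1 : forall i x, \int[mu i]_y (s i x y)%:E = 1)
  (mZ : forall i, measurable_fun setT (Z i)) (mW : forall i, measurable_fun setT (W i)).

Let cexp i := kernel_exp (mu i) (s i).

Hypothesis rectangles : forall (A : 'I_n -> set T1) (B : 'I_n -> set T2),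
  (forall i, measurable (A i)) -> (forall i, measurable (B i)) ->
  \int[P]_w (\prod_i (\1_(A i `*` B i) (Z i w, W i w) : R))%:E =
  \int[P]_w \prod_i cexp i (fun z => (\1_(A i `*` B i) z)%:E) (Z i w).

Let factor i (F : T1 * T2 -> R) := [/\ measurable_fun setT F,
  forall z, (0 <= F z)%R & exists c : R, forall x, cexp i (EFin \o F) x <= c%:E].

Let rectangle (F : T1 * T2 -> R) :=
  exists A B, [/\ measurable A, measurable B & F = \1_(A `*` B)].

Let kap i (F : T1 * T2 -> R) x := fine (cexp i (EFin \o F) x).

Let kapE i F x : factor i F -> cexp i (EFin \o F) x = (kap i F x)%:E.
Proof.
case=> mF F0 [c Fc]; rewrite /kap fineK// ge0_fin_numE.
  exact: le_lt_trans (Fc x) (ltry _).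
by apply: kernel_exp_ge0 => // z; rewrite lee_fin.
Qed.

Let kap0 i F x : factor i F -> (0 <= kap i F x)%R.
Proof.
move=> fF; rewrite -lee_fin -kapE//; case: fF => mF F0 _.
by apply: kernel_exp_ge0 => // z; rewrite lee_fin.
Qed.

Let mkap i F : factor i F -> measurable_fun setT (kap i F).
Proof.
move=> fF; apply/measurable_EFinP.
have -> : EFin \o kap i F = cexp i (EFin \o F).
  by apply/funext => x; rewrite /= kapE.
case: fF => mF F0 _; apply: measurable_kernel_exp => //.
exact/measurable_EFinP.
Qed.

Let rectangle_factor i F : rectangle F -> factor i F.
Proof.
move=> [A [B [mA mB ->]]]; have mAB := measurableX mA mB; split.
- by [].
- by move=> z; rewrite indicE.
by exists 1%R => x; exact: kernel_exp_indic_le1.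
Qed.

Let mFZW F i : measurable_fun setT F -> measurable_fun setT (fun w => F (Z i w, W i w) : R).
Proof.
move=> mF; apply: (measurableT_comp mF).
by apply: measurable_fun_pair.
Qed.

Let agree (F : 'I_n -> T1 * T2 -> R) :=
  \int[P]_w (\prod_i F i (Z i w, W i w))%:E =
  \int[P]_w (\prod_i kap i (F i) (Z i w))%:E.

Let agree_rectangles F : (forall i, rectangle (F i)) -> agree F.
Proof.
move=> /choice[A /choice[B AB]].
have mA i : measurable (A i) by case: (AB i).
have mB i : measurable (B i) by case: (AB i).
have FE i : F i = \1_(A i `*` B i) by case: (AB i).
rewrite /agree; under eq_integral do under eq_bigr do rewrite FE.
rewrite rectangles//; apply: eq_integral => w _; rewrite -prodEFin.
apply: eq_bigr => i _; rewrite -kapE; first by rewrite FE.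
by apply: rectangle_factor; exists (A i), (B i).
Qed.

(** The factors are moved from indicators of rectangles to general functions one index at
    a time, by uniqueness of finite measures; the uniform bound on the
    conditional expectations keeps all the measures finite. *)
Let agree_upto k F : (forall i, factor i (F i)) ->
  (forall i : 'I_n, (k <= i)%N -> rectangle (F i)) -> agree F.
Proof.
elim: k F => [|k IH] F fF rF; first by apply: agree_rectangles => i; exact: rF.
have [nk|kn] := leqP n k.
  apply: IH => // i ki; have := leq_trans nk ki; by rewrite leqNgt ltn_ord.
pose i0 := Ordinal kn.
pose U w := (\prod_(i | i != i0) F i (Z i w, W i w))%R.
pose V w := (\prod_(i | i != i0) kap i (F i) (Z i w))%R.
pose Fr H i := if i == i0 then H else F i.
have prodF H w : (\prod_i Fr H i (Z i w, W i w) = H (Z i0 w, W i0 w) * U w)%R.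
  rewrite (bigD1 i0)//= /Fr eqxx; congr (_ * _)%R.
  by apply: eq_bigr => i /negbTE ->.
have prodK H w : (\prod_i kap i (Fr H i) (Z i w) = kap i0 H (Z i0 w) * V w)%R.
  rewrite (bigD1 i0)//= /Fr eqxx; congr (_ * _)%R.
  by apply: eq_bigr => i /negbTE ->.
have FrF : Fr (F i0) = F by apply/funext => i; rewrite /Fr; case: eqP => // ->.
have agr A B : measurable A -> measurable B -> agree (Fr (\1_(A `*` B))).
  move=> mA mB; apply: IH => i.
    rewrite /Fr; case: eqP => // _; apply: rectangle_factor.
    by exists A, B.
  rewrite /Fr; case: eqP => [_ _|/eqP ii0 ki]; first by exists A, B.
  by apply: rF; rewrite ltn_neqAle ki andbT eq_sym.
have mU : measurable_fun setT U.
  rewrite /U; under eq_fun do rewrite -big_filter.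
  by apply: measurable_prod => i _; case: (fF i) => mF _ _; exact: mFZW.
have mV : measurable_fun setT V.
  rewrite /V; under eq_fun do rewrite -big_filter.
  apply: measurable_prod => i _.
  exact: (measurableT_comp (mkap (fF i))).
have U0 w : (0 <= U w)%R by apply: prodr_ge0 => i _; case: (fF i).
have V0 w : (0 <= V w)%R by apply: prodr_ge0 => i _; exact: kap0.
have fT : factor i0 (\1_(setT `*` setT)) by apply: rectangle_factor; exists setT, setT.
have Uoo : \int[P]_w (U w)%:E < +oo.
  have := agr _ _ measurableT measurableT; rewrite /agree.
  under eq_integral do rewrite prodF setXTT indicT mul1r.
  move=> ->; under eq_integral do rewrite prodK.
  have [c cV] : exists c : R, forall w, (kap i0 (\1_(setT `*` setT)) (Z i0 w) * V w <= c)%R.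
    have : forall i, exists c : R, forall x, (kap i (Fr (\1_(setT `*` setT)) i) x <= c)%R.
      move=> i; have fi : factor i (Fr (\1_(setT `*` setT)) i).
        by rewrite /Fr; case: eqP => [->|].
      case: (fi) => _ _ [c hc]; exists c => x.
      by rewrite -lee_fin -kapE.
    move=> /choice[c hc]; exists (\prod_i c i)%R => w; rewrite -prodK.
    apply: ler_prod => i _; rewrite hc andbT; apply: kap0.
    by rewrite /Fr; case: eqP => [->|_].
  apply: (@le_lt_trans _ _ (\int[P]_w c%:E)).
    apply: ge0_le_integral => //.
    - by move=> w _; rewrite lee_fin mulr_ge0// kap0.
    - apply/measurable_EFinP/measurable_funM => //.
      exact: (measurableT_comp (mkap fT)).
    - by move=> w _; rewrite lee_fin.
  by rewrite integral_cst//= probability_setT mule1 ltry.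
have := @weighted_disintegration R _ Omega P _ _ _ _ (mu i0) (s i0) (ms i0) (s0 i0)
  U V (Z i0) (W i0) mU mV U0 V0 (mZ i0) (mW i0) Uoo.
case: (fF i0) => mF0 F00 _.
move=> /(_ _ (EFin \o F i0)) h.
rewrite /agree -FrF; under eq_integral do rewrite prodF mulrC EFinM.
under [RHS]eq_integral do rewrite prodK mulrC EFinM -kapE//.
apply: h => //.
- move=> A B mA mB; have := agr A B mA mB; rewrite /agree.
  have fAB : factor i0 (\1_(A `*` B)) by apply: rectangle_factor; exists A, B.
  under eq_integral do rewrite prodF mulrC EFinM.
  by under [RHS]eq_integral do rewrite prodK mulrC EFinM -kapE//.
- exact/measurable_EFinP.
Qed.

(** This covers both independence assumptions on a sample: that of the
    responses given the covariates, with [s] their conditional density, and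
    that of the covariates, with [T1] a one-point space and [mu i] their laws. *)
Lemma expectation_prod_kernel (F : 'I_n -> T1 * T2 -> R) :
  (forall i, measurable_fun setT (F i)) -> (forall i z, (0 <= F i z)%R) ->
  (forall i, exists c : R, forall x, kernel_exp (mu i) (s i) (EFin \o F i) x <= c%:E) ->
  \int[P]_w (\prod_i F i (Z i w, W i w))%:E =
  \int[P]_w (\prod_i fine (kernel_exp (mu i) (s i) (EFin \o F i) (Z i w)))%:E.
Proof.
move=> mF F0 Fc; have fF i : factor i (F i).
  by split; [exact: mF|exact: F0|exact: Fc].
by apply: (agree_upto (k := n) fF) => i; rewrite leqNgt ltn_ord.
Qed.

End kernel_expectation.

(** * Relative entropy to a mixture *)

Section real_integrals.
Context d (T : measurableType d) (R : realType) (mu : {measure set T -> \bar R}).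
Implicit Types f g : T -> R.

Lemma measurable_funV g : (forall y, 0 <= g y) -> measurable_fun setT g ->
  measurable_fun setT (fun y => (g y)^-1).
Proof.
move=> g0 mg; under eq_fun do rewrite -powR_inv1//.
exact: (measurableT_comp (measurable_powR _)).
Qed.

Lemma ge0_integrable g : measurable_fun setT g -> (forall y, 0 <= g y) ->
  (\int[mu]_y (g y)%:E < +oo)%E -> mu.-integrable setT (EFin \o g).
Proof.
move=> mg g0 goo; apply/integrableP; split; first exact/measurable_EFinP.
by under eq_integral => y _ do rewrite /= ger0_norm//.
Qed.

Lemma normr_le_integrable f g : measurable_fun setT f ->
  (forall y, `|f y| <= g y) -> mu.-integrable setT (EFin \o g) ->
  mu.-integrable setT (EFin \o f).
Proof.
move=> mf fg; apply: le_integrable => //; first exact/measurable_EFinP.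
by move=> y _; rewrite /= lee_fin (le_trans (fg y))// ler_norm.
Qed.

Lemma RintegralE f : mu.-integrable setT (EFin \o f) ->
  (\int[mu]_y (f y)%:E)%E = (\int[mu]_y f y)%:E.
Proof. by move=> fi; rewrite /Rintegral fineK// integrable_fin_num. Qed.

End real_integrals.

Section relative_entropy.
Context d (T : measurableType d) (R : realType) (mu : {measure set T -> \bar R}).
Variable f : T -> R.
Hypotheses (mf : measurable_fun setT f) (f0 : forall y, 0 <= f y).
Hypothesis f1 : (\int[mu]_y (f y)%:E = 1)%E.

Lemma kl_integrandE (a b : R) : a = 0 \/ b != 0 ->
  kl_integrand a b = (a * ln (a / b))%:E.
Proof.
rewrite /kl_integrand => -[->|/negbTE ->]; first by rewrite eqxx mul0r.
by case: eqVneq => // ->; rewrite mul0r.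
Qed.

Lemma measurable_entropy_integrand (g : T -> R) : measurable_fun setT g ->
  (forall y, 0 <= g y) -> measurable_fun setT (fun y => f y * ln (f y / g y)).
Proof.
move=> mg g0; apply: measurable_funM => //.
apply: (measurableT_comp (@measurable_ln R)); apply: measurable_funM => //.
exact: measurable_funV.
Qed.

Lemma sub_le_entropy_integrand (a b : R) : 0 <= a -> 0 <= b -> a = 0 \/ b != 0 ->
  a - b <= a * ln (a / b).
Proof.
move=> a0 b0 [->|bn0]; first by rewrite mul0r sub0r oppr_le0.
move: a0; rewrite le_eqVlt => /predU1P[<-|a0]; first by rewrite mul0r sub0r oppr_le0.
have {}b0 : 0 < b by rewrite lt_neqAle eq_sym bn0.
have h : ln (b / a) <= b / a - 1.
  have := @le_ln1Dx R (b / a - 1).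
  by rewrite addrCA subrr addr0; apply; rewrite ltrBrDr addNr divr_gt0.
rewrite -[a / b]invf_div lnV ?posrE ?divr_gt0// mulrN lerNr opprB.
by rewrite (le_trans (ler_wpM2l (ltW a0) h))// mulrBr mulr1 mulrC divfK ?gt_eqF.
Qed.

Section divergence.
Variable g : T -> R.
Hypotheses (mg : measurable_fun setT g) (g0 : forall y, 0 <= g y).
Hypothesis fg : forall y, f y = 0 \/ g y != 0.
Hypothesis g1 : (\int[mu]_y (g y)%:E <= 1)%E.

Let phi y := f y * ln (f y / g y).

Let mphi : measurable_fun setT (EFin \o phi).
Proof. by apply/measurable_EFinP; exact: measurable_entropy_integrand. Qed.

(** By [a - b <= a ln (a / b)], the negative part of the integrand is at most
    [g]. *)
Lemma entropy_funeneg_le : (\int[mu]_y (EFin \o phi)^\- y <= 1)%E.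
Proof.
apply: le_trans g1; apply: ge0_le_integral => //.
- exact: measurable_funeneg.
- exact/measurable_EFinP.
move=> y _; rewrite funenegE /= -EFin_max lee_fin ge_max g0 andbT lerNl.
apply: le_trans (sub_le_entropy_integrand _ _ (fg y)) => //.
by rewrite lerBrDr addrC subrr.
Qed.

(** The negative part has a finite integral. If that of the positive part is
    infinite, so is the divergence; otherwise [f - g <= f ln (f / g)] can be
    integrated. *)
Lemma divergence_ge0 : (0 <= \int[mu]_y (phi y)%:E)%E.
Proof.
have fi : mu.-integrable setT (EFin \o f) by apply: ge0_integrable => //; rewrite f1 ltry.
have gi : mu.-integrable setT (EFin \o g).
  by apply: ge0_integrable => //; rewrite (le_lt_trans g1) ?ltry.
have [phioo|phioo] := ltP (\int[mu]_y (EFin \o phi)^\+ y)%E +oo%E.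
  have phii : mu.-integrable setT (EFin \o phi).
    apply/integrableP; split => //.
    rewrite (eq_integral (fun y => (EFin \o phi)^\+ y + (EFin \o phi)^\- y)%E).
      rewrite ge0_integralD//; [|exact: measurable_funepos|exact: measurable_funeneg].
      by rewrite lte_add_pinfty// (le_lt_trans entropy_funeneg_le)// ltry.
    by move=> y _; rewrite -[RHS]/(((EFin \o phi)^\+ \+ (EFin \o phi)^\-)%E y) -fune_abse.
  rewrite RintegralE// lee_fin.
  have : \int[mu]_y (f y - g y) <= \int[mu]_y phi y.
    apply: le_Rintegral => //; first exact: (integrableB _ fi gi).
    by move=> y _; exact: sub_le_entropy_integrand.
  apply: le_trans; rewrite RintegralB// subr_ge0 -lee_fin -!RintegralE//.
  by rewrite f1.
rewrite leye_eq in phioo; rewrite integralE (eqP phioo).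
rewrite -(@fineK _ (\int[mu]_y (EFin \o phi)^\- y)%E) ?addye ?leey//.
rewrite ge0_fin_numE ?(le_lt_trans entropy_funeneg_le) ?ltry//.
exact: integral_ge0.
Qed.

End divergence.

Section mixture.
Variables rho delta : R.
Hypotheses (rho01 : 0 < rho < 1) (delta0 : 0 <= delta).

Definition mix (t : T -> R) y := (1 - rho) * f y + rho * t y.

Definition mix_entropy t := \int[mu]_y (f y * ln (f y / mix t y)).

Section one_mixture.
Variable t : T -> R.
Hypotheses (mt : measurable_fun setT t) (t0 : forall y, 0 <= t y).
Hypothesis t1 : (\int[mu]_y (t y)%:E <= (1 + delta)%:E)%E.

Local Notation q := (mix t).
Local Notation phi := (fun y => f y * ln (f y / q y)).

Lemma mix_ge0 y : 0 <= q y.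
Proof. by case/andP: rho01 => r0 r1; rewrite addr_ge0// mulr_ge0// ?subr_ge0 ltW. Qed.

Lemma le_mix y : (1 - rho) * f y <= q y.
Proof. by case/andP: rho01 => r0 r1; rewrite lerDl mulr_ge0// ltW. Qed.

Lemma mix_neq0 y : f y = 0 \/ q y != 0.
Proof.
have [/eqP|fn0] := boolP (f y == 0); [by left|right].
have fp : 0 < f y by rewrite lt_neqAle eq_sym fn0 /=.
by rewrite gt_eqF// (lt_le_trans _ (le_mix y))// mulr_gt0// subr_gt0; case/andP: rho01.
Qed.

Lemma measurable_mix : measurable_fun setT q.
Proof. by apply: measurable_funD; apply: measurable_funM => //; exact: measurable_cst. Qed.

Lemma integrable_density : mu.-integrable setT (EFin \o f).
Proof. by apply: ge0_integrable => //; rewrite f1 ltry. Qed.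

Lemma integrable_component : mu.-integrable setT (EFin \o t).
Proof. by apply: ge0_integrable => //; rewrite (le_lt_trans t1)// ltry. Qed.

Let fi := integrable_density.
Let ti := integrable_component.

Lemma integrable_mix : mu.-integrable setT (EFin \o q).
Proof.
exact: (integrableD _ (integrableZl _ _ fi) (integrableZl _ _ ti)).
Qed.

Lemma Rintegral_mix : \int[mu]_y q y = (1 - rho) + rho * \int[mu]_y t y.
Proof.
rewrite RintegralD//; [|exact: (integrableZl _ _ fi)|exact: (integrableZl _ _ ti)].
by rewrite !RintegralZl// {1}/Rintegral f1 mulr1.
Qed.

Lemma mix_integrand_ge y : f y - q y <= phi y.
Proof.
by apply: sub_le_entropy_integrand => //; [exact: mix_ge0|exact: mix_neq0].
Qed.

Lemma mix_integrand_le y : phi y <= - ln (1 - rho) * f y.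
Proof.
case/andP: (rho01) => r0 r1.
have := f0 y; rewrite le_eqVlt => /predU1P[<-|fp]; first by rewrite mul0r mulr0.
rewrite mulrC ler_pM2r// -lnV ?posrE ?subr_gt0//.
have qp : 0 < q y by rewrite (lt_le_trans _ (le_mix y))// mulr_gt0// subr_gt0.
rewrite ler_ln ?posrE ?divr_gt0 ?invr_gt0 ?subr_gt0//.
by rewrite ler_pdivrMr// mulrC ler_pdivlMr ?subr_gt0// mulrC le_mix.
Qed.

(** As [q >= (1 - rho) f], the integrand lies between [f - q] and
    [- ln (1 - rho) f]. *)
Lemma mix_entropy_integrable : mu.-integrable setT (EFin \o phi).
Proof.
case/andP: (rho01) => r0 r1.
apply: (@normr_le_integrable _ _ _ _ _ (fun y => - ln (1 - rho) * f y + q y)).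
- by apply: measurable_entropy_integrand; [exact: measurable_mix|exact: mix_ge0].
- move=> y.
  have lnr : 0 <= - ln (1 - rho) by rewrite oppr_ge0 ln_le0// lerBlDr lerDl ltW.
  have := mix_integrand_ge y; have := mix_integrand_le y.
  have := mix_ge0 y; have := f0 y; rewrite ler_norml; nra.
- exact: (integrableD _ (integrableZl _ _ fi) integrable_mix).
Qed.

Lemma Rintegral_mix_le : \int[mu]_y q y <= 1 + rho * delta.
Proof.
case/andP: (rho01) => r0 _; rewrite Rintegral_mix.
have t1R : \int[mu]_y t y <= 1 + delta by rewrite -lee_fin -RintegralE.
have := ler_wpM2l (ltW r0) t1R; lra.
Qed.

Lemma mix_entropy_ge : - (rho * delta) <= mix_entropy t.
Proof.
have : \int[mu]_y (f y - q y) <= mix_entropy t.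
  apply: le_Rintegral => //; [exact: (integrableB _ fi integrable_mix)|
    exact: mix_entropy_integrable|by move=> y _; exact: mix_integrand_ge].
apply: le_trans; rewrite RintegralB//; last exact: integrable_mix.
rewrite {1}/Rintegral f1 /=; have := Rintegral_mix_le; lra.
Qed.

Lemma mix_entropy_le : mix_entropy t <= - ln (1 - rho).
Proof.
have : mix_entropy t <= \int[mu]_y (- ln (1 - rho) * f y).
  apply: le_Rintegral => //; [exact: mix_entropy_integrable|
    exact: (integrableZl _ _ fi)|by move=> y _; exact: mix_integrand_le].
by move=> /le_trans; apply; rewrite RintegralZl// {1}/Rintegral f1 mulr1.
Qed.

Lemma mix_entropyE :
  (\int[mu]_y kl_integrand (f y) (q y) = (mix_entropy t)%:E)%E.
Proof.
rewrite -RintegralE; last exact: mix_entropy_integrable.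
by apply: eq_integral => y _; rewrite kl_integrandE//; exact: mix_neq0.
Qed.

(** The pointwise bound on powers, applied to [h = q / f >= 1 - rho] and
    integrated against [f]: the logarithm gives the entropy, and the affine
    part the excess of the mass of [q] over 1, at most [rho delta]. *)
Lemma mix_power_moment a theta : 0 < theta < 1 ->
  0 <= a <= (1 - theta) * (1 - rho) ->
  (\int[mu]_y (f y * (q y / f y) `^ a)%:E <=
   (1 + (a * delta - a * theta * mix_entropy t))%:E)%E.
Proof.
move=> th aI; case/andP: (rho01) => r0 r1; case/andP: (th) => th0 th1.
case/andP: (aI) => a0 ale.
pose B y := f y + (- (a * theta) * phi y + a * (1 - theta) * (q y - f y)).
have qfi : mu.-integrable setT (EFin \o (fun y => q y - f y)).
  exact: (integrableB _ integrable_mix fi).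
have phii := mix_entropy_integrable.
have Bi2 : mu.-integrable setT (EFin \o
    (fun y => - (a * theta) * phi y + a * (1 - theta) * (q y - f y))).
  exact: (integrableD _ (integrableZl _ _ phii) (integrableZl _ _ qfi)).
have Bi : mu.-integrable setT (EFin \o B) by exact: (integrableD _ fi Bi2).
have leB y : f y * (q y / f y) `^ a <= B y.
  have := f0 y; rewrite le_eqVlt => /predU1P[fy0|fp].
    rewrite /B -fy0 !mul0r mulr0 !add0r subr0.
    by rewrite mulr_ge0 ?mix_ge0// mulr_ge0// subr_ge0 ltW.
  have qp : 0 < q y by rewrite (lt_le_trans _ (le_mix y))// mulr_gt0// subr_gt0.
  have := @powR_le_ln_affine R a theta rho (q y / f y) th rho01 aI.
  rewrite ler_pdivlMr// => /(_ (le_mix y)) /(ler_wpM2l (ltW fp)).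
  move=> /le_trans; apply; rewrite /B -[f y / q y]invf_div lnV ?posrE ?divr_gt0//.
  rewrite le_eqVlt; apply/orP; left; apply/eqP.
  by field; rewrite gt_eqF.
have mq : measurable_fun setT (fun y => f y * (q y / f y) `^ a).
  apply: measurable_funM => //; apply: (measurableT_comp (measurable_powR _)).
  by apply: measurable_funM; [exact: measurable_mix|exact: measurable_funV].
apply: (@le_trans _ _ (\int[mu]_y (B y)%:E)%E).
  apply: ge0_le_integral => //.
  - by move=> y _; rewrite lee_fin mulr_ge0// powR_ge0.
  - exact/measurable_EFinP.
  - by case/integrableP : Bi.
  - by move=> y _; rewrite lee_fin.
rewrite RintegralE// lee_fin /B RintegralD// RintegralD//; last 2 first.
- exact: (integrableZl _ _ phii).
- exact: (integrableZl _ _ qfi).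
rewrite !RintegralZl// RintegralB//; last exact: integrable_mix.
have f1R : \int[mu]_y f y = 1 by rewrite /Rintegral f1.
rewrite f1R /mix_entropy.
have := Rintegral_mix_le; move: (\int[mu]_y q y) (\int[mu]_y phi y) => I K I1.
have I1' : rho * delta <= delta by rewrite ler_piMl// ltW.
have a1t : 0 <= a * (1 - theta) by rewrite mulr_ge0// subr_ge0 ltW.
have : a * (1 - theta) * (I - 1) <= a * (1 - theta) * delta.
  by apply: ler_wpM2l => //; lra.
have : 0 <= a * theta * delta.
  by rewrite mulr_ge0// mulr_ge0// ltW.
lra.
Qed.

End one_mixture.

(** With [q] and [q'] the two mixtures, [ln (q / q') <= rho (t - t') / q'] and
    [f / q' <= 1 / (1 - rho)], while [t - t'] has integral at most [delta]. *)
Lemma mix_entropy_le_dominated (t t' : T -> R) : measurable_fun setT t ->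
  (\int[mu]_y (t y)%:E <= (1 + delta)%:E)%E ->
  measurable_fun setT t' -> (forall y, 0 <= t' y) ->
  (\int[mu]_y (t' y)%:E = 1)%E -> (forall y, t' y <= t y) ->
  mix_entropy t' <= mix_entropy t + rho * delta / (1 - rho).
Proof.
move=> mt t1 mt' t'0 t'1 tt'; case/andP: (rho01) => r0 r1.
have t0 y : 0 <= t y by apply: le_trans (tt' y).
have t'1' : (\int[mu]_y (t' y)%:E <= (1 + delta)%:E)%E by rewrite t'1 lee_fin lerDl.
have phii := mix_entropy_integrable mt t0 t1.
have phii' := mix_entropy_integrable mt' t'0 t'1'.
have ti := integrable_component mt t0 t1.
have ti' := integrable_component mt' t'0 t'1'.
have tti : mu.-integrable setT (EFin \o (fun y => t y - t' y)).
  exact: (integrableB _ ti ti').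
have step : mix_entropy t' <= \int[mu]_y
    (f y * ln (f y / mix t y) + rho / (1 - rho) * (t y - t' y)).
  apply: le_Rintegral => //.
    exact: (integrableD _ phii (integrableZl _ _ tti)).
  move=> y _; have := f0 y; rewrite le_eqVlt => /predU1P[<-|fp].
    by rewrite !mul0r add0r mulr_ge0 ?subr_ge0// divr_ge0 ?subr_ge0 ?ltW//.
  have qp : 0 < mix t y by rewrite (lt_le_trans _ (le_mix t0 y))// mulr_gt0// subr_gt0.
  have q'p : 0 < mix t' y by rewrite (lt_le_trans _ (le_mix t'0 y))// mulr_gt0// subr_gt0.
  rewrite -lerBlDl -mulrBr -ln_div ?posrE ?divr_gt0//.
  have -> : f y / mix t' y / (f y / mix t y) = mix t y / mix t' y.
    by field; rewrite !gt_eqF.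
  have h : ln (mix t y / mix t' y) <= mix t y / mix t' y - 1.
    have := @le_ln1Dx R (mix t y / mix t' y - 1).
    by rewrite addrCA subrr addr0; apply; rewrite ltrBrDr addNr divr_gt0.
  apply: le_trans (ler_wpM2l (ltW fp) h) _.
  have -> : f y * (mix t y / mix t' y - 1) = f y / mix t' y * (rho * (t y - t' y)).
    rewrite -[in X in _ = _ * X](addrK ((1 - rho) * f y) (rho * _)) /mix.
    by field; rewrite gt_eqF.
  rewrite [rho / _]mulrC -[in leRHS]mulrA; apply: ler_wpM2r.
    by rewrite mulr_ge0 ?subr_ge0// ltW.
  by rewrite ler_pdivrMr// mulrC ler_pdivlMr ?subr_gt0// mulrC le_mix.
apply: le_trans step _.
rewrite RintegralD//; last exact: (integrableZl _ _ tti).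
rewrite lerD2l RintegralZl// RintegralB//.
have -> : \int[mu]_y t' y = 1 by rewrite /Rintegral t'1.
rewrite [leRHS]mulrAC; apply: ler_wpM2l; first by rewrite divr_ge0 ?subr_ge0 ?ltW.
by rewrite lerBlDl -lee_fin -RintegralE.
Qed.

Lemma mix_entropy_ge0 (t : T -> R) : measurable_fun setT t -> (forall y, 0 <= t y) ->
  (\int[mu]_y (t y)%:E = 1)%E -> 0 <= mix_entropy t.
Proof.
move=> mt t0 t1.
have t1' : (\int[mu]_y (t y)%:E <= (1 + delta)%:E)%E by rewrite t1 lee_fin lerDl.
rewrite -lee_fin /mix_entropy -RintegralE; last exact: mix_entropy_integrable.
apply: divergence_ge0; [exact: measurable_mix|exact: mix_ge0|exact: mix_neq0|].
rewrite RintegralE; last exact: integrable_mix.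
rewrite lee_fin Rintegral_mix//.
have -> : \int[mu]_y t y = 1 by rewrite /Rintegral t1.
by rewrite mulr1 subrK.
Qed.

End mixture.
End relative_entropy.

(** * Gaussian integrals *)

Section gaussian_integral.
Variable R : realType.
Local Notation lambda := (@lebesgue_measure R).

(** The two measures are the same set function on two copies of the real line
    that carry the same sigma-algebra under different displays. *)
Lemma integral_lebesgue1 (f : R -> \bar R) : measurable_fun setT f ->
  (forall z, 0 <= f z)%E ->
  (\int[@lebesgue1 R]_z f z = \int[lambda]_z f z)%E.
Proof.
move=> mf f0.
have mid : measurable_fun setT (fun x : measurableTypeR R => x : R).
  by move=> _ A mA; rewrite setTI.
rewrite -[RHS](@ge0_integral_pushforward _ _ _ _ R _ mid lambda setT f)//.
Qed.

Lemma integral_lebesgue_tupleS q (f : q.+1.-tuple R -> \bar R) :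
  measurable_fun setT f -> (forall t, 0 <= f t)%E ->
  (\int[lebesgue_tuple R q.+1]_t f t =
   \int[lebesgue_tuple R q]_t \int[lambda]_z f (Defs.cons_tuple (z : R, t)))%E.
Proof.
move=> mf f0 /=.
rewrite ge0_integral_pushforward//; last exact: measurable_cons_tuple.
rewrite preimage_setT (@fubini_tonelli2 _ _ _ _ _ (@lebesgue1 R) (lebesgue_tuple R q))//=.
  have mf2 := measurableT_comp mf (@measurable_cons_tuple R q).
  apply: eq_integral => t _; rewrite /fubini_G /= integral_lebesgue1//.
  have m2 : measurable_fun setT (fun z : R => (z, t)) by exact: measurable_fun_pair.
  exact: (measurableT_comp mf2 m2).
exact: (measurableT_comp mf (@measurable_cons_tuple R q)).
Qed.

Lemma measurable_expR_sqr (alpha c : R) : measurable_fun setT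
  (fun z : measurableTypeR R => (expR (- (alpha * (z - c) ^+ 2 / 2)))%:E).
Proof.
apply/measurable_EFinP; apply: measurableT_comp => //.
apply: measurableT_comp => //; apply: measurable_funM => //.
apply: measurable_funM => //; apply: measurable_funX => //.
exact: measurable_funB.
Qed.

Lemma integral_expR_sqr (alpha c : R) : 0 < alpha ->
  (\int[lambda]_z (expR (- (alpha * (z - c) ^+ 2 / 2)))%:E =
   (Num.sqrt (2 * pi / alpha))%:E)%E.
Proof.
move=> a0; pose sigma := Num.sqrt alpha^-1.
have s2 : sigma ^+ 2 = alpha^-1 by rewrite sqr_sqrtr// invr_ge0 ltW.
have sn0 : sigma != 0 by rewrite gt_eqF// sqrtr_gt0 invr_gt0.
have peak0 : 0 < Num.sqrt (2 * pi / alpha).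
  by rewrite sqrtr_gt0 divr_gt0// mulr_gt0// pi_gt0.
have := integral_normal_pdf c sigma.
under eq_integral => z _.
  rewrite normal_pdfE// /normal_peak /normal_fun s2.
  have -> : alpha^-1 * pi *+ 2 = 2 * pi / alpha by rewrite -mulr_natr; ring.
  have -> : - (z - c) ^+ 2 / (alpha^-1 *+ 2) = - (alpha * (z - c) ^+ 2 / 2).
    by rewrite -mulr_natr; field; rewrite gt_eqF.
  rewrite EFinM.
  over.
rewrite ge0_integralZl//; last exact: measurable_expR_sqr.
move/(congr1 (mule (Num.sqrt (2 * pi / alpha))%:E)).
by rewrite mule1 muleA -EFinM divff ?gt_eqF// mul1e.
Qed.

End gaussian_integral.

Section quadratic_form.
Variable R : realType.

Definition qform p (Q : 'M[R]_p) (v : 'cV[R]_p) : R := (v^T *m Q *m v) 0 0.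

Definition posdef p (Q : 'M[R]_p) := Q^T = Q /\ forall v, v != 0 -> 0 < qform Q v.

Section schur.
Variables (p : nat) (Q : 'M[R]_(1 + p)).
Hypothesis pdQ : posdef Q.

Definition pivot := ulsubmx Q 0 0.
Definition pivot_col : 'cV[R]_p := dlsubmx Q.
Definition schur : 'M[R]_p :=
  drsubmx Q - pivot^-1 *: (pivot_col *m pivot_col^T).

Let QE : Q = block_mx pivot%:M pivot_col^T pivot_col (drsubmx Q).
Proof.
rewrite -[LHS]submxK; congr block_mx; first exact: mx11_scalar.
by rewrite -[in LHS](proj1 pdQ) -trmx_dlsub.
Qed.

Let qformE (z : R) w : qform Q (col_mx z%:M w) =
  pivot * z ^+ 2 + z * (pivot_col^T *m w) 0 0 *+ 2 + qform (drsubmx Q) w.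
Proof.
rewrite [in LHS]/qform [in LHS]QE tr_col_mx mul_row_block mul_row_col.
have -> : (z%:M : 'M[R]_1)^T = z%:M by rewrite tr_scalar_mx.
rewrite !mul_scalar_mx !mul_mx_scalar mulmxDl -!scalemxAl !mxE.
have -> : \sum_j w^T 0 j * pivot_col j 0 = \sum_j pivot_col^T 0 j * w j 0.
  by apply: eq_bigr => j _; rewrite !mxE mulrC.
rewrite mulr1n mulr2n /qform mxE; ring.
Qed.

Lemma pivot_gt0 : 0 < pivot.
Proof.
have := (proj2 pdQ) (col_mx 1%:M 0); rewrite qformE mulmx0 expr1n mulr1 mxE.
rewrite /qform mulmx0 !mxE mulr0 mul0rn !addr0; apply.
apply/eqP => /matrixP/(_ (lshift p 0) 0); rewrite col_mxEu !mxE /=.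
by move/eqP; rewrite oner_eq0.
Qed.

(** Completing the square in the first coordinate. *)
Lemma qform_schur (z : R) w : qform Q (col_mx z%:M w) =
  pivot * (z + pivot^-1 * (pivot_col^T *m w) 0 0) ^+ 2 + qform schur w.
Proof.
have sub_entry (A B : 'M[R]_1) c : (A - c *: B) 0 0 = A 0 0 - c * B 0 0.
  by rewrite !mxE.
have bE : (w^T *m pivot_col) 0 0 = (pivot_col^T *m w) 0 0.
  by rewrite -[w^T *m _]trmxK trmx_mul trmxK mxE.
rewrite qformE [in RHS]/qform /schur mulmxBr mulmxBl -scalemxAr -scalemxAl.
rewrite sub_entry.
have -> : w^T *m (pivot_col *m pivot_col^T) *m w =
    (w^T *m pivot_col) *m (pivot_col^T *m w) by rewrite !mulmxA.
rewrite [(_ *m (_ *m w)) 0 0]mxE big_ord1 bE /qform mulr2n.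
by field; rewrite gt_eqF//; exact: pivot_gt0.
Qed.

(** The value of the Schur complement at [w] is that of [Q] at the vector [w]
    completed by the first coordinate that makes the square vanish. *)
Lemma posdef_schur : posdef schur.
Proof.
split; last first.
  move=> w w0.
  have := (proj2 pdQ) (col_mx (- (pivot^-1 * (pivot_col^T *m w) 0 0))%:M w).
  rewrite qform_schur addNr expr0n mulr0 add0r; apply.
  by apply: contra w0 => /eqP/(congr1 dsubmx); rewrite col_mxKd linear0 => ->.
rewrite /schur linearB linearZ /= trmx_mul trmxK; congr (_ - _).
by rewrite trmx_drsub (proj1 pdQ).
Qed.

Lemma det_schur : \det Q = pivot * \det schur.
Proof.
have a0 : pivot != 0 by rewrite gt_eqF// pivot_gt0.
rewrite [in LHS]QE.
have -> : block_mx pivot%:M pivot_col^T pivot_col (drsubmx Q) =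
  block_mx (1%:M : 'M[R]_1) 0 (pivot^-1 *: pivot_col) 1%:M *m
  block_mx pivot%:M pivot_col^T 0 schur.
  rewrite mulmx_block !mul1mx !mul0mx !addr0 mul_mx_scalar scalerA.
  rewrite divff// scale1r; congr block_mx.
  by rewrite -scalemxAl /schur addrCA subrr addr0.
by rewrite det_mulmx det_lblock det_ublock !det1 !mul1r det_scalar1.
Qed.

End schur.

Lemma det_posdef_gt0 p (Q : 'M[R]_p) : posdef Q -> 0 < \det Q.
Proof.
elim: p Q => [|p IH] Q pdQ; first by rewrite det_mx00.
by rewrite (det_schur (p := p))// mulr_gt0// ?pivot_gt0// IH//; exact: posdef_schur.
Qed.

Lemma measurable_qform p (Q : 'M[R]_p) d (T : measurableType d)
    (v : T -> 'cV[R]_p) : (forall i, measurable_fun setT (fun x => v x i 0)) ->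
  measurable_fun setT (fun x => qform Q (v x)).
Proof.
move=> mv; rewrite /qform; under eq_fun do rewrite mxE.
apply: measurable_sum => j; apply: measurable_funM => //.
under eq_fun do rewrite mxE; apply: measurable_sum => i.
by under eq_fun do rewrite mxE; apply: measurable_funM.
Qed.

Lemma measurable_vec_sub p i (u : 'cV[R]_p) :
  measurable_fun setT (fun y : p.-tuple R => (vec y - u) i 0).
Proof.
under eq_fun do rewrite !mxE.
by apply: measurable_funB => //; exact: measurable_tnth.
Qed.

Lemma measurable_expR_qform p (Q : 'M[R]_p) (u : 'cV[R]_p) :
  measurable_fun setT (fun y : p.-tuple R => expR (- (qform Q (vec y - u) / 2))).
Proof.
apply: measurableT_comp => //; apply: measurableT_comp => //.
apply: measurable_funM => //; apply: measurable_qform => i.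
exact: measurable_vec_sub.
Qed.

(** By induction on the dimension: after completion of the square, the first
    coordinate is integrated as a one-dimensional Gaussian, and the Gaussian of
    the Schur complement remains. *)
Lemma integral_expR_qform p (Q : 'M[R]_p) (u : 'cV[R]_p) : posdef Q ->
  (\int[lebesgue_tuple R p]_y (expR (- (qform Q (vec y - u) / 2)))%:E =
   (Num.sqrt ((2 * pi) ^+ p / \det Q))%:E)%E.
Proof.
elim: p Q u => [|p IH] Q u pdQ; have mQ := measurable_expR_qform Q u.
  rewrite [lebesgue_tuple R 0]/= integral_dirac//; last exact/measurable_EFinP.
  rewrite diracE in_setT mul1e.
  by rewrite /qform mxE big_ord0 mul0r oppr0 expR0 det_mx00 divr1 expr0 sqrtr1.
have a0 := pivot_gt0 (p := p) pdQ.
pose u0 : R := u 0 0; pose u' : 'cV[R]_p := dsubmx (u : 'cV[R]_(1 + p)).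
have vecE z (t : p.-tuple R) : vec (Defs.cons_tuple (z : R, t)) - u =
    col_mx (z - u0)%:M (vec t - u').
  apply/colP => i; rewrite !mxE; case: splitP => j ij /=.
    have -> : i = ord0 by apply: val_inj; rewrite /= ij (ord1 j).
    by rewrite !mxE (tnth_nth 0)/= (ord1 j) mulr1n.
  have -> : i = lift ord0 j by apply: val_inj; rewrite /= ij.
  rewrite !mxE !(tnth_nth 0)/=; congr (_ - u _ _).
  by apply: val_inj.
rewrite integral_lebesgue_tupleS; last 2 first.
- exact/measurable_EFinP.
- by move=> t; rewrite lee_fin expR_ge0.
have sqE t z : expR (- (qform Q (vec (Defs.cons_tuple (z : R, t)) - u) / 2)) =
    expR (- (qform (schur (p := p) Q) (vec t - u') / 2)) *
    expR (- (pivot (p := p) Q *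
      (z - (u0 - (pivot (p := p) Q)^-1 *
        ((pivot_col (p := p) Q)^T *m (vec t - u')) 0 0)) ^+ 2 / 2)).
  rewrite vecE (qform_schur (p := p))// -expRD; congr expR.
  by rewrite opprB addrA addrAC; ring.
under eq_integral => t _.
  under eq_integral do rewrite sqE EFinM.
  rewrite ge0_integralZl//; last exact: measurable_expR_sqr.
  rewrite integral_expR_sqr//.
  over.
rewrite ge0_integralZr//; last first.
  by apply/measurable_EFinP; exact: measurable_expR_qform.
rewrite IH; last exact: posdef_schur.
rewrite -EFinM -sqrtrM; last by rewrite divr_ge0 ?exprn_ge0 ?mulr_ge0 ?pi_ge0// ltW// det_posdef_gt0//; exact: posdef_schur.
congr (Num.sqrt _)%:E; rewrite (det_schur (p := p))// exprSr.
have dS := det_posdef_gt0 (posdef_schur (p := p) pdQ).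
by field; rewrite !gt_eqF.
Qed.

End quadratic_form.

(** * Gaussian densities in spectral coordinates *)

Section covariance.
Variables (R : realType) (p : nat).
Implicit Types (L : R) (D A : 'M[R]_p) (v e : 'cV[R]_p).

Definition cov L D A := L *: (D *m A *m D^T).

Definition sqnorm v : R := \sum_i v i 0 ^+ 2.

(** [L^-1 * energy D A v] is the value at [v] of the quadratic form of the
    precision matrix of [cov L D A]. *)
Definition energy D A v : R := \sum_i (D^T *m v) i 0 ^+ 2 / A i i.

Lemma sqnormE v : sqnorm v = (v^T *m v) 0 0.
Proof. by rewrite mxE; apply: eq_bigr => i _; rewrite mxE expr2. Qed.

Lemma sqnorm_ge0 v : 0 <= sqnorm v.
Proof. by apply: sumr_ge0 => i _; exact: sqr_ge0. Qed.

Lemma sqnorm_trmul D v : D *m D^T = 1%:M -> sqnorm (D^T *m v) = sqnorm v.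
Proof.
by move=> DD; rewrite !sqnormE trmx_mul trmxK mulmxA -[_ *m D *m _]mulmxA DD mulmx1.
Qed.

Section one.
Variables (L : R) (D A : 'M[R]_p).
Hypotheses (L0 : 0 < L) (DD : D *m D^T = 1%:M) (diagA : is_diag_mx A).
Hypotheses (A0 : forall i, 0 < A i i).

Let Ai := diag_mx (\row_i (A i i)^-1).

Let AAi : A *m Ai = 1%:M.
Proof.
apply/matrixP => i j; rewrite mul_mx_diag !mxE.
have [->|ij] := eqVneq i j; first by rewrite divff ?gt_eqF.
by rewrite (is_diag_mxP diagA)// mul0r.
Qed.

Let invE : invmx (cov L D A) = L^-1 *: (D *m Ai *m D^T).
Proof.
have DD' : D^T *m D = 1%:M by exact: mulmx1C.
have SB : cov L D A *m (L^-1 *: (D *m Ai *m D^T)) = 1%:M.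
  rewrite /cov -scalemxAl -scalemxAr scalerA divff ?gt_eqF// scale1r.
  rewrite -!mulmxA [D^T *m (D *m _)]mulmxA DD' mul1mx [A *m (Ai *m _)]mulmxA.
  by rewrite AAi mul1mx.
have [Su _] := mulmx1_unit SB.
by rewrite -[RHS](mulKmx Su) SB mulmx1.
Qed.

Lemma qform_invmx_cov v : qform (invmx (cov L D A)) v = L^-1 * energy D A v.
Proof.
rewrite /qform invE -scalemxAr -scalemxAl mxE; congr (_ * _).
have -> : v^T *m (D *m Ai *m D^T) *m v = (D^T *m v)^T *m (Ai *m (D^T *m v)).
  by rewrite trmx_mul trmxK !mulmxA.
rewrite mxE; apply: eq_bigr => i _; rewrite mul_diag_mx mxE [X in _ * X]mxE.
by rewrite [(\row__ _) _ _]mxE [_^-1 * _]mulrC mulrA expr2.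
Qed.

Lemma energy_ge0 v : 0 <= energy D A v.
Proof. by apply: sumr_ge0 => i _; rewrite divr_ge0 ?sqr_ge0// ltW. Qed.

Lemma posdef_invmx_cov : posdef (invmx (cov L D A)).
Proof.
split.
  by rewrite invE linearZ /= !trmx_mul trmxK tr_diag_mx mulmxA.
move=> v v0; rewrite qform_invmx_cov mulr_gt0 ?invr_gt0//.
rewrite lt_neqAle energy_ge0 andbT eq_sym; apply: contra v0 => /eqP/psumr_eq0P.
move=> E0; apply/eqP.
have -> : v = D *m (D^T *m v) by rewrite mulmxA DD mul1mx.
suff -> : D^T *m v = 0 by rewrite mulmx0.
apply/colP => i; rewrite [RHS]mxE; apply/eqP; rewrite -sqrf_eq0.
have /eqP := E0 (fun i _ => divr_ge0 (sqr_ge0 _) (ltW (A0 i))) i isT.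
by rewrite mulf_eq0 invr_eq0 [A i i == 0]gt_eqF// orbF.
Qed.

Lemma det_cov : \det D = 1 -> \det A = 1 -> \det (cov L D A) = L ^+ p.
Proof. by move=> D1 A1; rewrite detZ !det_mulmx det_tr D1 A1 !mulr1. Qed.

End one.

Section density.
Variables (L : R) (D A : 'M[R]_p) (u : 'cV[R]_p).
Hypotheses (L0 : 0 < L) (DD : D *m D^T = 1%:M) (diagA : is_diag_mx A).
Hypotheses (A0 : forall i, 0 < A i i) (D1 : \det D = 1) (A1 : \det A = 1).

Lemma gaussian_densityE y : gaussian_density u (cov L D A) y =
  expR (- (L^-1 * energy D A (vec y - u) / 2)) / Num.sqrt ((2 * pi * L) ^+ p).
Proof.
rewrite /gaussian_density det_cov// -exprMn; congr (expR _ / _).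
by rewrite -(qform_invmx_cov L0 DD diagA A0) mulNr.
Qed.

Lemma gaussian_density_gt0 y : 0 < gaussian_density u (cov L D A) y.
Proof.
rewrite gaussian_densityE divr_gt0 ?expR_gt0// sqrtr_gt0 exprn_gt0//.
by rewrite !mulr_gt0// pi_gt0.
Qed.

Lemma integral_gaussian_density :
  (\int[lebesgue_tuple R p]_y (gaussian_density u (cov L D A) y)%:E = 1)%E.
Proof.
have c0 : 0 < Num.sqrt ((2 * pi) ^+ p * \det (cov L D A)).
  rewrite sqrtr_gt0 det_cov// mulr_gt0// exprn_gt0// mulr_gt0//; exact: pi_gt0.
rewrite /gaussian_density.
have pd := posdef_invmx_cov L0 DD diagA A0.
under eq_integral => y _ do rewrite mulNr -/(qform _ _) EFinM.
rewrite ge0_integralZr//=; last first.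
  by apply/measurable_EFinP; exact: measurable_expR_qform.
rewrite integral_expR_qform// -EFinM; congr EFin.
by rewrite det_inv invrK divff// gt_eqF.
Qed.

End density.
End covariance.

(** * Domination between neighbouring Gaussian densities *)

Section comparison.
Variables (R : realType) (p : nat) (Lm Lp lm lp : R).
Hypotheses (p0 : (0 < p)%N) (Lm0 : 0 < Lm) (lm0 : 0 < lm) (lmp : lm <= lp).

(** Parameters whose entries differ by at most [resolution * gamma] give
    quadratic forms within a factor [1 - gamma] of each other, up to an
    additive constant of order [gamma]. The first two terms keep the relative
    variation of eigenvalues and volumes below [gamma / 4]; the last one
    absorbs the rotation of the eigenvectors into a fraction of the energy. *)
Definition resolution : R :=
  Num.min (Num.min (lm / 4) (Lm / 4)) (lm / (32 * p%:R ^+ 3 * lp)).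

Let lp0 : 0 < lp. Proof. exact: lt_le_trans lmp. Qed.

Let p1 : 1 <= p%:R :> R. Proof. by rewrite ler1n. Qed.

Let p3 : 1 <= p%:R ^+ 3 :> R. Proof. by rewrite exprn_ege1. Qed.

Let k0 : 0 < 32 * p%:R ^+ 3 * lp.
Proof. by rewrite mulr_gt0// mulr_gt0// (lt_le_trans ltr01 p3). Qed.

Lemma resolution_gt0 : 0 < resolution.
Proof.
by rewrite !lt_min !divr_gt0.
Qed.

Let res_lm : resolution <= lm / 4.
Proof. by rewrite !ge_min lexx. Qed.

Let res_Lm : resolution <= Lm / 4.
Proof. by rewrite !ge_min lexx orbT. Qed.

Lemma resolution_le1 : resolution <= 1.
Proof.
have lmk : lm <= 32 * p%:R ^+ 3 * lp.
  apply: le_trans lmp _; apply: ler_peMl; first exact: ltW.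
  by rewrite mulr_ege1// ler1n.
by rewrite ge_min orbC ler_pdivrMr// mul1r lmk.
Qed.

Let res_sqr : resolution ^+ 2 * (32 * p%:R ^+ 3 * lp) <= lm.
Proof.
have r1 : resolution <= lm / (32 * p%:R ^+ 3 * lp) by rewrite ge_min lexx orbT.
have r2 := resolution_le1.
move: r1; rewrite ler_pdivlMr// => r1.
rewrite expr2 -mulrA; apply: le_trans (ler_piMl _ r2) r1.
by rewrite mulr_ge0 ?ltW// resolution_gt0.
Qed.

Section energies.
Variables (gamma : R) (D D' A A' : 'M[R]_p).
Hypotheses (g0 : 0 < gamma) (g1 : gamma <= 1 / 2).
Local Notation tau := (resolution * gamma).
Hypotheses (DD : D *m D^T = 1%:M) (DD' : D' *m D'^T = 1%:M).
Hypotheses (A0 : forall i, lm <= A i i) (A0' : forall i, lm <= A' i i <= lp).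
Hypotheses (DDtau : forall i j, `|D i j - D' i j| <= tau).
Hypothesis AAtau : forall i, `|A i i - A' i i| <= tau.

Let tau0 : 0 < tau. Proof. by rewrite mulr_gt0// resolution_gt0. Qed.

Lemma energy_ge_sqnorm v : sqnorm v <= lp * energy D' A' v.
Proof.
rewrite -(sqnorm_trmul v DD') /energy mulr_sumr; apply: ler_sum => i _.
have /andP[a0 a1] := A0' i.
have a0' : 0 < A' i i by exact: lt_le_trans a0.
by rewrite mulrCA ler_peMr ?sqr_ge0// ler_pdivlMr// mul1r.
Qed.

Lemma sqnorm_sub_trmul v :
  sqnorm ((D - D')^T *m v) <= p%:R ^+ 3 * tau ^+ 2 * sqnorm v.
Proof.
pose N := Num.sqrt (sqnorm v).
have N2 : N ^+ 2 = sqnorm v by rewrite sqr_sqrtr// sqnorm_ge0.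
have vN j : `|v j 0| <= N.
  rewrite -[leLHS]sqrtr_sqr; apply: ler_wsqrtr.
  rewrite /sqnorm (bigD1 j)//= lerDl; apply: sumr_ge0 => i _; exact: sqr_ge0.
have row i : ((D - D')^T *m v) i 0 ^+ 2 <= p%:R ^+ 2 * tau ^+ 2 * N ^+ 2.
  rewrite -!exprMn -real_normK ?num_real//; apply: lerXn2r; rewrite ?nnegrE//.
    by rewrite mulr_ge0 ?sqrtr_ge0// mulr_ge0 ?ler0n// ltW.
  rewrite mxE (le_trans (ler_norm_sum _ _ _))//.
  apply: (@le_trans _ _ (\sum_(j < p) tau * N)).
    apply: ler_sum => j _; rewrite !mxE normrM.
    by apply: ler_pM => //; exact: DDtau.
  by rewrite sumr_const card_ord -[leLHS]mulr_natl mulrA.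
apply: le_trans (ler_sum _ (fun i _ => row i)) _.
rewrite sumr_const card_ord N2 -[leLHS]mulr_natl.
by rewrite [in leRHS]exprS !mulrA.
Qed.

Let sqr_perturb (a b r : R) : 0 < a -> (1 - a) * b ^+ 2 - r ^+ 2 / a <= (b + r) ^+ 2.
Proof.
move=> a0; rewrite -subr_ge0.
have -> : (b + r) ^+ 2 - ((1 - a) * b ^+ 2 - r ^+ 2 / a) =
    r ^+ 2 + (a * b + r) ^+ 2 / a by field; rewrite gt_eqF.
by rewrite addr_ge0 ?sqr_ge0// divr_ge0 ?sqr_ge0// ltW.
Qed.

(** With [al = gamma / 4], each coordinate satisfies
    [(b + r) ^ 2 >= (1 - al) b ^ 2 - r ^ 2 / al]. The error [r] has two sources:
    the change of eigenvectors, whose contribution is a small fraction of the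
    energy since the eigenvalues are bounded, and the translation by [e], which
    leaves the additive constant. *)
Lemma energy_perturb v e : sqnorm e <= tau ^+ 2 ->
  (1 - 3 / 4 * gamma) * energy D' A' v - 8 * tau ^+ 2 / (gamma * lm) <=
  energy D A (v - e).
Proof.
move=> e_tau; set E' := energy D' A' v.
pose b i := (D'^T *m v) i 0.
pose r i := (D^T *m (v - e)) i 0 - b i.
have bE i : (D^T *m (v - e)) i 0 = b i + r i by rewrite /r addrCA subrr addr0.
pose al := gamma / 4.
have al0 : 0 < al by rewrite divr_gt0.
have al1 : al <= 1 by move: g1; rewrite /al; lra.
have taulm : tau <= al * lm.
  by rewrite /al mulrAC mulrC -mulrA ler_wpM2l// ltW.
have E'0 : 0 <= E'.
  apply: energy_ge0 => i; by have /andP[/(lt_le_trans lm0)] := A0' i.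
have term i : (1 - al) ^+ 2 * (b i ^+ 2 / A' i i) - r i ^+ 2 / (al * lm) <=
    (D^T *m (v - e)) i 0 ^+ 2 / A i i.
  rewrite bE; have /andP[a0 a1] := A0' i.
  have a0' : 0 < A' i i by exact: lt_le_trans a0.
  have a0'' : 0 < A i i by exact: lt_le_trans (A0 i).
  apply: (@le_trans _ _ (((1 - al) * b i ^+ 2 - r i ^+ 2 / al) / A i i)); last first.
    by apply: ler_wpM2r; [rewrite invr_ge0 ltW|exact: sqr_perturb].
  rewrite mulrBl lerB//.
    have := sqr_ge0 (b i); move: (b i ^+ 2) => B B0.
    rewrite [(1 - al) ^+ 2]expr2 -!mulrA ler_wpM2l ?subr_ge0// mulrCA ler_wpM2l//.
    rewrite ler_pdivrMr// mulrC ler_pdivlMr//.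
    have := AAtau i; rewrite ler_norml => /andP[_ At].
    have : A i i <= A' i i + al * A' i i.
      have : al * lm <= al * A' i i by rewrite ler_wpM2l// ltW.
      lra.
    nra.
  have -> : r i ^+ 2 / (al * lm) = r i ^+ 2 / al / lm by rewrite invfM mulrA.
  apply: ler_wpM2l.
    by rewrite divr_ge0 ?sqr_ge0// ltW.
  by rewrite lef_pV2 ?posrE.
have r2 : \sum_i r i ^+ 2 <= 2 * (p%:R ^+ 3 * tau ^+ 2 * (lp * E') + tau ^+ 2).
  apply: (@le_trans _ _ (\sum_i (2 * (((D - D')^T *m v) i 0 ^+ 2
      + (D^T *m e) i 0 ^+ 2)))).
    apply: ler_sum => i _.
    have -> : r i = ((D - D')^T *m v) i 0 - (D^T *m e) i 0.
      have dT : (D - D')^T = D^T - D'^T by rewrite linearB.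
      have subE (x y : 'cV[R]_p) : (x - y) i 0 = x i 0 - y i 0 by rewrite !mxE.
      by rewrite /r /b dT mulmxBl mulmxBr !subE; ring.
    set x := _ i 0; set y := _ i 0.
    have := sqr_ge0 (x + y); rewrite sqrrD sqrrB; lra.
  rewrite -mulr_sumr big_split/= ler_wpM2l// lerD//.
    apply: le_trans (sqnorm_sub_trmul v) _.
    apply: ler_wpM2l (energy_ge_sqnorm v).
    by rewrite mulr_ge0 ?exprn_ge0// ltW.
  by rewrite -/(sqnorm _) sqnorm_trmul.
have main : (1 - al) ^+ 2 * E' - (\sum_i r i ^+ 2) / (al * lm) <= energy D A (v - e).
  rewrite /E' /energy mulr_sumr mulr_suml -sumrB; apply: ler_sum => i _; exact: term.
apply: le_trans main.
have alm0 : 0 < al * lm by rewrite mulr_gt0.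
have : (\sum_i r i ^+ 2) / (al * lm) <=
    al * E' + 8 * tau ^+ 2 / (gamma * lm).
  rewrite ler_pdivrMr//; apply: le_trans r2 _.
  have -> : (al * E' + 8 * tau ^+ 2 / (gamma * lm)) * (al * lm) =
      al ^+ 2 * lm * E' + 2 * tau ^+ 2.
    by rewrite /al; field; rewrite !gt_eqF.
  rewrite mulrDr lerD2r.
  have -> : 2 * (p%:R ^+ 3 * tau ^+ 2 * (lp * E')) =
      al ^+ 2 * (resolution ^+ 2 * (32 * p%:R ^+ 3 * lp)) * E'.
    by rewrite /al; field.
  rewrite ler_wpM2r// ler_wpM2l ?sqr_ge0//.
have alE : 0 <= al ^+ 2 * E' by rewrite mulr_ge0 ?sqr_ge0.
have -> : 3 / 4 * gamma = 3 * al by rewrite /al; field.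
move: (8 * tau ^+ 2 / _) ((\sum_i _) / _) => x y; lra.
Qed.

Section densities.
Variables (L L' : R) (u u' : 'cV[R]_p).
Hypotheses (LLm : Lm <= L) (LLm' : Lm <= L') (LLtau : `|L - L'| <= tau).
Hypotheses (diagA : is_diag_mx A) (diagA' : is_diag_mx A').
Hypotheses (D1 : \det D = 1) (A1 : \det A = 1).
Hypotheses (D1' : \det D' = 1) (A1' : \det A' = 1).
Hypothesis uutau : sqnorm (u - u') <= tau ^+ 2.

Let L0 : 0 < L. Proof. exact: lt_le_trans LLm. Qed.
Let L0' : 0 < L'. Proof. exact: lt_le_trans LLm'. Qed.
Let gm1 : 0 < 1 - gamma. Proof. by move: g1; lra. Qed.

Let tauLm : tau <= gamma / 4 * Lm.
Proof. by rewrite mulrAC mulrC -mulrA ler_wpM2l// ltW. Qed.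

Let taulm : tau <= gamma / 4 * lm.
Proof. by rewrite mulrAC mulrC -mulrA ler_wpM2l// ltW. Qed.

Lemma precision_ge y :
  (L' / (1 - gamma))^-1 * energy D' A' (vec y - u') - gamma / 2 <=
  L^-1 * energy D A (vec y - u).
Proof.
have -> : vec y - u = (vec y - u') - (u - u') by rewrite opprB addrA subrK.
have E'0 : 0 <= energy D' A' (vec y - u').
  by apply: energy_ge0 => i; have /andP[/(lt_le_trans lm0)] := A0' i.
have := energy_perturb (vec y - u') uutau.
move: (energy D' A' (vec y - u')) (energy D A _) E'0 => E' E E'0 h.
have Li0 : 0 < L^-1 by rewrite invr_gt0.
apply: le_trans (ler_wpM2l (ltW Li0) h).
have LL : (1 - gamma / 4) / L' <= L^-1.
  rewrite ler_pdivrMr// [L^-1 * _]mulrC ler_pdivlMr//.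
  move: LLtau; rewrite ler_norml => /andP[_ LLt].
  have : gamma / 4 * Lm <= gamma / 4 * L' by rewrite ler_wpM2l// divr_ge0// ltW.
  have := tauLm; have := L0'; move: g0 g1 LLt; nra.
have cst : 8 * tau ^+ 2 / (gamma * lm) / L <= gamma / 2.
  rewrite ler_pdivrMr// ler_pdivrMr ?mulr_gt0//.
  have t2 : tau * tau <= (gamma / 4 * lm) * (gamma / 4 * L).
    apply: ler_pM; rewrite ?(ltW tau0)//.
    by apply: le_trans tauLm _; rewrite ler_wpM2l// divr_ge0// ltW.
  rewrite expr2; nra.
have quad : (1 - gamma) / L' * E' <= (1 - gamma / 4) / L' * ((1 - 3 / 4 * gamma) * E').
  rewrite [leRHS]mulrA ler_wpM2r// mulrAC ler_wpM2r ?invr_ge0 ?(ltW L0')//.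
  have := sqr_ge0 gamma; rewrite expr2; nra.
have sc : (1 - gamma / 4) / L' * ((1 - 3 / 4 * gamma) * E') <=
    L^-1 * ((1 - 3 / 4 * gamma) * E').
  by apply: ler_wpM2r LL; rewrite mulr_ge0//; move: g1; lra.
rewrite invf_div mulrBr [L^-1 * (_ / _)]mulrC.
by apply: lerB => //; exact: le_trans quad sc.
Qed.

Lemma volume_le : L' / (1 - gamma) <= L * expR (3 * gamma).
Proof.
have LL : L' <= L * (1 + gamma / 4).
  move: LLtau; rewrite ler_norml => /andP[LLt _].
  have : gamma / 4 * Lm <= gamma / 4 * L by rewrite ler_wpM2l// divr_ge0// ltW.
  have := tauLm; lra.
rewrite ler_pdivrMr//; apply: le_trans LL _.
rewrite -mulrA ler_wpM2l ?(ltW L0)//.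
have : (1 + 3 * gamma) * (1 - gamma) <= expR (3 * gamma) * (1 - gamma).
  by rewrite ler_wpM2r ?(ltW gm1)// expR_ge1Dx.
by move: g0 g1; nra.
Qed.

(** The two quadratic forms differ by a relative error, hence without bound at
    infinity; inflating the covariance by [1 / (1 - gamma)] compensates for it,
    and only the normalizing constants and an additive error in the exponent
    are left to compare. *)
Lemma gaussian_density_le y : gaussian_density u (cov L D A) y <=
  expR (3 * p%:R * gamma) *
  gaussian_density u' (cov (L' / (1 - gamma)) D' A') y.
Proof.
have A00 i : 0 < A i i by exact: lt_le_trans (A0 i).
have A00' i : 0 < A' i i by have /andP[/(lt_le_trans lm0)] := A0' i.
have L''0 : 0 < L' / (1 - gamma) by rewrite divr_gt0.
rewrite !gaussian_densityE//.
have pi2 : 0 < 2 * pi :> R by rewrite mulr_gt0// pi_gt0.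
have s0 : 0 < Num.sqrt ((2 * pi * L) ^+ p).
  by rewrite sqrtr_gt0 exprn_gt0// mulr_gt0.
have s0' : 0 < Num.sqrt ((2 * pi * (L' / (1 - gamma))) ^+ p).
  by rewrite sqrtr_gt0 exprn_gt0// mulr_gt0.
have se : Num.sqrt ((2 * pi * (L' / (1 - gamma))) ^+ p) <=
    expR (2 * p%:R * gamma) * Num.sqrt ((2 * pi * L) ^+ p).
  have e0 : 0 <= expR (2 * p%:R * gamma) by exact: expR_ge0.
  rewrite -(ger0_norm e0) -sqrtr_sqr -sqrtrM ?sqr_ge0//; apply: ler_wsqrtr.
  have -> : expR (2 * p%:R * gamma) ^+ 2 = expR (4 * gamma) ^+ p.
    by rewrite -!expRM_natl; congr expR; ring.
  rewrite -exprMn; apply: lerXn2r.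
  - by rewrite nnegrE mulr_ge0// ltW.
  - by rewrite nnegrE mulr_ge0 ?expR_ge0// mulr_ge0// ltW.
  rewrite [leRHS]mulrCA; apply: ler_wpM2l; first exact: ltW.
  apply: le_trans volume_le _; rewrite mulrC; apply: ler_wpM2r; first exact: ltW.
  by rewrite ler_expR; move: g0; lra.
have ne : expR (- (L^-1 * energy D A (vec y - u) / 2)) <=
    expR (p%:R * gamma) *
    expR (- ((L' / (1 - gamma))^-1 * energy D' A' (vec y - u') / 2)).
  rewrite -expRD ler_expR.
  have := precision_ge y.
  have : gamma <= p%:R * gamma by rewrite ler_peMl// ltW.
  by move: g0; lra.
move: s0 s0' se ne; move: (Num.sqrt _) (Num.sqrt _) => r' r r0 r0' rr' ne.
rewrite ler_pdivrMr//; apply: le_trans ne _.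
have -> : 3 * p%:R * gamma = p%:R * gamma + 2 * p%:R * gamma by ring.
rewrite expRD; move: rr'; move: (expR (2 * p%:R * gamma)) => b rr'.
rewrite [leRHS](_ : _ = expR (p%:R * gamma) *
  expR (- ((L' / (1 - gamma))^-1 * energy D' A' (vec y - u') / 2)) *
  (b * r / r')); last by ring.
apply: ler_peMr; first by rewrite mulr_ge0// expR_ge0.
by rewrite ler_pdivlMr// mul1r.
Qed.

End densities.
End energies.
End comparison.

(** * Discretization of the parameters *)

Section codes.

(** Covering numbers counted through labellings: elements of [F] with the same
    label are close. No center has to be exhibited, and labels of the
    components of a parameter combine into a tuple. *)
Definition codes T (C : Type) (close : T -> T -> Prop) (F : set T) :=
  exists c : T -> C, forall f g, F f -> F g -> c f = c g -> close f g.

Lemma codes_prod T1 T2 C1 C2 (close1 : T1 -> T1 -> Prop)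
    (close2 : T2 -> T2 -> Prop) F1 F2 : codes C1 close1 F1 -> codes C2 close2 F2 ->
  codes (C1 * C2) (fun f g => close1 f.1 g.1 /\ close2 f.2 g.2) (F1 `*` F2).
Proof.
move=> [c1 h1] [c2 h2]; exists (fun f => (c1 f.1, c2 f.2)).
by move=> f g [f1 f2] [g1 g2] [e1 e2]; split; [exact: h1|exact: h2].
Qed.

(** The label of a common component is read off the first class, that of a
    known one is void. *)
Lemma codes_component K T (C : finType) (close : T -> T -> Prop) (range : set T)
    (cpt : component K T) : (forall t, close t t) -> (0 < K)%N ->
  codes C close range ->
  codes {ffun 'I_(component_count cpt) -> C}
    (fun t t' : 'I_K -> T => forall k, close (t k) (t' k))
    (component_set cpt range).
Proof.
move=> refl K0 [c hc]; case: cpt => [t0| |] /=.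
- exists (fun t => [ffun i : 'I_0 => c (t (Ordinal K0))]) => t t' [_ ->] [_ ->] _ k.
  exact: refl.
- exists (fun t => [ffun=> c (t (Ordinal K0))]) => t t' [Ft tE] [Ft' tE'] E k.
  have /ffunP/(_ ord0) := E; rewrite !ffunE => Ek.
  by rewrite (tE k (Ordinal K0)) (tE' k (Ordinal K0)); exact: hc.
- exists (fun t => [ffun k => c (t k)]) => t t' [Ft _] [Ft' _] E k.
  by have /ffunP/(_ k) := E; rewrite !ffunE => Ek; exact: hc.
Qed.

Context {R : realType}.

Definition grid_size (B tau : R) : nat := (Num.truncn (2 * B / tau)).+1.

Lemma codes_interval (B tau : R) : 0 < tau -> codes 'I_(grid_size B tau)
  (fun x y : R => `|x - y| <= tau) [set x : R | `|x| <= B].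
Proof.
move=> tau0; exists (fun x => inord (Num.truncn ((x + B) / tau))) => x y /= xB yB.
have rng z : `|z| <= B -> 0 <= (z + B) / tau <= 2 * B / tau.
  rewrite ler_norml => /andP[z1 z2].
  apply/andP; split; first by apply: divr_ge0; [lra|exact: ltW].
  by apply: ler_wpM2r; [rewrite invr_ge0 ltW|lra].
have /andP[x0 xr] := rng _ xB; have /andP[y0 yr] := rng _ yB.
have le z : 0 <= z -> z <= 2 * B / tau -> (Num.truncn z < grid_size B tau)%N.
  move=> z0 zr; rewrite ltnS truncn_ge_nat ?(le_trans z0 zr)//.
  by apply: le_trans zr; rewrite truncn_le.
move=> /(congr1 val); rewrite /= !inordK ?le// => E.
have /andP[] := truncn_itv x0; have /andP[] := truncn_itv y0; rewrite E.
rewrite -natr1 => y1 y2 x1 x2.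
have : `|(x + B) / tau - (y + B) / tau| <= 1 by rewrite ler_norml; apply/andP; split; lra.
have -> : (x + B) / tau - (y + B) / tau = (x - y) / tau by field; rewrite gt_eqF.
by rewrite normrM normfV (gtr0_norm tau0) ler_pdivrMr// mul1r.
Qed.

Lemma codes_ffun (I : finType) T (C : finType) (close : T -> T -> Prop)
    (F : set T) (M : Type) (entry : M -> I -> T) (G : set M) :
  (forall m, G m -> forall i, F (entry m i)) -> codes C close F ->
  codes {ffun I -> C} (fun m m' => forall i, close (entry m i) (entry m' i)) G.
Proof.
move=> GF [c hc]; exists (fun m => [ffun i => c (entry m i)]) => m m' Gm Gm' E i.
by have /ffunP/(_ i) := E; rewrite !ffunE; apply: hc; exact: GF.
Qed.

Lemma card_codes (C : finType) T (t : T) (close : T -> T -> Prop) F :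
  codes C close F -> (0 < #|C|)%N.
Proof. by move=> [c _]; apply/card_gt0P; exists (c t). Qed.

End codes.

Section covariance_codes.
Variables (R : realType) (p : nat).
Hypothesis p0 : (0 < p)%N.

Lemma orthogonal_entry (D : 'M[R]_p) i j : D *m D^T = 1%:M -> `|D i j| <= 1.
Proof.
move=> /matrixP/(_ i i); rewrite !mxE eqxx mulr1n => E.
rewrite -ler_sqr ?nnegrE// !real_normK ?num_real// expr1n -E.
rewrite (bigD1 j)//= !mxE expr2 lerDl; apply: sumr_ge0 => k _.
by rewrite mxE -expr2 sqr_ge0.
Qed.

Let half_square : (2 <= p)%N -> (p * p <= 4 * ((p * (p - 1)) %/ 2))%N.
Proof.
move=> p2; have : (2 %| p * (p - 1))%N.
  by rewrite dvdn2 oddM oddB ?(ltnW p2)//=; case: (odd p).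
by move=> /divnK; set q := (_ %/ _)%N => qE; nia.
Qed.

Variables (tau B : R).
Hypotheses (tau0 : 0 < tau) (B1 : 1 <= B).

Let N := grid_size B tau.

Let lnN0 : 0 <= ln (N%:R : R). Proof. by rewrite ln_ge0// ler1n. Qed.

Let ln_expn q : ln ((N ^ q)%N%:R : R) = q%:R * ln N%:R.
Proof. by rewrite natrX lnXn ?ltr0n// mulr_natl. Qed.

Lemma ln_grid_size : ln (N%:R : R) <= ln (2 * B / tau + 1).
Proof.
have Bt : 0 < 2 * B / tau by rewrite divr_gt0// mulr_gt0// (lt_le_trans ltr01).
rewrite ler_ln ?posrE ?ltr0n// ?addr_gt0//.
by rewrite /N /grid_size -natr1 lerD2r truncn_le ltW.
Qed.

(** For [p = 1] the set is a singleton; for [p >= 2] the [p ^ 2] entries are at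
    most four times the dimension [p (p - 1) / 2]. *)
Lemma codes_orthogonal : exists C : finType,
  codes C (fun D D' : 'M[R]_p => forall i j, `|D i j - D' i j| <= tau)
    (@special_orthogonal R p) /\
  ln (#|C|%:R : R) <= 4 * ((p * (p - 1)) %/ 2)%:R * ln N%:R.
Proof.
have [p2|p1] := ltnP 1 p; last first.
  have pE : p = 1%N by apply/eqP; rewrite eqn_leq p1.
  exists unit; rewrite card_unit ln1; split; last by rewrite !mulr_ge0.
  exists (fun=> tt); rewrite /special_orthogonal; clear half_square p0.
  move: p1 pE => _ ->.
  move=> D D' [_ D1] [_ D1'] _ i j.
  rewrite (ord1 i) (ord1 j); move: D1 D1'; rewrite !det_mx11 => -> ->.
  by rewrite subrr normr0 ltW.
exists {ffun 'I_p * 'I_p -> 'I_N}; split.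
  have [c hc] := @codes_ffun ('I_p * 'I_p)%type R 'I_N _ _ 'M[R]_p
    (fun D ij => D ij.1 ij.2) (@special_orthogonal R p)
    (fun D DS ij => le_trans (orthogonal_entry _ _ (proj1 DS)) B1)
    (codes_interval B tau0).
  by exists c => D D' SD SD' E i j; exact: (hc _ _ SD SD' E (i, j)).
rewrite card_ffun card_prod !card_ord ln_expn ler_wpM2r//.
by rewrite -natrM ler_nat half_square.
Qed.

(** For [p = 1] the determinant fixes the matrix; for [p >= 2] the [p] entries
    are at most four times the dimension [p - 1]. *)
Lemma codes_eigenvalues (lm lp : R) : 0 < lm -> lp <= B -> exists C : finType,
  codes C (fun A A' : 'M[R]_p => forall i, `|A i i - A' i i| <= tau)
    (normalized_eigenvalues lm lp) /\
  ln (#|C|%:R : R) <= 4 * (p - 1)%:R * ln N%:R.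
Proof.
move=> lm0 lpB; have [p2|p1] := ltnP 1 p; last first.
  have pE : p = 1%N by apply/eqP; rewrite eqn_leq p1.
  exists unit; rewrite card_unit ln1; split; last by rewrite !mulr_ge0.
  exists (fun=> tt); rewrite /normalized_eigenvalues; clear half_square p0.
  move: p1 pE => _ ->.
  move=> D D' [_ D1 _] [_ D1' _] _ i.
  rewrite (ord1 i); move: D1 D1'; rewrite !det_mx11 => -> ->.
  by rewrite subrr normr0 ltW.
exists {ffun 'I_p -> 'I_N}; split.
  apply: (@codes_ffun 'I_p R 'I_N _ _ 'M[R]_p (fun A i => A i i) _ _
    (codes_interval B tau0)).
  move=> A [_ _ Ai] i /=; have /andP[a0 a1] := Ai i.
  by rewrite ger0_norm ?(le_trans a1)// (le_trans _ a0)// ltW.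
rewrite card_ffun !card_ord ln_expn ler_wpM2r//.
rewrite -natrM ler_nat; lia.
Qed.

End covariance_codes.

Section entropy_codes.
Variable R : realType.

(** The infimum over the sizes of nets is attained, since these are integers,
    and it is infinite when there is no net. *)
Lemma metric_entropy_net T (dist : T -> T -> \bar R) (sigma r : R) (F : set T) :
  F !=set0 -> (metric_entropy dist sigma F <= r%:E)%E ->
  exists N, [/\ (0 < N)%N, has_net dist sigma F N & ln (N%:R : R) <= r].
Proof.
move=> [f Ff]; rewrite /metric_entropy.
have [[N netN]|noN] := pselect (exists N, has_net dist sigma F N); last first.
  rewrite (_ : [set _ | _ in _] = set0) ?ereal_inf0//.
  by apply/seteqP; split => // x [N netN _]; apply: noN; exists N.
have exN : exists N, `[< has_net dist sigma F N >] by exists N; exact/asboolP.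
case: (ex_minnP exN) => N0 /asboolP net0 min0.
have N00 : (0 < N0)%N.
  by have [c [Fc /(_ _ Ff)[i _]]] := net0; exact: leq_ltn_trans (ltn_ord i).
rewrite (_ : ereal_inf _ = N0%:R%:E).
  by rewrite lne_EFin ?ltr0n// lee_fin => ?; exists N0.
apply/eqP; rewrite eq_le; apply/andP; split.
  by apply: ereal_inf_lbound; exists N0.
apply: le_ereal_inf_tmp => _ [n netn <-]; rewrite lee_fin ler_nat.
by apply: min0; exact/asboolP.
Qed.

(** A negative dimension would make the bound negative for small [sigma],
    whereas the logarithm of the size of a net is nonnegative. *)
Lemma entropy_bound_dim_ge0 T (dist : T -> T -> \bar R) (F : set T) (D c : R) :
  F !=set0 -> entropy_bound dist F D c -> 0 <= D.
Proof.
move=> F0 eb; rewrite leNgt; apply/negP => D0.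
pose sigma := expR (- (`|c| + 1)).
have s1 : sigma <= 1 by rewrite expR_le1 oppr_le0 addr_ge0.
have /eb : 0 < sigma <= Num.sqrt 2.
  by rewrite expR_gt0 (le_trans s1)// -[leLHS]sqrtr1 ler_wsqrtr// ler1n.
move=> /(metric_entropy_net F0)[N [N0 _]].
rewrite /sigma div1r -expRN opprK expRK => lnN.
have : 0 <= ln (N%:R : R) by rewrite ln_ge0// ler1n.
apply/negP; rewrite -ltNge; apply: le_lt_trans lnN _.
rewrite nmulr_rlt0//; have := ler_norm (- c); rewrite normrN.
by move=> ?; lra.
Qed.

Lemma codes_net T (dist : T -> T -> \bar R) sigma (F : set T) N : (0 < N)%N ->
  has_net dist sigma F N ->
  codes 'I_N (fun f g => exists c, (dist f c <= sigma%:E)%E /\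
                                   (dist g c <= sigma%:E)%E) F.
Proof.
case: N => // N _ [c [_ netc]].
have /choice[code hcode] : forall f, exists i, F f -> (dist f (c i) <= sigma%:E)%E.
  move=> f; have [Ff|nF] := pselect (F f); last by exists ord0.
  by have [i fi] := netc f Ff; exists i.
exists code => f g Ff Fg E; exists (c (code f)); split; first exact: hcode.
by rewrite E; exact: hcode.
Qed.

Lemma sup_dist_le (V : zmodType) (nrm : V -> R) d K
    (s t : 'I_K -> cube R d -> V) sigma k x :
  (sup_dist nrm s t <= sigma%:E)%E -> nrm (s k x - t k x) <= sigma.
Proof.
move=> st; rewrite -lee_fin; apply: le_trans st.
by apply: ereal_sup_ubound; exists (k, x).
Qed.

Lemma codes_weights d K (W : set ('I_K -> cube R d -> R)) (D c sigma : R) :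
  W !=set0 -> entropy_bound (@weight_dist R d K) W D c ->
  0 < sigma <= Num.sqrt 2 -> exists C : finType,
  codes C (fun w w' => forall k x, `|w k x - w' k x| <= 2 * sigma) W /\
  ln (#|C|%:R : R) <= D * (c + ln (1 / sigma)).
Proof.
move=> W0 eb /eb/(metric_entropy_net W0)[N [N0 net lnN]].
exists 'I_N; rewrite card_ord; split => //.
have [code h] := codes_net N0 net; exists code => w w' Ww Ww' E k x.
have [v [/(sup_dist_le k x) wv /(sup_dist_le k x) w'v]] := h _ _ Ww Ww' E.
have -> : w k x - w' k x = (w k x - v k x) - (w' k x - v k x) by ring.
by apply: le_trans (ler_normB _ _) _; lra.
Qed.

Lemma codes_means d p K (U : set ('I_K -> cube R d -> 'cV[R]_p)) (D c sigma : R) :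
  U !=set0 -> entropy_bound (@mean_dist R d p K) U D c ->
  0 < sigma <= Num.sqrt 2 -> exists C : finType,
  codes C (fun u u' => forall k x, sqnorm (u k x - u' k x) <= (2 * sigma) ^+ 2) U /\
  ln (#|C|%:R : R) <= D * (c + ln (1 / sigma)).
Proof.
move=> U0 eb sI; have /andP[s0 _] := sI.
have [N [N0 net lnN]] := metric_entropy_net U0 (eb _ sI).
exists 'I_N; rewrite card_ord; split => //.
have [code h] := codes_net N0 net; exists code => u u' Uu Uu' E k x.
have [v [/(sup_dist_le k x) uv /(sup_dist_le k x) u'v]] := h _ _ Uu Uu' E.
have sqE (e : 'cV[R]_p) : norm2 e <= sigma -> sqnorm e <= sigma ^+ 2.
  move=> es; rewrite -(sqr_sqrtr (sqnorm_ge0 e)); apply: lerXn2r => //.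
  - by rewrite nnegrE sqrtr_ge0.
  - by rewrite nnegrE ltW.
have le_sub : sqnorm (u k x - u' k x) <=
    2 * (sqnorm (u k x - v k x) + sqnorm (u' k x - v k x)).
  rewrite /sqnorm -big_split/= mulr_sumr; apply: ler_sum => i _.
  rewrite !mxE; move: (u k x i 0) (u' k x i 0) (v k x i 0) => a b e.
  by have := sqr_ge0 ((a - e) + (b - e)); nra.
apply: le_trans le_sub _; have := sqE _ uv; have := sqE _ u'v.
by rewrite exprMn; lra.
Qed.

End entropy_codes.

(** * Gaussian mixtures with logistic weights *)

Section mixtures.
Variables (R : realType) (d p K : nat).
Hypothesis K0 : (0 < K)%N.
Implicit Types (w : 'I_K -> cube R d -> R) (u : 'I_K -> cube R d -> 'cV[R]_p).

Lemma logistic_denominator_gt0 w x : 0 < \sum_(l < K) expR (w l x).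
Proof.
case: K K0 w => // k _ w; rewrite big_ord_recl ltr_pwDl ?expR_gt0//.
by apply: sumr_ge0 => i _; exact: expR_ge0.
Qed.

Lemma logistic_weight_gt0 w k x : 0 < logistic_weight w k x.
Proof. by rewrite divr_gt0 ?expR_gt0 ?logistic_denominator_gt0. Qed.

Lemma sum_logistic_weight w x : \sum_(k < K) logistic_weight w k x = 1.
Proof. by rewrite -mulr_suml divff// gt_eqF// logistic_denominator_gt0. Qed.

Lemma measurable_logistic_weight w k :
  (forall k, measurable_fun setT (w k)) -> measurable_fun setT (logistic_weight w k).
Proof.
move=> mw; apply: measurable_funM.
  exact: (measurableT_comp (@measurable_expR R)).
apply: measurable_funV; first by move=> x; rewrite ltW// logistic_denominator_gt0.
by apply: measurable_sum => l; exact: (measurableT_comp (@measurable_expR R)).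
Qed.

(** The numerator and the denominator each vary by a factor at most
    [e ^ gamma]. *)
Lemma logistic_weight_le w w' gamma k x : (forall k, `|w k x - w' k x| <= gamma) ->
  logistic_weight w k x <= expR (2 * gamma) * logistic_weight w' k x.
Proof.
move=> ww.
have le1 l : expR (w l x) <= expR gamma * expR (w' l x).
  rewrite -expRD ler_expR -lerBlDr.
  by have := ww l; rewrite ler_norml => /andP[].
have le2 l : expR (w' l x) <= expR gamma * expR (w l x).
  rewrite -expRD ler_expR.
  by have := ww l; rewrite ler_norml => /andP[]; lra.
have s2 : \sum_(l < K) expR (w' l x) <= expR gamma * \sum_(l < K) expR (w l x).
  by rewrite mulr_sumr; apply: ler_sum => l _; exact: le2.
have d0 := logistic_denominator_gt0 w x; have d0' := logistic_denominator_gt0 w' x.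
rewrite /logistic_weight ler_pdivrMr// -[leRHS]mulrA mulrAC.
rewrite (_ : 2 * gamma = gamma + gamma); last by ring.
rewrite expRD; apply: le_trans (le1 k) _.
move: (expR_gt0 (w' k x)) (expR_gt0 gamma) s2 d0 d0'.
move: (expR (w' k x)) (expR gamma) (\sum_(l < K) expR (w l x)) (\sum_(l < K) _).
move=> a g s s' a0 g0 s2 d0 d0'.
rewrite -[leRHS](_ : g * a * (g * s / s') = _); last by ring.
by apply: ler_peMr; [rewrite mulr_ge0 ?ltW|rewrite ler_pdivlMr// mul1r].
Qed.

Lemma measurable_gaussian_mixture w u S : (forall k, measurable_fun setT (w k)) ->
  (forall k i, measurable_fun setT (fun x => u k x i 0)) ->
  measurable_fun [set: cube R d * p.-tuple R]
    (fun z => gaussian_mixture w u S z.1 z.2).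
Proof.
move=> mw mu; apply: measurable_sum => k; apply: measurable_funM.
  exact: (measurableT_comp (measurable_logistic_weight k mw)).
rewrite /gaussian_density; apply: measurable_funM => //.
apply: (measurableT_comp (@measurable_expR R)); apply: measurable_funM => //.
apply: measurableT_comp => //.
apply: (@measurable_qform R p _ _ _ (fun z : cube R d * p.-tuple R => vec z.2 - u k z.1)) => i.
under eq_fun do rewrite mxE [(vec _) _ _]mxE mxE.
apply: measurable_funB.
  exact: (measurableT_comp (measurable_tnth i)).
exact: (measurableT_comp (mu k i)).
Qed.

Section integral.
Variables (w : 'I_K -> cube R d -> R) (u : 'I_K -> cube R d -> 'cV[R]_p).
Variables (L : 'I_K -> R) (D A : 'I_K -> 'M[R]_p).
Hypotheses (mw : forall k, measurable_fun setT (w k))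
  (mu : forall k i, measurable_fun setT (fun x => u k x i 0))
  (L0 : forall k, 0 < L k) (DSO : forall k, special_orthogonal (D k))
  (diagA : forall k, is_diag_mx (A k)) (A1 : forall k, \det (A k) = 1)
  (A0 : forall k i, 0 < A k i i).
Let S k := cov (L k) (D k) (A k).

Let Phi0 k x y : 0 < gaussian_density (u k x) (S k) y.
Proof. by have [DD D1] := DSO k; exact: gaussian_density_gt0. Qed.

Lemma gaussian_mixture_gt0 x y : 0 < gaussian_mixture w u S x y.
Proof.
rewrite /gaussian_mixture lt_neqAle; apply/andP; split; last first.
  by apply: sumr_ge0 => k _; rewrite ltW// mulr_gt0// logistic_weight_gt0.
rewrite eq_sym psumr_neq0; last first.
  by move=> k _; rewrite ltW// mulr_gt0// logistic_weight_gt0.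
apply/hasP; exists (Ordinal K0); first exact: mem_index_enum.
by rewrite mulr_gt0// logistic_weight_gt0.
Qed.

Lemma integral_gaussian_mixture x :
  (\int[lebesgue_tuple R p]_y (gaussian_mixture w u S x y)%:E = 1)%E.
Proof.
have mPhi k : measurable_fun setT (fun y => gaussian_density (u k x) (S k) y).
  apply: measurable_funM => //; apply: measurableT_comp => //.
  apply: measurable_funM => //; apply: measurableT_comp => //.
  by apply: measurable_qform => i; exact: measurable_vec_sub.
under eq_integral do rewrite -sumEFin.
rewrite ge0_integral_sum//; last 2 first.
- by move=> k; apply/measurable_EFinP/measurable_funM.
- by move=> k y _; rewrite lee_fin ltW// mulr_gt0// logistic_weight_gt0.
rewrite -(sum_logistic_weight w x) -sumEFin; apply: eq_bigr => k _.
under eq_integral do rewrite EFinM.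
have [DD D1] := DSO k.
rewrite ge0_integralZl//=; last 3 first.
- exact/measurable_EFinP.
- by move=> y _; rewrite lee_fin ltW.
- by rewrite lee_fin ltW// logistic_weight_gt0.
by rewrite integral_gaussian_density// mule1.
Qed.

End integral.
End mixtures.

(** * Upper nets of a model *)

Section upper_nets.
Variables (R : realType) (d p : nat) (Lm Lp lm lp : R).
Hypotheses (p0 : (0 < p)%N) (Lm0 : 0 < Lm) (lm0 : 0 < lm) (lmp : lm <= lp).

Section one_model.
Variables (m : model R d p) (Kmax : nat).
Hypothesis adm : admissible_model Kmax m.
Local Notation K := (ncomp m).

Let K0 : (0 < K)%N. Proof. by case: adm => /andP[]. Qed.

Definition parameter : Type :=
  (('I_K -> cube R d -> R) * ('I_K -> cube R d -> 'cV[R]_p)) *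
  ((('I_K -> R) * ('I_K -> 'M[R]_p)) * ('I_K -> 'M[R]_p)).

Definition parameter_set : set parameter :=
  (weight_set m `*` mean_set m) `*`
  ((component_set (volume m) `[Lm, Lp] `*`
    component_set (eigenvectors m) (@special_orthogonal R p)) `*`
   component_set (eigenvalues m) (normalized_eigenvalues lm lp)).

(** At [gamma = 0] these are the densities of the model, and for [gamma > 0]
    the functions that dominate them. *)
Definition inflated (gamma : R) (th : parameter) : cond_fun R d p :=
  gaussian_mixture th.1.1 th.1.2
    (fun k => cov (th.2.1.1 k / (1 - gamma)) (th.2.1.2 k) (th.2.2 k)).

Lemma densitiesP s : densities Lm Lp lm lp m s ->
  exists2 th, parameter_set th & s = inflated 0 th.
Proof.
move=> [w [u [S [Ww Uu [L [D [A [hL hD hA ->]]]] ->]]]].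
exists ((w, u), ((L, D), A)); first by split; split => //; split.
by rewrite /inflated/=; congr gaussian_mixture; apply/funext => k; rewrite subr0 divr1.
Qed.

Lemma inflated_valid gamma th : 0 <= gamma < 1 -> parameter_set th ->
  [/\ measurable_fun [set: cube R d * p.-tuple R] (fun z => inflated gamma th z.1 z.2),
      forall x y, 0 < inflated gamma th x y &
      forall x, (\int[lebesgue_tuple R p]_y (inflated gamma th x y)%:E = 1)%E].
Proof.
move=> /andP[g0 g1] [[Ww Uu] [[[hL _] [hD _]] [hA _]]].
case: adm => _ /(_ _ Ww)[mw _] _ /(_ _ Uu)[mu _] _.
have L0 k : 0 < th.2.1.1 k / (1 - gamma).
  rewrite divr_gt0 ?subr_gt0//; have := hL k; rewrite /= in_itv/= => /andP[+ _].
  exact: lt_le_trans.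
have A0 k i : 0 < th.2.2 k i i.
  by have [_ _ /(_ i)/andP[+ _]] := hA k; exact: lt_le_trans.
have diagA k : is_diag_mx (th.2.2 k) by case: (hA k).
have A1 k : \det (th.2.2 k) = 1 by case: (hA k).
split.
- exact: measurable_gaussian_mixture.
- by move=> x y; exact: gaussian_mixture_gt0.
- by move=> x; exact: integral_gaussian_mixture.
Qed.

Local Notation res := (resolution p Lm lm lp).

Definition close_parameters gamma (th th' : parameter) :=
  ((forall k x, `|th.1.1 k x - th'.1.1 k x| <= gamma) /\
   (forall k x, sqnorm (th.1.2 k x - th'.1.2 k x) <= (res * gamma) ^+ 2)) /\
  (((forall k, `|th.2.1.1 k - th'.2.1.1 k| <= res * gamma) /\
   (forall k i j, `|th.2.1.2 k i j - th'.2.1.2 k i j| <= res * gamma)) /\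
  (forall k i, `|th.2.2 k i i - th'.2.2 k i i| <= res * gamma)).

Lemma inflated_dominates gamma th th' x y : 0 < gamma <= 1 / 2 ->
  parameter_set th -> parameter_set th' -> close_parameters gamma th th' ->
  inflated 0 th x y <= expR (5 * p%:R * gamma) * inflated gamma th' x y.
Proof.
move=> /andP[g0 g1] [[Ww Uu] [[[hL _] [hD _]] [hA _]]].
move=> [[Ww' Uu'] [[[hL' _] [hD' _]] [hA' _]]].
move=> [[cw cu] [[cL cD] cA]].
rewrite /inflated /gaussian_mixture mulr_sumr; apply: ler_sum => k _.
have p1 : 1 <= p%:R :> R by rewrite ler1n.
have e5 : expR (2 * gamma) * expR (3 * p%:R * gamma) <= expR (5 * p%:R * gamma).
  by rewrite -expRD ler_expR; nra.
have lw := @logistic_weight_le R d K K0 th.1.1 th'.1.1 gamma k x (fun k => cw k x).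
have [DD D1] := hD k; have [DD' D1'] := hD' k.
have [diagA A1 A0] := hA k; have [diagA' A1' A0'] := hA' k.
have Lk : Lm <= th.2.1.1 k by have := hL k; rewrite /= in_itv/= => /andP[].
have Lk' : Lm <= th'.2.1.1 k by have := hL' k; rewrite /= in_itv/= => /andP[].
have := @gaussian_density_le R p Lm lm lp p0 Lm0 lm0 lmp gamma (th.2.1.2 k)
  (th'.2.1.2 k) (th.2.2 k) (th'.2.2 k) g0 g1 DD DD' _ A0' (cD k) (cA k)
  _ _ _ _ Lk Lk' (cL k) diagA diagA' D1 A1 D1' A1' (cu k x) y.
move=> /(_ (fun i => (andP (A0 i)).1)) lG.
rewrite subr0 divr1.
have G'0 : 0 <= gaussian_density (th'.1.2 k x)
    (cov (th'.2.1.1 k / (1 - gamma)) (th'.2.1.2 k) (th'.2.2 k)) y.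
  by rewrite /gaussian_density divr_ge0 ?expR_ge0.
have G0 : 0 <= gaussian_density (th.1.2 k x)
    (cov (th.2.1.1 k) (th.2.1.2 k) (th.2.2 k)) y.
  by rewrite /gaussian_density divr_ge0 ?expR_ge0.
have w0 := ltW (@logistic_weight_gt0 R d K K0 th.1.1 k x).
have w0' := ltW (@logistic_weight_gt0 R d K K0 th'.1.1 k x).
apply: le_trans (ler_pM w0 G0 lw lG) _.
rewrite mulrACA; apply: ler_wpM2r e5; exact: mulr_ge0.
Qed.

Variables (CW CU : R).
Hypotheses
  (entW : entropy_bound (@weight_dist R d K) (weight_set m)
            (metric_dim (@weight_dist R d K) (weight_set m)) CW)
  (entU : entropy_bound (@mean_dist R d p K) (mean_set m)
            (metric_dim (@mean_dist R d p K) (mean_set m)) CU).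

Let B := 1 + Lp + lp.

(** At [gamma = 1 / (10 p n)], the first three terms inside the logarithm are,
    up to a factor [n], the inverse scales at which the weights and the means
    are covered and the number of grid steps for the covariances. *)
Definition net_constant : R := `|CW| + `|CU| +
  ln (20 * p%:R + 20 * p%:R / res + 20 * p%:R * (1 + Lp + lp) / res + 1).

Hypothesis Lmp : Lm <= Lp.

Let sum_bounds (a b c : R) : 20 <= a -> 0 < b -> 0 < c ->
  [/\ 1 <= a + b + c + 1, a <= a + b + c + 1, b <= a + b + c + 1 &
      c + 1 <= a + b + c + 1].
Proof. by move=> a20 b0 c0; split; lra. Qed.

(* Each scalar parameter, and each unit of entropy dimension, costs at most
   [z]; the factor 4 comes from the crude count of the entries of matrices. *)
Let entropy_sum (a b z nL nD nA q r lw lu lN lD lA : R) :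
  0 <= nL * z -> 0 <= a * z -> 0 <= b * z -> lw <= a * z -> lu <= b * z ->
  nL * lN <= nL * z -> nD * lD <= nD * (4 * q * z) -> nA * lA <= nA * (4 * r * z) ->
  lw + lu + (nL * lN + nD * lD + nA * lA) <=
  4 * (z * (a + b + (nL + q * nD + r * nA))).
Proof. lra. Qed.

(** The scale of order [1 / (p n)] is the one at which the factor
    [e ^ (5 p gamma)] of [inflated_dominates] stays below [1 + 1 / n]; the
    entropy then grows like [ln n] times the dimension. *)
Lemma codes_parameters (n : nat) : (0 < n)%N -> parameter_set !=set0 ->
  exists C : finType,
    codes C (close_parameters (1 / (10 * p%:R * n%:R))) parameter_set /\
    ln (#|C|%:R : R) <= 4 * ((net_constant + ln n%:R) * dim_model m).
Proof.
move=> n0 [[[w0 u0] [[L0 D0] A0]] [[Ww0 Uu0] [[L0s D0s] A0s]]].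
rewrite /= in Ww0 Uu0 L0s D0s A0s.
set g := 1 / _; pose tau := res * g.
have p1 : 1 <= p%:R :> R by rewrite ler1n.
have n1 : 1 <= n%:R :> R by rewrite ler1n.
have pn1 : 1 <= p%:R * n%:R :> R by rewrite mulr_ege1.
have g0 : 0 < g by rewrite divr_gt0// !mulr_gt0// ltr0n.
have g1 : g <= 1 by rewrite ler_pdivrMr ?mul1r -?mulrA ?mulr_gt0 ?ltr0n//; lra.
have r0 : 0 < res by exact: resolution_gt0.
have r1 : res <= 1 by exact: resolution_le1.
have tau0 : 0 < tau by rewrite mulr_gt0.
have tau1 : tau <= 1 by rewrite /tau -[leRHS]mulr1; apply: ler_pM => //; exact: ltW.
have sq2 : 1 <= Num.sqrt 2 :> R by rewrite -[leLHS]sqrtr1 ler_wsqrtr// ler1n.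
have half (x : R) : 0 < x -> x <= 1 -> 0 < x / 2 <= Num.sqrt 2.
  by move=> x0 x1; rewrite divr_gt0//=; apply: le_trans sq2; lra.
have [CWt [cW lnW]] := codes_weights (ex_intro _ _ Ww0) entW (half _ g0 g1).
have [CUt [cU lnU]] := codes_means (ex_intro _ _ Uu0) entU (half _ tau0 tau1).
have dW := entropy_bound_dim_ge0 (ex_intro _ _ Ww0) entW.
have dU := entropy_bound_dim_ge0 (ex_intro _ _ Uu0) entU.
have Lp0 : 0 < Lp by exact: lt_le_trans Lmp.
have lp0 : 0 < lp by exact: lt_le_trans lmp.
have B1 : 1 <= B by rewrite /B; lra.
have BL : Lp <= B by rewrite /B; lra.
have Bl : lp <= B by rewrite /B; lra.
have [CDt [cD lnD]] := codes_orthogonal p0 tau0 B1.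
have [CAt [cA lnA]] := codes_eigenvalues p0 tau0 B1 lm0 Bl.
pose N := grid_size B tau.
have cL : codes 'I_N (fun x y : R => `|x - y| <= tau) `[Lm, Lp].
  have [c hc] := codes_interval B tau0; exists c => x y.
  rewrite /= !in_itv/= => /andP[x1 x2] /andP[y1 y2]; apply: hc => /=.
  - by rewrite ger0_norm ?(le_trans x2)// (le_trans (ltW Lm0)).
  - by rewrite ger0_norm ?(le_trans y2)// (le_trans (ltW Lm0)).
have cL' := codes_component (volume m)
  (fun t : R => eq_ind_r (fun z => `|z| <= tau) (eq_ind_r (fun z => z <= tau)
     (ltW tau0) (normr0 _)) (subrr t)) K0 cL.
have reflD (t : 'M[R]_p) i j : `|t i j - t i j| <= tau by rewrite subrr normr0 ltW.
have cD' := codes_component (eigenvectors m) reflD K0 cD.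
have cA' := codes_component (eigenvalues m) (fun t i => reflD t i i) K0 cA.
have [c hc] := codes_prod (codes_prod cW cU) (codes_prod (codes_prod cL' cD') cA').
eexists; split.
  exists c => th th' Fth Fth' E; have [[h1 h2] [[h3 h4] h5]] := hc _ _ Fth Fth' E.
  split; split => //.
  - by move=> k x; rewrite (le_trans (h1 k x))// mulrC divfK.
  - by move=> k x; rewrite (le_trans (h2 k x))// [2 * _]mulrC divfK.
rewrite !card_prod !card_ffun !card_ord !natrM !natrX.
have W0 : 0 < #|CWt|%:R :> R by rewrite ltr0n (card_codes w0 cW).
have U0 : 0 < #|CUt|%:R :> R by rewrite ltr0n (card_codes u0 cU).
have Dt0 : 0 < #|CDt|%:R :> R by rewrite ltr0n (card_codes (D0 (Ordinal K0)) cD).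
have At0 : 0 < #|CAt|%:R :> R by rewrite ltr0n (card_codes (A0 (Ordinal K0)) cA).
have N0 : 0 < N%:R :> R by rewrite ltr0n.
rewrite !lnM ?posrE ?mulr_gt0 ?exprn_gt0// !lnXn// -![ln _ *+ _]mulr_natl.
have p20 : 20 <= 20 * p%:R :> R by rewrite ler_peMr.
pose kU := 20 * p%:R / res; pose kN := 20 * p%:R * B / res.
have kU0 : 0 < kU by rewrite divr_gt0// mulr_gt0// ltr0n.
have kN0 : 0 < kN by rewrite divr_gt0// !mulr_gt0 ?ltr0n// (lt_le_trans ltr01).
pose k0 := 20 * p%:R + kU + kN + 1.
have [k01 kW_le kU_le kN_le] : [/\ 1 <= k0, 20 * p%:R <= k0, kU <= k0 & kN + 1 <= k0].
  exact: sum_bounds p20 kU0 kN0.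
have lnn0 : 0 <= ln n%:R :> R by rewrite ln_ge0.
pose z := net_constant + ln n%:R.
have ncE : net_constant = `|CW| + `|CU| + ln k0 by [].
have lnk0 : 0 <= ln k0 by rewrite ln_ge0.
have z0 : 0 <= z by rewrite /z ncE !addr_ge0.
have ln_le x : 0 < x -> x <= k0 * n%:R -> ln x <= ln k0 + ln n%:R.
  move=> x0 xk; rewrite -lnM ?posrE ?ltr0n// ?(lt_le_trans ltr01)//.
  by rewrite ler_ln ?posrE// (lt_le_trans x0).
have gE : 1 / (g / 2) = 20 * p%:R * n%:R.
  by rewrite /g; field; rewrite !pnatr_eq0 -!lt0n p0 n0.
have tE : 1 / (tau / 2) = kU * n%:R.
  by rewrite /tau /g /kU; field; rewrite !pnatr_eq0 -!lt0n p0 n0 gt_eqF.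
have BE : 2 * B / tau = kN * n%:R.
  by rewrite /tau /g /kN; field; rewrite !pnatr_eq0 -!lt0n p0 n0 gt_eqF.
have zE (v x : R) : v <= `|CW| + `|CU| -> x <= ln k0 + ln n%:R -> v + x <= z.
  by rewrite /z ncE -addrA; exact: lerD.
have Wz : CW + ln (1 / (g / 2)) <= z.
  apply: zE; first by rewrite (le_trans (ler_norm _))// lerDl.
  by apply: ln_le; [rewrite divr_gt0// divr_gt0|rewrite gE ler_wpM2r].
have Uz : CU + ln (1 / (tau / 2)) <= z.
  apply: zE; first by rewrite (le_trans (ler_norm _))// lerDr.
  by apply: ln_le; [rewrite divr_gt0// divr_gt0|rewrite tE ler_wpM2r].
have Nz : ln N%:R <= z.
  apply: le_trans (ln_grid_size tau0 B1) _; rewrite -[leLHS]add0r.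
  apply: zE; first by rewrite addr_ge0.
  have BN0 : 0 <= 2 * B / tau by rewrite BE mulr_ge0// ltW.
  apply: ln_le; first by rewrite ltr_wpDl.
  apply: le_trans (ler_wpM2r (ler0n R n) kN_le).
  by rewrite BE mulrDl mul1r lerD2l.
have Dz : ln #|CDt|%:R <= 4 * ((p * (p - 1)) %/ 2)%:R * z.
  by apply: le_trans lnD _; apply: ler_wpM2l.
have Az : ln #|CAt|%:R <= 4 * (p - 1)%:R * z.
  by apply: le_trans lnA _; apply: ler_wpM2l.
have lnWz := le_trans lnW (ler_wpM2l dW Wz).
have lnUz := le_trans lnU (ler_wpM2l dU Uz).
rewrite -/z /dim_model /dim_cov !natrD !natrM.
move: (component_count (volume m)) (component_count (eigenvectors m))
  (component_count (eigenvalues m)) => nL nD nA.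
have LN := ler_wpM2l (ler0n R nL) Nz.
have LD := ler_wpM2l (ler0n R nD) Dz.
have LA := ler_wpM2l (ler0n R nA) Az.
have zL : 0 <= nL%:R * z by rewrite mulr_ge0.
have zW := mulr_ge0 dW z0; have zU := mulr_ge0 dU z0.
exact: (entropy_sum zL zW zU lnWz lnUz LN LD LA).
Qed.

(** Each attained label contributes the inflation of one parameter that bears
    it, multiplied by the factor of [inflated_dominates]. *)
Lemma upper_net (n : nat) : (0 < n)%N -> densities Lm Lp lm lp m !=set0 ->
  exists (J : finType) (t : J -> cond_fun R d p),
  [/\ forall j, [/\ measurable_fun [set: cube R d * p.-tuple R] (fun z => t j z.1 z.2),
        forall x y, 0 <= t j x y &
        forall x, (\int[lebesgue_tuple R p]_y (t j x y)%:E <= (1 + n%:R^-1)%:E)%E],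
      forall s, densities Lm Lp lm lp m s -> exists j, forall x y, s x y <= t j x y,
      (0 < #|J|)%N &
      ln (#|J|%:R : R) <= 4 * ((net_constant + ln n%:R) * dim_model m)].
Proof.
move=> n0 [s /densitiesP[th0 Fth0 _]].
have [C [[c hc] lnC]] := codes_parameters n0 (ex_intro _ _ Fth0).
set g := 1 / _ in hc.
have n1 : 1 <= n%:R :> R by rewrite ler1n.
have pn1 : 1 <= p%:R * n%:R :> R by rewrite mulr_ege1// ler1n.
have g0 : 0 < g by rewrite divr_gt0// !mulr_gt0// ltr0n.
have g1 : g <= 1 / 2.
  by rewrite ler_pdivrMr ?mulr_gt0 ?ltr0n//; lra.
have g01 : 0 <= g < 1 by rewrite ltW//=; lra.
have /choice[rep hrep] : forall j, exists th,
    (exists2 th', parameter_set th' & c th' = j) -> parameter_set th /\ c th = j.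
  move=> j; have [[th' Fth' cj]|no] := pselect (exists2 th', parameter_set th' & c th' = j).
    by exists th'.
  by exists th0 => /no.
pose e := expR (5 * p%:R * g).
pose occ j := `[< exists2 th', parameter_set th' & c th' = j >].
have eE : e <= 1 + n%:R^-1.
  have -> : e = expR (n%:R^-1 / 2).
    by congr expR; rewrite /g; field; rewrite !pnatr_eq0 -!lt0n p0 n0.
  have in0 : 0 < n%:R^-1 :> R by rewrite invr_gt0 ltr0n.
  have in1 : n%:R^-1 <= 1 :> R by rewrite invf_le1 ?ltr0n.
  move: in0 in1; move: (n%:R^-1 : R) => v v0 v1.
  (* e^(v/2) <= 1 / (1 - v/2) <= 1 + v *)
  have := expR_ge1Dx (- (v / 2)); rewrite expRN => h.
  have ev0 := expR_gt0 (v / 2).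
  have : (1 - v / 2) * expR (v / 2) <= 1.
    by rewrite -ler_pdivlMr// div1r.
  nra.
exists C, (fun j x y => if occ j then e * inflated g (rep j) x y else 0); split.
- move=> j; case: (boolP (occ j)) => [/asboolP/hrep[Fth _]|_].
    have [mi i0 i1] := inflated_valid g01 Fth; split.
    + exact: measurable_funM.
    + by move=> x y; rewrite mulr_ge0 ?expR_ge0// ltW.
    + move=> x; under eq_integral do rewrite EFinM.
      rewrite ge0_integralZl//=.
      * by rewrite i1 mule1 lee_fin.
      * by apply/measurable_EFinP; exact: (measurable_section (F := fun z => inflated g (rep j) z.1 z.2)).
      * by move=> y _; rewrite lee_fin ltW.
      * by rewrite lee_fin expR_ge0.
  split => //.
  by move=> x; rewrite integral0 lee_fin addr_ge0.
- move=> _ /densitiesP[th Fth ->]; exists (c th) => x y.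
  have ex : exists2 th', parameter_set th' & c th' = c th by exists th.
  rewrite ifT; last exact/asboolP.
  have [Fr cr] := hrep _ ex.
  by apply: inflated_dominates => //; [rewrite g0|exact: hc].
- by apply/card_gt0P; exists (c th0).
- exact: lnC.
Qed.

End one_model.
End upper_nets.

(** * Expectations of products over the sample *)

Section sample.
Local Open Scope ereal_scope.
Context (R : realType) (d p : nat) (s : cond_fun R d p).
Hypothesis cs : cond_density s.
Context {disp : measure_display} {Omega : measurableType disp}.
Variables (P : probability Omega R) (n : nat).
Variables (X : 'I_n -> {RV P >-> cube R d}) (Y : 'I_n -> {RV P >-> p.-tuple R}).

Local Notation cond_exp := (kernel_exp (lebesgue_tuple R p) s).

Let ms : measurable_fun [set: cube R d * p.-tuple R] (fun z => s z.1 z.2).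
Proof. by case: cs. Qed.

Let s0 x y : (0 <= s x y)%R.
Proof. by case: cs => _ + _; exact. Qed.

Let s1 x : \int[lebesgue_tuple R p]_y (s x y)%:E = 1.
Proof. by case: cs. Qed.

Let prod_indic I (r : seq I) (C : I -> set Omega) w :
  (\prod_(i <- r) (\1_(C i) w : R))%R = (all (fun i => w \in C i) r)%:R.
Proof.
elim: r => [|i r IH]; first by rewrite big_nil.
by rewrite big_cons IH indicE -natrM mulnb.
Qed.

Let allE (C : 'I_n -> set Omega) w :
  all (fun i => w \in C i) (index_enum 'I_n) = (w \in \bigcap_i C i).
Proof.
apply/allP/idP => [h|/set_mem h i _]; last exact/mem_set/h.
by apply/mem_set => i _; apply/set_mem/h; rewrite mem_index_enum.
Qed.

Let mpreim d' (T : measurableType d') (f : 'I_n -> {RV P >-> T}) (A : 'I_n -> set T) :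
  (forall i, measurable (A i)) -> measurable (\bigcap_i (f i @^-1` A i)).
Proof.
move=> mA; apply: fin_bigcap_measurable => // i _.
by rewrite -[X in measurable X]setTI; exact: measurable_funPT.
Qed.

(** The conditional independence assumption is the case of indicators of
    rectangles. *)
Lemma expectation_prod_responses (F : 'I_n -> cube R d * p.-tuple R -> R) :
  cond_independent_responses X Y s ->
  (forall i, measurable_fun setT (F i)) -> (forall i z, (0 <= F i z)%R) ->
  (forall i, exists c : R, forall x, cond_exp (EFin \o F i) x <= c%:E) ->
  \int[P]_w (\prod_i F i (X i w, Y i w))%:E =
  \int[P]_w (\prod_i fine (cond_exp (EFin \o F i) (X i w)))%:E.
Proof.
move=> XY mF F0 Fc.
apply: (@expectation_prod_kernel R _ _ _ _ _ _ P n (fun=> lebesgue_tuple R p)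
  (fun=> s) (fun i => X i) (fun i => Y i)) => // A B mA mB.
pose box := [set t : n.-tuple (cube R d) | forall i, A i (tnth t i)].
have mbox : measurable box.
  rewrite /box (_ : [set _ | _] = \bigcap_(i in [set: 'I_n])
    ((fun t : n.-tuple (cube R d) => tnth t i) @^-1` A i)).
    apply: fin_bigcap_measurable => // i _; rewrite -[X in measurable X]setTI.
    exact: measurable_tnth.
  by apply/seteqP; split=> [t At i _|t At i]; [exact: At|exact: (At i)].
have := XY box B mbox mB; set XA := _ @^-1` box => /= H.
have XAE : XA = \bigcap_i (X i @^-1` A i).
  apply/seteqP; split => [w Aw i _|w Aw i].
    by have := Aw i; rewrite tnth_mktuple.
  by rewrite tnth_mktuple; exact: Aw.
transitivity (P (XA `&` \bigcap_i (Y i @^-1` B i))).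
  rewrite -[X in P X]setIT -integral_indic//; last first.
    by apply: measurableI; [rewrite XAE; exact: mpreim|exact: mpreim].
  apply: eq_integral => w _; congr EFin.
  rewrite indicE in_setI -mulnb natrM XAE -!allE -!prod_indic -big_split/=.
  by apply: eq_bigr => i _; rewrite !indicE in_setX -natrM mulnb.
rewrite H integral_mkcond epatch_indic; apply: eq_integral => w _ /=.
rewrite indicE XAE -allE -prod_indic -prodEFin -big_split/=.
by apply: eq_bigr => i _; rewrite kernel_exp_indic// muleC !indicE.
Qed.

(** The product formula, with trivial factors at the other indices, gives the
    case of rectangles; [weighted_disintegration] extends it to functions whose
    conditional expectation may be unbounded or infinite. *)
Lemma expectation_response i F : cond_independent_responses X Y s ->
  measurable_fun setT F -> (forall z, 0 <= F z) ->
  \int[P]_w F (X i w, Y i w) = \int[P]_w cond_exp F (X i w).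
Proof.
move=> XY mF F0.
have := @weighted_disintegration R _ Omega P _ _ _ _ (lebesgue_tuple R p) s ms s0
  (cst 1%R) (cst 1%R) (X i) (Y i) (measurable_cst _) (measurable_cst _)
  (fun=> ler01) (fun=> ler01).
move=> /(_ _ _ _ _ F) h.
under eq_integral do rewrite -[F _]mul1e.
under [RHS]eq_integral do rewrite -[cond_exp _ _]mul1e.
apply: h => //.
  rewrite -[ltLHS]/(\int[P]_w cst 1 w) integral_cst//= probability_setT.
  by rewrite mule1 ltry.
move=> A B mA mB /=.
pose H j : cube R d * p.-tuple R -> R :=
  if j == i then \1_(A `*` B) else \1_(setT `*` setT).
have mH j : measurable_fun setT (H j).
  by rewrite /H; case: eqP => _; apply: measurable_indic; exact: measurableX.
have Hle j x : cond_exp (EFin \o H j) x <= 1.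
  by rewrite /H; case: eqP => _; exact: kernel_exp_indic_le1.
have H0 j z : (0 <= H j z)%R by rewrite /H; case: eqP.
have HE x : cond_exp (EFin \o H i) x =
    (fine (cond_exp (EFin \o H i) x))%:E.
  rewrite fineK// ge0_fin_numE ?(le_lt_trans (Hle i x)) ?ltry//.
  by apply: kernel_exp_ge0 => // z; rewrite lee_fin.
have := expectation_prod_responses XY mH H0 (fun j => ex_intro _ 1%R (Hle j)).
have kap1 x j : j != i -> fine (cond_exp (EFin \o H j) x) = 1%R.
  move=> /negbTE ji; rewrite /H ji /kernel_exp setXTT indicT /=.
  by under eq_integral do rewrite mule1; rewrite s1.
have HX w : (\prod_j H j (X j w, Y j w) = \1_(A `*` B) (X i w, Y i w))%R.
  rewrite (bigD1 i)//= /H eqxx big1 ?mulr1// => j /negbTE ->.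
  by rewrite setXTT indicT.
have HK w : (\prod_j fine (cond_exp (EFin \o H j) (X j w)) =
    fine (cond_exp (EFin \o H i) (X i w)))%R.
  by rewrite (bigD1 i)//= big1 ?mulr1// => j ji; rewrite kap1.
under eq_integral do rewrite HX -[_%:E]mul1e.
move=> ->; apply: eq_integral => w _; rewrite HK mul1e -HE.
by rewrite /H eqxx.
Qed.

(** Independence is the product formula for kernels starting from a single
    point, with the law of each covariate as reference measure. *)
Lemma expectation_prod_covariates (g : 'I_n -> cube R d -> R) :
  independent_covariates X ->
  (forall i, measurable_fun setT (g i)) -> (forall i x, (0 <= g i x)%R) ->
  (forall i, \int[P]_w (g i (X i w))%:E < +oo) ->
  \int[P]_w (\prod_i g i (X i w))%:E =
  \prod_i \int[P]_w (g i (X i w))%:E.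
Proof.
move=> indX mg g0 goo.
pose law i := distribution P (X i).
have mcst1 : measurable_fun [set: unit * cube R d] (fun=> 1%R : R) by [].
have cexpE i (f : unit * cube R d -> \bar R) : measurable_fun setT f ->
    (forall z, 0 <= f z) -> kernel_exp (law i) (fun _ _ => 1%R) f tt =
    \int[P]_w f (tt, X i w).
  move=> mf f0; rewrite /kernel_exp; under eq_integral do rewrite mul1e.
  rewrite /law /distribution ge0_integral_pushforward//.
  exact: measurable_section.
have mF i : measurable_fun setT (fun z : unit * cube R d => g i z.2).
  exact: measurableT_comp.
have gE i : kernel_exp (law i) (fun _ _ => 1%R) (EFin \o (fun z => g i z.2)) tt =
    \int[P]_w (g i (X i w))%:E.
  have gi0 (z : unit * cube R d) : 0 <= (g i z.2)%:E by rewrite lee_fin.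
  by rewrite cexpE//; exact/measurable_EFinP.
have gfin i : \int[P]_w (g i (X i w))%:E \is a fin_num.
  rewrite ge0_fin_numE//; apply: integral_ge0 => w _; by rewrite lee_fin.
have := @expectation_prod_kernel R _ unit _ _ _ _ P n law (fun _ _ _ => 1%R)
  (fun _ _ => tt) (fun i => X i) (fun=> mcst1) (fun _ _ _ => ler01) _ _ _ _
  (fun i z => g i z.2) mF (fun i z => g0 i z.2).
move=> -> //=.
- under eq_integral do under eq_bigr do rewrite gE.
  rewrite -[LHS]/(\int[P]_w cst _ w) integral_cst//= probability_setT mule1.
  rewrite -prodEFin; by apply: eq_bigr => i _; rewrite fineK.
- by move=> i x; rewrite integral_cst//= mul1e /law probability_setT.
- move=> A B mA mB.
  pose B' i := if tt \in A i then B i else set0.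
  have mB' i : measurable (B' i) by rewrite /B'; case: ifP.
  have indE i w : \1_(A i `*` B i) (tt, X i w) = \1_(X i @^-1` B' i) w :> R.
    rewrite !indicE in_setX /= /B'; case: (tt \in A i) => //.
    by rewrite preimage_set0 in_set0.
  have mXB i : measurable (X i @^-1` B' i).
    by rewrite -[X in measurable X]setTI; exact: measurable_funPT.
  transitivity (P (\bigcap_i (X i @^-1` B' i))).
    rewrite -[X in P X]setIT -integral_indic//; last exact: mpreim.
    apply: eq_integral => w _; congr EFin.
    by rewrite indicE -allE -prod_indic; apply: eq_bigr => i _.
  rewrite (indX B' mB').
  have E i : kernel_exp (law i) (fun _ _ => 1%R)
      (fun z => (\1_(A i `*` B i) z)%:E) tt = P (X i @^-1` B' i).
    rewrite cexpE; last 2 first.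
    + by apply/measurable_EFinP/measurable_indic; exact: measurableX.
    + by move=> z; rewrite lee_fin.
    under eq_integral do rewrite indE.
    by rewrite integral_indic// setIT.
  under [RHS]eq_integral do under eq_bigr do rewrite E.
  by rewrite -[RHS]/(\int[P]_w cst _ w) integral_cst//= probability_setT mule1.
- by move=> i; exists (fine (\int[P]_w (g i (X i w))%:E)) => -[]; rewrite gE fineK.
Qed.

End sample.

(** * Countable mixtures of random variables *)

Section countable_mixture.
Local Open Scope ereal_scope.
Context (R : realType) (M : countType).

(** Enumerating the index type turns the unordered sum into a series, for which
    the expectation can be taken term by term. *)
Lemma nneseries_countable (a : M -> \bar R) : (forall m, 0 <= a m) ->
  \sum_(k <oo) oapp a 0 (pickle_inv k) = \esum_(m in [set: M]) a m.
Proof.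
move=> a0; pose b k := oapp a 0 (pickle_inv k : option M).
have b0 k : 0 <= b k by rewrite /b; case: pickle_inv.
have bE m : b (pickle m) = a m by rewrite /b pickleK_inv.
rewrite nneseries_esumT//.
transitivity (\esum_(k in range (@pickle M)) b k).
  rewrite [RHS]esum_mkcond; apply: eq_esum => k _.
  case: ifPn => // /negP nk; rewrite -/(b k) /b.
  case E: (pickle_inv k) => [m|] //=; exfalso; apply: nk; apply/mem_set.
  by exists m => //; have := @pickle_invK M k; rewrite E.
rewrite esum_image; first by apply: eq_esum => m _; rewrite bE.
by move=> m m' _ _; exact: (pcan_inj pickleK_inv).
Qed.

Context {disp : measure_display} {Omega : measurableType disp}.
Variables (P : probability Omega R).

(** A weighted sum dominates each of its terms, and its expectation is at most
    the sum of the weights. *)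
Lemma esum_mixture (x : M -> R) (Xi : R) (A : M -> Omega -> \bar R) :
  assumption_K x Xi -> (forall m, measurable_fun setT (A m)) ->
  (forall m w, 0 <= A m w) -> (forall m, \int[P]_w A m w <= 1) ->
  exists V : Omega -> \bar R,
  [/\ measurable_fun setT V, forall w, 0 <= V w,
      forall m w, (expR (- x m))%:E * A m w <= V w &
      \int[P]_w V w <= Xi%:E].
Proof.
move=> [x0 xXi] mA A0 A1.
pose a w m := (expR (- x m))%:E * A m w.
have a0 w m : 0 <= a w m by rewrite mule_ge0// lee_fin expR_ge0.
have ma m : measurable_fun setT (a ^~ m).
  by apply: emeasurable_funM => //; exact: measurable_cst.
pose b k w := oapp (a w) 0 (pickle_inv k : option M).
have b0 k w : 0 <= b k w by rewrite /b; case: pickle_inv => //= m; exact: a0.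
have mb k : measurable_fun setT (b k).
  by rewrite /b; case: pickle_inv => [m|] /=; [exact: ma|exact: measurable_cst].
exists (fun w => \sum_(k <oo) b k w); split.
- by apply: ge0_emeasurable_sum.
- by move=> w; apply: nneseries_ge0.
- move=> m w; rewrite nneseries_countable//; apply: esum_ge.
  exists [set m]; first by split.
  by rewrite fsbig_set1.
rewrite integral_nneseries//; apply: le_trans xXi.
have ex0 m : 0 <= (expR (- x m))%:E by rewrite lee_fin expR_ge0.
rewrite -nneseries_countable//; apply: lee_nneseries => [k _ _|k _].
  exact: integral_ge0.
rewrite /b; case: pickle_inv => [m|] /=; last by rewrite integral0.
rewrite ge0_integralZl//.
by rewrite -[leRHS]mule1 lee_wpmul2l.
Qed.

End countable_mixture.

(** * Averaged divergence to a mixture *)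

Section mean_entropy.
Context (R : realType) (d p : nat) (s0 : cond_fun R d p).
Hypothesis cs : cond_density s0.
Context {disp : measure_display} {Omega : measurableType disp}.
Variables (P : probability Omega R) (n : nat).
Variables (X : 'I_n -> {RV P >-> cube R d}).
Variables (rho delta : R).
Hypotheses (rho01 : 0 < rho < 1) (delta0 : 0 <= delta).
Local Notation mu := (lebesgue_tuple R p).

Let ms0 : measurable_fun [set: cube R d * p.-tuple R] (fun z => s0 z.1 z.2).
Proof. by case: cs. Qed.

Let s00 x y : 0 <= s0 x y.
Proof. by case: cs => _ + _; exact. Qed.

Let s01 x : (\int[mu]_y (s0 x y)%:E = 1)%E.
Proof. by case: cs. Qed.

Let msx x : measurable_fun setT (s0 x).
Proof. exact: (measurable_section (F := fun z => s0 z.1 z.2)). Qed.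

Definition sub_density (t : cond_fun R d p) := [/\
  measurable_fun [set: cube R d * p.-tuple R] (fun z => t z.1 z.2),
  forall x y, 0 <= t x y &
  forall x, (\int[mu]_y (t x y)%:E <= (1 + delta)%:E)%E].

Lemma cond_density_sub t : cond_density t -> sub_density t.
Proof. by move=> [mt t0 t1]; split => // x; rewrite t1 lee_fin lerDl. Qed.

Definition entropy_at (t : cond_fun R d p) x := mix_entropy mu (s0 x) rho (t x).

(** The loss of an estimator is an expectation over covariates independent of
    the sample, so divergences enter through their means and not through their
    values at the observed covariates. *)
Definition mean_entropy (t : cond_fun R d p) i : R :=
  \int[P]_w entropy_at t (X i w).

Let mixz (t : cond_fun R d p) (z : cube R d * p.-tuple R) :=
  mix (s0 z.1) rho (t z.1) z.2.

Let mmixz t : sub_density t -> measurable_fun setT (mixz t).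
Proof.
by move=> [mt _ _]; apply: measurable_funD; apply: measurable_funM => //; exact: measurable_cst.
Qed.

Let mixz0 t z : sub_density t -> 0 <= mixz t z.
Proof. by move=> [_ t0 _]; exact: mix_ge0. Qed.

Lemma measurable_integral_section (F : cube R d * p.-tuple R -> R) :
  measurable_fun setT F -> measurable_fun setT (fun x => (\int[mu]_y (F (x, y))%:E)%E).
Proof.
move=> mF.
have mFE : measurable_fun setT (EFin \o F) by exact/measurable_EFinP.
under eq_fun do rewrite integralE.
apply: emeasurable_funB.
- rewrite (_ : (fun x => _) = fubini_F mu (EFin \o F)^\+%E); last first.
    by apply/funext => x; apply: eq_integral => y _; rewrite !funeposE.
  by apply: measurable_fun_fubini_tonelli_F => //; exact: measurable_funepos.
- rewrite (_ : (fun x => _) = fubini_F mu (EFin \o F)^\-%E); last first.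
    by apply/funext => x; apply: eq_integral => y _; rewrite !funenegE.
  by apply: measurable_fun_fubini_tonelli_F => //; exact: measurable_funeneg.
Qed.

Lemma measurable_entropy_at t : sub_density t -> measurable_fun setT (entropy_at t).
Proof.
move=> st; rewrite /entropy_at /mix_entropy /Rintegral.
apply: (@measurableT_comp _ _ _ _ _ _ fine); first exact: fine_measurable.
apply: (measurable_integral_section
  (F := fun z => s0 z.1 z.2 * ln (s0 z.1 z.2 / mixz t z))).
apply: measurable_funM => //; apply: (measurableT_comp (@measurable_ln R)).
apply: measurable_funM => //; apply: measurable_funV; last exact: mmixz.
by move=> z; exact: mixz0.
Qed.

Lemma entropy_at_bounds t x : sub_density t ->
  - (rho * delta) <= entropy_at t x <= - ln (1 - rho).
Proof.
move=> [mt t0 t1].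
have mtx : measurable_fun setT (t x).
  exact: (measurable_section (F := fun z => t z.1 z.2)).
apply/andP; split.
  exact: (@mix_entropy_ge _ _ _ _ (s0 x) (msx x) (s00 x) (s01 x) rho delta).
exact: (@mix_entropy_le _ _ _ _ (s0 x) (msx x) (s00 x) (s01 x) rho delta).
Qed.

Let icst (c : R) : P.-integrable setT (EFin \o (fun _ : Omega => c)).
Proof. exact: finite_measure_integrable_cst. Qed.

Lemma integrable_entropy_at t i : sub_density t ->
  P.-integrable setT (EFin \o (fun w => entropy_at t (X i w))).
Proof.
move=> st.
apply: (@normr_le_integrable _ _ _ _ _ (fun=> rho * delta - ln (1 - rho))).
- by apply: measurableT_comp => //; exact: measurable_entropy_at.
- move=> w; have /andP[h1 h2] := entropy_at_bounds (X i w) st.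
  case/andP: rho01 => r0 r1.
  have : 0 <= rho * delta by rewrite mulr_ge0// ltW.
  have : 0 <= - ln (1 - rho) by rewrite oppr_ge0 ln_le0// lerBlDr lerDl ltW.
  by rewrite ler_norml; lra.
- exact: finite_measure_integrable_cst.
Qed.

Lemma mean_entropy_ge0 t i : cond_density t -> 0 <= mean_entropy t i.
Proof.
move=> ct; apply: Rintegral_ge0 => w _; case: ct => mt t0 t1.
apply: (@mix_entropy_ge0 _ _ _ _ (s0 (X i w)) (msx _) (s00 _) (s01 _) rho delta) => //.
exact: (measurable_section (F := fun z => t z.1 z.2)).
Qed.

Lemma mean_entropy_le_dominated t t' i : sub_density t -> cond_density t' ->
  (forall x y, t' x y <= t x y) ->
  mean_entropy t' i <= mean_entropy t i + rho * delta / (1 - rho).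
Proof.
move=> st ct' tt'; have st' := cond_density_sub ct'.
have <- : \int[P]_w (entropy_at t (X i w) + rho * delta / (1 - rho)) =
    mean_entropy t i + rho * delta / (1 - rho).
  rewrite RintegralD//; last exact: integrable_entropy_at.
  by rewrite Rintegral_cst//= probability_setT mulr1.
apply: le_Rintegral => //.
- exact: integrable_entropy_at.
- exact: (integrableD measurableT (integrable_entropy_at i st) (icst _)).
- move=> w _; case: (st) => mt t0 t1; case: ct' => mt' t'0 t'1.
  apply: (@mix_entropy_le_dominated _ _ _ _ (s0 (X i w)) (msx _) (s00 _) (s01 _) rho delta) => //.
    exact: (measurable_section (F := fun z => t z.1 z.2)).
  exact: (measurable_section (F := fun z => t' z.1 z.2)).
Qed.

(** Each divergence is finite, at most [- ln (1 - rho)], since the mixture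
    contains the part [(1 - rho) s0]; hence the loss is a real number. *)
Lemma JKLnE t : cond_density t ->
  JKLn X rho s0 t = (n%:R^-1 * (rho^-1 * \sum_(i < n) mean_entropy t i))%:E.
Proof.
move=> ct; have st := cond_density_sub ct; case: (st) => mt t0 t1.
rewrite /JKLn.
have KLE w i : KL (s0 (X i w))
    (fun y => (1 - rho) * s0 (X i w) y + rho * t (X i w) y) =
    (entropy_at t (X i w))%:E.
  apply: (@mix_entropyE _ _ _ _ (s0 (X i w)) (msx _) (s00 _) (s01 _) rho delta) => //.
  exact: (measurable_section (F := fun z => t z.1 z.2)).
have E w : (n%:R^-1%:E * \sum_(i < n) (rho^-1%:E *
    KL (s0 (X i w)) (fun y => ((1 - rho) * s0 (X i w) y + rho * t (X i w) y)%R)))%E =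
    (n%:R^-1 * (rho^-1 * \sum_(i < n) entropy_at t (X i w)))%:E.
  under eq_bigr do rewrite KLE -EFinM.
  by rewrite sumEFin -EFinM -mulr_sumr.
under eq_integral do rewrite E.
have isum (r : seq 'I_n) : P.-integrable setT
    (EFin \o (fun w => \sum_(i <- r) entropy_at t (X i w))).
  elim: r => [|i r IH].
    rewrite (_ : _ \o _ = cst 0%E); first exact: integrable0.
    by apply/funext => w; rewrite /= big_nil.
  have := integrableD measurableT (integrable_entropy_at i st) IH.
  apply: eq_integrable => // w _; by rewrite /= big_cons.
have Isum (r : seq 'I_n) : \int[P]_w (\sum_(i <- r) entropy_at t (X i w)) =
    \sum_(i <- r) mean_entropy t i.
  elim: r => [|i r IH].
    by under eq_Rintegral do rewrite big_nil; rewrite big_nil Rintegral_cst//= mul0r.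
  under eq_Rintegral do rewrite big_cons.
  by rewrite big_cons RintegralD ?IH//; exact: integrable_entropy_at.
have i1 := integrableZl measurableT rho^-1 (isum (index_enum _)).
rewrite RintegralE; last exact: (integrableZl measurableT n%:R^-1 i1).
by rewrite !RintegralZl// Isum.
Qed.

End mean_entropy.

(** * Exponential moment of the likelihood ratio *)

Section likelihood_ratio.
Context (R : realType) (d p : nat) (s0 : cond_fun R d p).
Hypothesis cs : cond_density s0.
Context {disp : measure_display} {Omega : measurableType disp}.
Variables (P : probability Omega R) (n : nat).
Variables (X : 'I_n -> {RV P >-> cube R d}) (Y : 'I_n -> {RV P >-> p.-tuple R}).
Hypotheses (indX : independent_covariates X)
  (XY : cond_independent_responses X Y s0).
Variables (rho delta a theta : R).
Hypotheses (rho01 : 0 < rho < 1) (delta0 : 0 <= delta) (theta01 : 0 < theta < 1)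
  (aI : 0 <= a <= (1 - theta) * (1 - rho)).
Local Notation mu := (lebesgue_tuple R p).
Local Notation sub_density := (sub_density delta).
Local Notation mean_entropy := (mean_entropy s0 X rho).

Let ms0 : measurable_fun [set: cube R d * p.-tuple R] (fun z => s0 z.1 z.2).
Proof. by case: cs. Qed.

Let s00 x y : 0 <= s0 x y.
Proof. by case: cs => _ + _; exact. Qed.

Let s01 x : (\int[mu]_y (s0 x y)%:E = 1)%E.
Proof. by case: cs. Qed.

Let msx x : measurable_fun setT (s0 x).
Proof. exact: (measurable_section (F := fun z => s0 z.1 z.2)). Qed.

Definition mix_ratio (t : cond_fun R d p) (z : cube R d * p.-tuple R) : R :=
  mix (s0 z.1) rho (t z.1) z.2 / s0 z.1 z.2.

Lemma measurable_mix_ratio t : sub_density t -> measurable_fun setT (mix_ratio t).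
Proof.
move=> [mt t0 _]; apply: measurable_funM; last exact: measurable_funV.
by apply: measurable_funD; apply: measurable_funM => //; exact: measurable_cst.
Qed.

Let pw t z := mix_ratio t z `^ a.

Let g t x := fine (kernel_exp mu s0 (EFin \o pw t) x).

Let gE t x : sub_density t ->
  [/\ kernel_exp mu s0 (EFin \o pw t) x = (g t x)%:E,
      0 <= g t x &
      g t x <= 1 + (a * delta - a * theta * entropy_at s0 rho t x)].
Proof.
move=> [mt t0 t1].
have mtx : measurable_fun setT (t x).
  exact: (measurable_section (F := fun z => t z.1 z.2)).
have ge0 : (0 <= kernel_exp mu s0 (EFin \o pw t) x)%E.
  by apply: kernel_exp_ge0 => // z; rewrite lee_fin powR_ge0.
have le1 : (kernel_exp mu s0 (EFin \o pw t) x <=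
    (1 + (a * delta - a * theta * entropy_at s0 rho t x))%:E)%E.
  have := @mix_power_moment _ _ _ mu (s0 x) (msx x) (s00 x) (s01 x) rho delta rho01
    delta0 (t x) mtx (t0 x) (t1 x) a theta theta01 aI.
  by apply: le_trans; rewrite le_eqVlt; apply/orP; left; apply/eqP; apply: eq_integral.
have E : kernel_exp mu s0 (EFin \o pw t) x = (g t x)%:E.
  by rewrite /g fineK// ge0_fin_numE// (le_lt_trans le1)// ltry.
by split => //; rewrite -lee_fin -E.
Qed.

(** Given the covariates, the factors are independent with means bounded by
    [mix_power_moment]; that bound is affine in the entropy, so its expectation
    involves [mean_entropy] alone. Independence of the covariates multiplies
    the expectations, and [1 + z <= e ^ z] concludes. *)
Lemma expectation_prod_mix_ratio t : sub_density t ->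
  (\int[P]_w (\prod_i mix_ratio t (X i w, Y i w) `^ a)%:E <=
   (\prod_i expR (a * delta - a * theta * mean_entropy t i))%:E)%E.
Proof.
move=> st.
have mr : measurable_fun setT (pw t).
  apply: (measurableT_comp (measurable_powR _)); exact: measurable_mix_ratio.
case/andP: (theta01) => th0 th1; case/andP: (rho01) => r0 r1; case/andP: (aI) => a0 _.
have le_g x : g t x <= 1 + a * delta + a * theta * (rho * delta).
  have [_ _ gle] := gE x st; apply: le_trans gle _.
  have /andP[h _] := entropy_at_bounds cs rho01 x st.
  have : a * theta * - (rho * delta) <= a * theta * entropy_at s0 rho t x.
    by apply: ler_wpM2l => //; rewrite mulr_ge0// ltW.
  lra.
rewrite (expectation_prod_responses (F := fun=> pw t) cs XY)//; last 2 first.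
- by move=> i z; rewrite powR_ge0.
- move=> i; exists (1 + a * delta + a * theta * (rho * delta)) => x.
  by have [-> _ _] := gE x st; rewrite lee_fin.
have mgt : measurable_fun setT (g t).
  apply: (@measurableT_comp _ _ _ _ _ _ fine); first exact: fine_measurable.
  have mE := measurableT_comp (@EFin_measurable R setT) mr.
  apply: measurable_kernel_exp => // z.
  by rewrite lee_fin powR_ge0.
have mgX i : measurable_fun setT (fun w => g t (X i w)).
  exact: measurableT_comp.
have g0 x : 0 <= g t x by have [] := gE x st.
have ie i : P.-integrable setT
    (EFin \o (fun w => 1 + (a * delta - a * theta * entropy_at s0 rho t (X i w)))).
  have ie := integrable_entropy_at cs X rho01 delta0 i st.
  have ic (c : R) : P.-integrable setT (EFin \o (fun _ : Omega => c)).
    exact: finite_measure_integrable_cst.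
  have i2 := integrableB measurableT (ic (a * delta)) (integrableZl measurableT (a * theta) ie).
  exact: (integrableD measurableT (ic 1) i2).
have Eg i : (\int[P]_w (g t (X i w))%:E <=
    (1 + (a * delta - a * theta * mean_entropy t i))%:E)%E.
  apply: (@le_trans _ _ (\int[P]_w
      (1 + (a * delta - a * theta * entropy_at s0 rho t (X i w)))%:E)%E).
    apply: ge0_le_integral => //.
    - by move=> w _; rewrite lee_fin.
    - exact: (measurableT_comp (@EFin_measurable R _) (mgX i)).
    - by case/integrableP : (ie i).
    - by move=> w _; rewrite lee_fin; have [] := gE (X i w) st.
  have ie' := integrable_entropy_at cs X rho01 delta0 i st.
  have ic (c : R) : P.-integrable setT (EFin \o (fun _ : Omega => c)).
    exact: finite_measure_integrable_cst.
  have iZ := integrableZl measurableT (a * theta) ie'.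
  rewrite RintegralE// RintegralD//; last exact: (integrableB measurableT (ic _) iZ).
  rewrite RintegralB// (RintegralZl (a * theta) measurableT ie') !Rintegral_cst//= probability_setT !mulr1.
  exact: lexx.
have goo i : (\int[P]_w (g t (X i w))%:E < +oo)%E.
  by rewrite (le_lt_trans (Eg i))// ltry.
have prodE := expectation_prod_covariates indX (fun=> mgt) (fun=> g0) goo.
rewrite [X in (X <= _)%E](_ : _ = \prod_i \int[P]_w (g t (X i w))%:E)%E; last exact: prodE.
have fin i : (\int[P]_w (g t (X i w))%:E)%E = (\int[P]_w g t (X i w))%:E.
  rewrite /Rintegral fineK// ge0_fin_numE ?(le_lt_trans (Eg i)) ?ltry//.
  by apply: integral_ge0 => w _; rewrite lee_fin.
rewrite (eq_bigr _ (fun i _ => fin i)) prodEFin lee_fin.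
apply: ler_prod => i _; rewrite Rintegral_ge0//=.
apply: le_trans (expR_ge1Dx _).
by rewrite -lee_fin -fin.
Qed.

End likelihood_ratio.

(** * Comparison for a selected estimator *)

Section selection.
Variable R : realType.

(** Concavity of the logarithm between 1 and [r]. *)
Lemma ln_mix_ge (rho r : R) : 0 < rho < 1 -> 0 < r ->
  rho * ln r <= ln (1 - rho + rho * r).
Proof.
move=> /andP[r0 r1] rp.
have h : expR (rho * ln r) <= 1 - rho + rho * r.
  have := @convex_expR R (Itv01 (ltW r0) (ltW r1)) (ln r) 0.
  rewrite !convRE/= mulr0 addr0 expR0 mulr1 lnK ?posrE// /unstable.onem; lra.
by rewrite -[leLHS]expRK ler_ln ?posrE ?expR_gt0// (lt_le_trans (expR_gt0 _) h).
Qed.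

Let absorb (L y V A HT HS S : R) : 3 + (- y + (- (A - HT) + S)) <= V ->
  - L <= S -> HS <= HT + 1 -> A <= 1 -> HS <= L + y + V.
Proof. lra. Qed.

Context (d p : nat) (s0 : cond_fun R d p).
Hypothesis cs : cond_density s0.
Context {disp : measure_display} {Omega : measurableType disp}.
Variables (P : probability Omega R) (n : nat).
Variables (X : 'I_n -> {RV P >-> cube R d}) (Y : 'I_n -> {RV P >-> p.-tuple R}).
Hypothesis n0 : (0 < n)%N.
Variables (rho a theta : R).
Hypotheses (rho01 : 0 < rho < 1) (theta01 : 0 < theta < 1)
  (aE : a = (1 - theta) * (1 - rho)).
Local Notation mu := (lebesgue_tuple R p).
Local Notation delta := (n%:R^-1).
Local Notation mean_entropy := (mean_entropy s0 X rho).

Let a0 : 0 < a.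
Proof.
by case/andP: rho01 => ? ?; case/andP: theta01 => ? ?; rewrite aE mulr_gt0// subr_gt0.
Qed.

Let delta0 : 0 <= delta :> R. Proof. by rewrite invr_ge0. Qed.

(** The product of powers divided by the bound of [expectation_prod_mix_ratio],
    so that its expectation is at most 1. *)
Definition exp_moment (t : cond_fun R d p) w : R :=
  expR (- \sum_i (a * delta - a * theta * mean_entropy t i)) *
  \prod_i mix_ratio s0 rho t (X i w, Y i w) `^ a.

Lemma exp_moment_ge0 t w : 0 <= exp_moment t w.
Proof. by rewrite mulr_ge0 ?expR_ge0// prodr_ge0// => i _; exact: powR_ge0. Qed.

Lemma measurable_exp_moment t : sub_density delta t ->
  measurable_fun setT (exp_moment t).
Proof.
move=> st; apply: measurable_funM => //; apply: measurable_prod => i _.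
apply: (measurableT_comp (measurable_powR _)).
apply: (measurableT_comp (measurable_mix_ratio cs rho st)).
exact: measurable_fun_pair.
Qed.

Lemma expectation_exp_moment t : independent_covariates X ->
  cond_independent_responses X Y s0 -> sub_density delta t ->
  (\int[P]_w (exp_moment t w)%:E <= 1)%E.
Proof.
move=> indX XY st.
have aI : 0 <= a <= (1 - theta) * (1 - rho) by rewrite ltW//= aE.
have := expectation_prod_mix_ratio cs indX XY rho01 delta0 theta01 aI st.
rewrite -expR_sum => h; rewrite /exp_moment.
have prod0 w : (0 <= (\prod_i mix_ratio s0 rho t (X i w, Y i w) `^ a)%:E)%E.
  by rewrite lee_fin prodr_ge0// => i _; exact: powR_ge0.
have mprod : measurable_fun setT
    (fun w => (\prod_i mix_ratio s0 rho t (X i w, Y i w) `^ a)%:E).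
  apply/measurable_EFinP; apply: measurable_prod => i _.
  apply: (measurableT_comp (measurable_powR _)).
  apply: (measurableT_comp (measurable_mix_ratio cs rho st)).
  exact: measurable_fun_pair.
under eq_integral do rewrite EFinM.
rewrite ge0_integralZl//.
apply: (@le_trans _ _ ((expR (- \sum_i (a * delta - a * theta * mean_entropy t i)))%:E
  * (expR (\sum_i (a * delta - a * theta * mean_entropy t i)))%:E)%E).
  by apply: lee_wpmul2l => //; rewrite lee_fin expR_ge0.
by rewrite -EFinM -expRD addNr expR0.
Qed.

Section pointwise.
Variables (t s : cond_fun R d p) (w : Omega).
Hypotheses (st : sub_density delta t) (cds : cond_density s)
  (s_gt0 : forall x y, 0 < s x y) (s_le_t : forall x y, s x y <= t x y)
  (s0_gt0 : forall i, 0 < s0 (X i w) (Y i w)).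

Let l i := ln (s0 (X i w) (Y i w)) - ln (s (X i w) (Y i w)).

(** The logarithm of the hypothesis bounds the mean entropies of [t] by a
    likelihood ratio; domination passes from [t] to [s]. In the conclusion
    [ln v] is replaced by a multiple of [v], whose expectation can be bounded,
    through [z <= e ^ 2 v - 3] for [e ^ z <= v]: the constant 3 absorbs the two
    errors, each at most 1, due to [t] having mass up to [1 + 1 / n]. *)
Lemma selection_bound (y v : R) : expR (- y) * exp_moment t w <= v ->
  a * theta * \sum_i mean_entropy s i <=
  a * rho * \sum_i l i + y + expR 2 * v.
Proof.
move=> hv; case/andP: (rho01) => r0 r1; case/andP: (theta01) => th0 th1.
have n0R : n%:R != 0 :> R by rewrite pnatr_eq0 -lt0n.
have [mt t0 t1] := st.
have ratio i : - (a * rho * l i) <= a * ln (mix_ratio s0 rho t (X i w, Y i w)).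
  have sp := s_gt0 (X i w) (Y i w); have s0p := s0_gt0 i.
  have tp : 0 < t (X i w) (Y i w) by rewrite (lt_le_trans sp).
  rewrite -mulrA -mulrN; apply: ler_wpM2l; first exact: ltW.
  rewrite /l -mulrN opprB -ln_div ?posrE//.
  apply: le_trans (ln_mix_ge rho01 _) _; first by rewrite divr_gt0.
  have rhs : mix_ratio s0 rho t (X i w, Y i w) =
      1 - rho + rho * (t (X i w) (Y i w) / s0 (X i w) (Y i w)).
    by rewrite /mix_ratio /mix /=; field; rewrite gt_eqF.
  have lo : 0 < 1 - rho + rho * (s (X i w) (Y i w) / s0 (X i w) (Y i w)).
    by rewrite addr_gt0 ?subr_gt0// mulr_gt0// divr_gt0.
  have le : 1 - rho + rho * (s (X i w) (Y i w) / s0 (X i w) (Y i w)) <=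
      1 - rho + rho * (t (X i w) (Y i w) / s0 (X i w) (Y i w)).
    by rewrite lerD2l; apply: ler_wpM2l; [exact: ltW|rewrite ler_pM2r ?invr_gt0].
  by rewrite rhs ler_ln ?posrE// (lt_le_trans lo).
have ratio0 i : 0 < mix_ratio s0 rho t (X i w, Y i w).
  have sp := s_gt0 (X i w) (Y i w); have s0p := s0_gt0 i.
  have tp : 0 < t (X i w) (Y i w) by rewrite (lt_le_trans sp).
  by rewrite divr_gt0// /mix addr_gt0// mulr_gt0// subr_gt0.
have prodE : \prod_i mix_ratio s0 rho t (X i w, Y i w) `^ a =
    expR (\sum_i a * ln (mix_ratio s0 rho t (X i w, Y i w))).
  by rewrite expR_sum; apply: eq_bigr => i _; rewrite /powR gt_eqF.
move: hv; rewrite /exp_moment prodE -!expRD => hv.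
set z := - y + _ in hv.
have zv : 3 + z <= expR 2 * v.
  apply: (@le_trans _ _ (expR (2 + z))).
    by have := expR_ge1Dx (2 + z); lra.
  by rewrite expRD ler_wpM2l ?expR_ge0.
have sumE : \sum_(i < n) (a * delta - a * theta * mean_entropy t i) =
    a - a * theta * \sum_i mean_entropy t i.
  by rewrite sumrB sumr_const card_ord -mulr_sumr -[_ *+ n]mulr_natr divfK.
have ln_sum : - (a * rho * \sum_i l i) <=
    \sum_i a * ln (mix_ratio s0 rho t (X i w, Y i w)).
  by rewrite mulr_sumr -sumrN; apply: ler_sum => i _; exact: ratio.
have H_le : \sum_i mean_entropy s i <=
    \sum_i mean_entropy t i + rho / (1 - rho).
  have -> : rho / (1 - rho) = \sum_(i < n) rho * delta / (1 - rho).
    rewrite sumr_const card_ord -mulr_natr; field.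
    by rewrite n0R gt_eqF// subr_gt0.
  rewrite -big_split/=; apply: ler_sum => i _.
  exact: (mean_entropy_le_dominated cs X rho01 delta0 i st cds s_le_t).
have aH : a * theta * \sum_i mean_entropy s i <=
    a * theta * \sum_i mean_entropy t i + 1.
  have at0 : 0 <= a * theta by rewrite mulr_ge0// ltW.
  apply: le_trans (ler_wpM2l at0 H_le) _; rewrite mulrDr lerD2l aE.
  rewrite [leLHS](_ : _ = (1 - theta) * theta * rho); last first.
    by field; rewrite gt_eqF// subr_gt0.
  by rewrite !mulr_ile1 ?mulr_ge0 ?subr_ge0 ?lerBlDr ?lerDl// ltW.
have a1 : a <= 1.
  by rewrite aE mulr_ile1 ?subr_ge0 ?lerBlDr ?lerDl// ltW.
by move: zv; rewrite /z sumE => zv; exact: absorb zv ln_sum aH a1.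
Qed.

End pointwise.
End selection.

(** * Expected log-likelihood ratio *)

Section log_ratio.
Local Open Scope ereal_scope.
Context (R : realType) (d p : nat) (s0 s : cond_fun R d p).
Hypotheses (cs : cond_density s0) (cds : cond_density s)
  (s_gt0 : forall x y, (0 < s x y)%R).
Local Notation mu := (lebesgue_tuple R p).
Implicit Type z : cube R d * p.-tuple R.

Let ms0 : measurable_fun [set: cube R d * p.-tuple R] (fun z => s0 z.1 z.2).
Proof. by case: cs. Qed.

Let s00 x y : (0 <= s0 x y)%R.
Proof. by case: cs => _ + _; exact. Qed.

Let s01 x : \int[mu]_y (s0 x y)%:E = 1.
Proof. by case: cs. Qed.

Let msx x : measurable_fun setT (s0 x).
Proof. exact: (measurable_section (F := fun z => s0 z.1 z.2)). Qed.

Let ms : measurable_fun [set: cube R d * p.-tuple R] (fun z => s z.1 z.2).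
Proof. by case: cds. Qed.

Definition log_ratio z : R := ln (s0 z.1 z.2 / s z.1 z.2).

(** The value [+oo] where [s0] vanishes makes later inequalities hold at every
    point of the sample space; as [0 * +oo = 0], it does not change conditional
    expectations. *)
Definition log_ratio_pos z : \bar R :=
  if (s0 z.1 z.2 == 0 :> R)%R then +oo else (Num.max (log_ratio z) 0)%:E.

Definition log_ratio_neg z : \bar R :=
  if (s0 z.1 z.2 == 0 :> R)%R then 0 else (Num.max (- log_ratio z) 0)%:E.

Lemma log_ratio_pos_ge0 z : 0 <= log_ratio_pos z.
Proof. by rewrite /log_ratio_pos; case: ifP => // _; rewrite lee_fin le_max lexx orbT. Qed.

Lemma log_ratio_neg_ge0 z : 0 <= log_ratio_neg z.
Proof. by rewrite /log_ratio_neg; case: ifP => // _; rewrite lee_fin le_max lexx orbT. Qed.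

Let mratio : measurable_fun setT log_ratio.
Proof.
apply: (measurableT_comp (@measurable_ln R)); apply: measurable_funM => //.
by apply: measurable_funV => // z; exact: ltW.
Qed.

Let mzero : measurable_fun setT (fun z : cube R d * p.-tuple R => (s0 z.1 z.2 == 0 :> R)%R).
Proof. exact: measurable_fun_eqr. Qed.

Lemma measurable_log_ratio_pos : measurable_fun setT log_ratio_pos.
Proof.
apply: measurable_fun_ifT => //.
by apply/measurable_EFinP; apply: measurable_maxr.
Qed.

Lemma measurable_log_ratio_neg : measurable_fun setT log_ratio_neg.
Proof.
apply: measurable_fun_ifT => //.
by apply/measurable_EFinP; apply: measurable_maxr => //; exact: measurableT_comp.
Qed.

Let phi x y := (s0 x y * ln (s0 x y / s x y))%R.

Let kposE x : kernel_exp mu s0 log_ratio_pos x = \int[mu]_y (EFin \o phi x)^\+ y.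
Proof.
apply: eq_integral => y _; rewrite funeposE /log_ratio_pos /log_ratio /phi /=.
case: eqP => [->|_]; first by rewrite mul0e mul0r maxxx.
by rewrite -EFin_max -EFinM maxr_pMr// mulr0.
Qed.

Let knegE x : kernel_exp mu s0 log_ratio_neg x = \int[mu]_y (EFin \o phi x)^\- y.
Proof.
apply: eq_integral => y _; rewrite funenegE /log_ratio_neg /log_ratio /phi /=.
case: eqP => [->|_]; first by rewrite mul0e mul0r oppr0 maxxx.
by rewrite -EFin_max -EFinM maxr_pMr// mulr0 mulrN.
Qed.

Let KLE x : KL (s0 x) (s x) = \int[mu]_y (phi x y)%:E.
Proof.
by apply: eq_integral => y _; rewrite kl_integrandE//; right; rewrite gt_eqF.
Qed.

Let msx' x : measurable_fun setT (s x).
Proof. exact: (measurable_section (F := fun z => s z.1 z.2)). Qed.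

Let s_neq0 x y : s0 x y = 0%R \/ s x y != 0%R.
Proof. by right; rewrite gt_eqF. Qed.

Let s1 x : \int[mu]_y (s x y)%:E <= 1.
Proof. by case: cds => _ _ ->. Qed.

Lemma KL_ge0 x : 0 <= KL (s0 x) (s x).
Proof.
rewrite KLE; apply: divergence_ge0 => // y; exact: ltW.
Qed.

Lemma cond_log_ratio_neg_le1 x : kernel_exp mu s0 log_ratio_neg x <= 1.
Proof.
by rewrite knegE; apply: (@entropy_funeneg_le _ _ R mu (s0 x) _ _ (s x)) => // y; exact: ltW.
Qed.

Lemma cond_log_ratio_neg_fin x : kernel_exp mu s0 log_ratio_neg x \is a fin_num.
Proof.
rewrite ge0_fin_numE ?(le_lt_trans (cond_log_ratio_neg_le1 x)) ?ltry//.
by apply: kernel_exp_ge0 => //; exact: log_ratio_neg_ge0.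
Qed.

Lemma cond_log_ratio_posE x : kernel_exp mu s0 log_ratio_pos x =
  KL (s0 x) (s x) + kernel_exp mu s0 log_ratio_neg x.
Proof.
have := cond_log_ratio_neg_fin x.
by rewrite KLE integralE -kposE -knegE => fin; rewrite subeK.
Qed.

Lemma measurable_KL : measurable_fun setT (fun x => KL (s0 x) (s x)).
Proof.
have -> : (fun x => KL (s0 x) (s x)) = (fun x =>
    kernel_exp mu s0 log_ratio_pos x - kernel_exp mu s0 log_ratio_neg x).
  by apply/funext => x; rewrite cond_log_ratio_posE addeK// cond_log_ratio_neg_fin.
apply: emeasurable_funB; apply: measurable_kernel_exp => //.
- exact: measurable_log_ratio_pos.
- exact: log_ratio_pos_ge0.
- exact: measurable_log_ratio_neg.
- exact: log_ratio_neg_ge0.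
Qed.

Context {disp : measure_display} {Omega : measurableType disp}.
Variables (P : probability Omega R) (n : nat).
Variables (X : 'I_n -> {RV P >-> cube R d}) (Y : 'I_n -> {RV P >-> p.-tuple R}).
Hypothesis XY : cond_independent_responses X Y s0.

Let mKLX i : measurable_fun setT (fun w => KL (s0 (X i w)) (s (X i w))).
Proof. exact: (measurableT_comp measurable_KL). Qed.

Lemma KLnE : (0 < n)%N -> n%:R%:E * KLn X s0 s =
  \sum_(i < n) \int[P]_w KL (s0 (X i w)) (s (X i w)).
Proof.
move=> n0; rewrite /KLn ge0_integralZl//; last 2 first.
- exact: emeasurable_sum.
- by move=> w _; apply: sume_ge0 => i _; exact: KL_ge0.
rewrite muleA -EFinM divff ?pnatr_eq0 -?lt0n// mul1e ge0_integral_sum//.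
by move=> i w _; exact: KL_ge0.
Qed.

Let fpos i w := log_ratio_pos (X i w, Y i w).
Let fneg i w := log_ratio_neg (X i w, Y i w).

Let mkneg i : measurable_fun setT (fun w => kernel_exp mu s0 log_ratio_neg (X i w)).
Proof.
have mk : measurable_fun setT (kernel_exp mu s0 log_ratio_neg).
  apply: measurable_kernel_exp => //; first exact: measurable_log_ratio_neg.
  exact: log_ratio_neg_ge0.
exact: (measurableT_comp mk).
Qed.

Lemma expectation_log_ratio_neg_fin i : \int[P]_w fneg i w \is a fin_num.
Proof.
rewrite ge0_fin_numE; last by apply: integral_ge0 => w _; exact: log_ratio_neg_ge0.
rewrite (expectation_response cs i XY measurable_log_ratio_neg log_ratio_neg_ge0).
apply: (@le_lt_trans _ _ (\int[P]_w 1)); last by rewrite integral_cst//= probability_setT mule1 ltry.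
apply: ge0_le_integral => //.
- by move=> w _; apply: kernel_exp_ge0 => //; exact: log_ratio_neg_ge0.
- by move=> w _; exact: cond_log_ratio_neg_le1.
Qed.

(** The positive part may have infinite expectation, so the identity is stated
    without subtraction. *)
Lemma expectation_log_ratio_pos i :
  \int[P]_w fpos i w =
  \int[P]_w KL (s0 (X i w)) (s (X i w)) + \int[P]_w fneg i w.
Proof.
rewrite (expectation_response cs i XY measurable_log_ratio_neg log_ratio_neg_ge0).
rewrite (expectation_response cs i XY measurable_log_ratio_pos log_ratio_pos_ge0).
rewrite -ge0_integralD//.
- by apply: eq_integral => w _; exact: cond_log_ratio_posE.
- by move=> w _; exact: KL_ge0.
- by move=> w _; apply: kernel_exp_ge0 => //; exact: log_ratio_neg_ge0.
Qed.

End log_ratio.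

(** * The oracle inequality *)

Section oracle.
Context (R : realType) (d p : nat) (s0 : cond_fun R d p).
Hypothesis cs : cond_density s0.
Context {disp : measure_display} {Omega : measurableType disp}.
Variables (P : probability Omega R) (n : nat).
Variables (X : 'I_n -> {RV P >-> cube R d}) (Y : 'I_n -> {RV P >-> p.-tuple R}).
Hypotheses (n0 : (0 < n)%N) (indX : independent_covariates X)
  (XY : cond_independent_responses X Y s0).
Variables (rho a theta : R).
Hypotheses (rho01 : 0 < rho < 1) (theta01 : 0 < theta < 1)
  (aE : a = (1 - theta) * (1 - rho)).

Variables (M : countType) (x : M -> R) (Xi : R).
Hypothesis xXi : assumption_K x Xi.
Variables (F : M -> set (cond_fun R d p)) (J : M -> finType)
  (t : forall m, J m -> cond_fun R d p).
Hypotheses (F_density : forall m s, F m s -> cond_density s)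
  (F_gt0 : forall m s, F m s -> forall y z, 0 < s y z)
  (t_sub : forall m j, sub_density n%:R^-1 (@t m j))
  (F_le_t : forall m s, F m s -> exists j, forall y z, s y z <= @t m j y z)
  (J_gt0 : forall m, (0 < #|J m|)%N).
Variables (pen : M -> R) (eta eta' : R).
Hypotheses (pen_ge : forall m, x m + ln (#|J m|%:R) <= a * rho * pen m)
  (eta0 : 0 <= eta) (eta0' : 0 <= eta').
Variables (shat : M -> Omega -> cond_fun R d p) (mhat : Omega -> M).
Hypotheses (shatF : forall m w, F m (shat m w))
  (shat_min : forall m w s, F m s ->
    neg_loglik X Y (shat m w) w <= neg_loglik X Y s w + eta)
  (mhat_min : forall m w,
    neg_loglik X Y (shat (mhat w) w) w + pen (mhat w) <=
    neg_loglik X Y (shat m w) w + pen m + eta').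
Hypothesis mJKL : measurable_fun [set: Omega]
  (fun w => JKLn X rho s0 (shat (mhat w) w)).

Let rho0 : 0 < rho. Proof. by case/andP: rho01. Qed.
Let th0 : 0 < theta. Proof. by case/andP: theta01. Qed.
Let a0 : 0 < a.
Proof.
by case/andP: rho01 => ? ?; case/andP: theta01 => ? ?; rewrite aE mulr_gt0// subr_gt0.
Qed.

Let b : R := expR 2 / (a * rho).

Let b0 : 0 < b. Proof. by rewrite divr_gt0 ?expR_gt0// mulr_gt0. Qed.

Let pen0 m : 0 <= pen m.
Proof.
have : 0 <= a * rho * pen m.
  apply: le_trans (pen_ge m); rewrite addr_ge0 ?ln_ge0 ?ler1n//.
  by case: xXi => + _; exact.
by rewrite pmulr_rge0// mulr_gt0.
Qed.

Let average m w : R := #|J m|%:R^-1 * \sum_j exp_moment s0 X Y rho a theta (@t m j) w.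

Let average_term m j w :
  expR (- (x m + ln (#|J m|%:R))) * exp_moment s0 X Y rho a theta (@t m j) w <=
  expR (- x m) * average m w.
Proof.
have Jp : 0 < #|J m|%:R :> R by rewrite ltr0n.
rewrite opprD expRD [expR (- ln _)]expRN lnK ?posrE// -mulrA; apply: ler_wpM2l; first exact: expR_ge0.
apply: ler_wpM2l; first by rewrite invr_ge0.
rewrite (bigD1 j)//= lerDl; apply: sumr_ge0 => i _; exact: exp_moment_ge0.
Qed.

(* The weights are uniform inside each net and [e ^ (- x m)] across models. *)
Let mixture : exists V : Omega -> \bar R,
  [/\ measurable_fun setT V, forall w, (0 <= V w)%E,
      forall m w, ((expR (- x m))%:E * (average m w)%:E <= V w)%E &
      (\int[P]_w V w <= Xi%:E)%E].
Proof.
have mexp m j : measurable_fun setT (exp_moment s0 X Y rho a theta (@t m j)).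
  exact: (measurable_exp_moment cs).
apply: (@esum_mixture _ _ _ _ P x Xi (fun m w => (average m w)%:E) xXi) => m.
- apply/measurable_EFinP; apply: measurable_funM => //.
  by apply: measurable_sum => j; exact: mexp.
- move=> w; rewrite lee_fin mulr_ge0 ?invr_ge0//; apply: sumr_ge0 => j _.
  exact: exp_moment_ge0.
rewrite /average; under eq_integral do rewrite EFinM -sumEFin.
have exp0 j w : (0 <= (exp_moment s0 X Y rho a theta (@t m j) w)%:E)%E.
  by rewrite lee_fin exp_moment_ge0.
have mexpE j := measurableT_comp (@EFin_measurable R setT) (mexp m j).
rewrite ge0_integralZl//; last 2 first.
- exact: emeasurable_sum.
- by move=> w _; apply: sume_ge0.
rewrite ge0_integral_sum//.
apply: (@le_trans _ _ (#|J m|%:R^-1%:E * \sum_(j : J m) 1)%E).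
  apply: lee_wpmul2l; first by rewrite lee_fin invr_ge0.
  apply: lee_sum => j _; exact: (expectation_exp_moment cs).
by rewrite sumEFin sumr_const -EFinM mulVf// pnatr_eq0 -lt0n.
Qed.

Let xi0 : 0 <= Xi.
Proof.
case: xXi => _; rewrite -lee_fin; apply: le_trans.
by apply: esum_ge0 => m _; rewrite lee_fin expR_ge0.
Qed.

Section comparison.
Variables (m : M) (s : cond_fun R d p).
Hypothesis Fs : F m s.

Let cds := F_density Fs.
Let s_gt0 := F_gt0 Fs.
Let rest : R := pen m + eta + eta'.

Let rest0 : 0 <= rest. Proof. by rewrite !addr_ge0. Qed.

Let G w : R := \sum_i mean_entropy s0 X rho (shat (mhat w) w) i.

Let pos i w := log_ratio_pos s0 s (X i w, Y i w).
Let neg i w := log_ratio_neg s0 s (X i w, Y i w).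

(** [selection_bound] is applied to a function of the net that dominates the
    selected estimator, and the near-minimality of the estimator and of the
    selected model brings in the competitor [s]. When [V] is infinite or [s0]
    vanishes at an observation, the right-hand side is infinite. *)
Lemma pointwise_oracle (V : Omega -> \bar R) w : (0 <= V w)%E ->
  (forall m, ((expR (- x m))%:E * (average m w)%:E <= V w)%E) ->
  ((theta / rho * G w)%:E + \sum_i neg i w <=
   \sum_i pos i w + rest%:E + b%:E * V w)%E.
Proof.
move=> V0 hV.
have pos0 i : (0 <= pos i w)%E by exact: log_ratio_pos_ge0.
have spos0 : (0 <= \sum_i pos i w)%E by exact: sume_ge0.
have [Voo|Vfin] := eqVneq (V w) +oo%E.
  rewrite Voo gt0_muley ?lte_fin// addey ?leey//.
  by rewrite gt_eqF// (lt_le_trans (ltNyr 0))// adde_ge0// lee_fin.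
have bV0 : (0 <= b%:E * V w)%E by rewrite mule_ge0// lee_fin ltW.
have [[i s0i]|pos_s0] := pselect (exists i, s0 (X i w) (Y i w) = 0).
  have posi : pos i w = +oo%E by rewrite /pos /log_ratio_pos /= s0i eqxx.
  suff -> : (\sum_i pos i w = +oo)%E.
    rewrite !addye ?leey//; rewrite gt_eqF// (lt_le_trans (ltNyr 0))//.
  apply/eqP; rewrite esum_eqy; last by move=> j _; rewrite gt_eqF// (lt_le_trans (ltNyr 0)).
  by apply/existsP; exists i; rewrite posi eqxx.
have s0_gt0 i : 0 < s0 (X i w) (Y i w).
  rewrite lt_neqAle; case: cs => _ -> _; rewrite andbT eq_sym.
  by apply/eqP => s0i; apply: pos_s0; exists i.
pose l i := ln (s0 (X i w) (Y i w)) - ln (s (X i w) (Y i w)).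
have lE i : log_ratio s0 s (X i w, Y i w) = l i by rewrite /log_ratio/= ln_div ?posrE.
have posE i : pos i w = (Num.max (l i) 0)%:E.
  by rewrite /pos /log_ratio_pos /= gt_eqF// lE.
have negE i : neg i w = (Num.max (- l i) 0)%:E.
  by rewrite /neg /log_ratio_neg /= gt_eqF// lE.
have VE : V w = (fine (V w))%:E by rewrite fineK// ge0_fin_numE// ltey.
rewrite (eq_bigr _ (fun i _ => posE i)) (eq_bigr _ (fun i _ => negE i)) !sumEFin.
rewrite VE -EFinM -!EFinD lee_fin.
set v := fine (V w) in VE *.
have max_sub i : Num.max (l i) 0 = l i + Num.max (- l i) 0.
  by rewrite addr_maxr subrr addr0 maxC.
rewrite (eq_bigr _ (fun i _ => max_sub i)) big_split/=.
have [j sj] := F_le_t (shatF (mhat w) w).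
have key : expR (- (x (mhat w) + ln (#|J (mhat w)|%:R))) *
    exp_moment s0 X Y rho a theta (@t (mhat w) j) w <= v.
  apply: le_trans (average_term j w) _.
  by rewrite -lee_fin EFinM -VE hV.
have := selection_bound cs n0 rho01 theta01 aE (t_sub j) (F_density (shatF (mhat w) w))
  (F_gt0 (shatF (mhat w) w)) sj s0_gt0 key.
rewrite -/(G w) sumrB => sel.
have nllE (s' : cond_fun R d p) : neg_loglik X Y s' w = - \sum_i ln (s' (X i w) (Y i w)).
  by rewrite /neg_loglik sumrN.
have := mhat_min m w; have := shat_min w Fs; rewrite !nllE.
move: sel (pen_ge (mhat w)); rewrite /l sumrB.
move: (\sum_i ln (s0 _ _)) (\sum_i ln (s _ _)) (\sum_i ln (shat (mhat w) w _ _))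
  (\sum_i ln (shat m w _ _)) (\sum_i Num.max _ _) (ln #|J (mhat w)|%:R) => A B C D N lJ.
move=> sel peng nll1 nll2.
have ar0 : 0 < a * rho by rewrite mulr_gt0.
have : a * rho * (theta / rho * G w) <= a * rho * (A - B + rest + b * v).
  have -> : a * rho * (theta / rho * G w) = a * theta * G w by field; rewrite gt_eqF.
  have -> : a * rho * (A - B + rest + b * v) =
      a * rho * (A - B + rest) + expR 2 * v by rewrite /b; field; rewrite !gt_eqF.
  apply: le_trans sel _; rewrite lerD2r.
  apply: (@le_trans _ _ (a * rho * (A - C) + a * rho * pen (mhat w))).
    by rewrite lerD2l.
  rewrite -mulrDr; apply: ler_wpM2l; first exact: ltW.
  rewrite /rest; lra.
rewrite ler_pM2l//; lra.
Qed.

(** Integrating [pointwise_oracle], the expected negative parts of the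
    log-likelihood ratio are finite and cancel out. *)
Lemma oracle_inequality :
  (\int[P]_w JKLn X rho s0 (shat (mhat w) w) <=
   (theta^-1)%:E * (KLn X s0 s + ((rest + b * Xi) / n%:R)%:E))%E.
Proof.
have [V [mV V0 hV EV]] := mixture.
have nR0 : 0 < n%:R :> R by rewrite ltr0n.
have cdhat w : cond_density (shat (mhat w) w) := F_density (shatF (mhat w) w).
have JE w : JKLn X rho s0 (shat (mhat w) w) = (n%:R^-1 * (rho^-1 * G w))%:E.
  by rewrite (JKLnE cs X rho01 (delta := 1) ler01 (cdhat w)).
have J0 w : (0 <= JKLn X rho s0 (shat (mhat w) w))%E.
  rewrite JE lee_fin mulr_ge0 ?invr_ge0// mulr_ge0 ?invr_ge0 ?(ltW rho0)//.
  by apply: sumr_ge0 => i _; exact: (mean_entropy_ge0 cs X rho01 (delta := 1) ler01).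
have neg0 i w : (0 <= neg i w)%E by exact: log_ratio_neg_ge0.
have pos0 i w : (0 <= pos i w)%E by exact: log_ratio_pos_ge0.
have mXY i : measurable_fun setT (fun w => (X i w, Y i w)) by exact: measurable_fun_pair.
have mneg i : measurable_fun setT (neg i).
  exact: (measurableT_comp (measurable_log_ratio_neg cs cds s_gt0) (mXY i)).
have mpos i : measurable_fun setT (pos i).
  exact: (measurableT_comp (measurable_log_ratio_pos cs cds s_gt0) (mXY i)).
have tn0 : 0 <= theta * n%:R by rewrite mulr_ge0// ltW.
have step : (\int[P]_w ((theta * n%:R)%:E * JKLn X rho s0 (shat (mhat w) w) +
      \sum_i neg i w) <=
    \int[P]_w (\sum_i pos i w + rest%:E + b%:E * V w))%E.
  apply: ge0_le_integral => //.
  - move=> w _; rewrite adde_ge0 ?sume_ge0// mule_ge0//.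
  - apply: emeasurable_funD; last exact: emeasurable_sum.
    by apply: emeasurable_funM => //; exact: measurable_cst.
  - apply: emeasurable_funD; last by apply: emeasurable_funM => //; exact: measurable_cst.
    by apply: emeasurable_funD; [exact: emeasurable_sum|exact: measurable_cst].
  - move=> w _; apply: le_trans (pointwise_oracle (V0 w) (hV ^~ w)).
    rewrite JE -EFinM (_ : theta * n%:R * _ = theta / rho * G w)//.
    by field; rewrite !gt_eqF.
move: step.
rewrite ge0_integralD//; last 4 first.
- by move=> w _; rewrite mule_ge0.
- by apply: emeasurable_funM => //; exact: measurable_cst.
- by move=> w _; rewrite sume_ge0.
- exact: emeasurable_sum.
rewrite ge0_integralZl// ge0_integral_sum//.
have Spos0 w : (0 <= \sum_i pos i w)%E by exact: sume_ge0.
have mSpos : measurable_fun setT (fun w => \sum_i pos i w)%E by exact: emeasurable_sum.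
have Sr0 w : (0 <= \sum_i pos i w + rest%:E)%E by rewrite adde_ge0// lee_fin.
have mSr : measurable_fun setT (fun w => \sum_i pos i w + rest%:E)%E.
  by apply: emeasurable_funD => //; exact: measurable_cst.
have bV0 w : (0 <= b%:E * V w)%E by rewrite mule_ge0// lee_fin ltW.
have mbV : measurable_fun setT (fun w => b%:E * V w)%E.
  by apply: emeasurable_funM => //; exact: measurable_cst.
have splitE : (\int[P]_w (\sum_i pos i w + rest%:E) =
    \sum_i \int[P]_w pos i w + rest%:E)%E.
  rewrite -ge0_integral_sum// -[X in (_ + X)%E]mule1 -(probability_setT P).
  rewrite -(integral_cst P measurableT) -ge0_integralD//.
have -> : (\int[P]_w (\sum_i pos i w + rest%:E + b%:E * V w) =
    \sum_i \int[P]_w pos i w + rest%:E + \int[P]_w (b%:E * V w))%E.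
  by rewrite -splitE; exact: ge0_integralD.
rewrite ge0_integralZl//; last by rewrite lee_fin ltW.
have posE i : (\int[P]_w pos i w =
    \int[P]_w KL (s0 (X i w)) (s (X i w)) + \int[P]_w neg i w)%E.
  exact: (expectation_log_ratio_pos cs cds s_gt0 XY).
have -> : (\sum_i \int[P]_w pos i w =
    n%:R%:E * KLn X s0 s + \sum_i \int[P]_w neg i w)%E.
  rewrite (KLnE cs cds s_gt0)// -big_split/=; apply: eq_bigr => i _; exact: posE.
have Nfin : (\sum_i \int[P]_w neg i w)%E \is a fin_num.
  by rewrite sum_fin_num; apply/allP => _ /mapP[i _ ->]; exact: (expectation_log_ratio_neg_fin cs cds s_gt0 XY).
move: (\sum_i _)%E Nfin => N Nfin step.
have K0 : (0 <= KLn X s0 s)%E.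
  apply: integral_ge0 => w _; rewrite mule_ge0 ?lee_fin ?invr_ge0//.
  by apply: sume_ge0 => i _; exact: KL_ge0.
have hb : (b%:E * \int[P]_w V w <= (b * Xi)%:E)%E.
  by rewrite (EFinM b Xi); apply: lee_wpmul2l => //; rewrite lee_fin ltW.
have [r rE] : exists r, r = rest by exists rest.
have {}step : ((theta * n%:R)%:E * \int[P]_w JKLn X rho s0 (shat (mhat w) w) <=
    n%:R%:E * KLn X s0 s + (rest + b * Xi)%:E)%E.
  rewrite -(leeD2rE _ _ Nfin); apply: (le_trans step); rewrite -rE.
  rewrite (EFinD r (b * Xi)) [in leRHS]addeA [leRHS]addeAC; apply: leeD => //.
  by rewrite [leRHS]addeAC.
have tn_gt0 : 0 < theta * n%:R by rewrite mulr_gt0.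
have {}step : (\int[P]_w JKLn X rho s0 (shat (mhat w) w) <= (theta * n%:R)^-1%:E *
    (n%:R%:E * KLn X s0 s + (rest + b * Xi)%:E))%E.
  by rewrite lee_pdivlMl.
apply: (le_trans step).
rewrite le_eqVlt; apply/orP; left; apply/eqP.
rewrite invfM EFinM -muleA; congr (_ * _)%E.
rewrite ge0_muleDr; last 2 first.
- by rewrite mule_ge0// lee_fin.
- by rewrite lee_fin addr_ge0// mulr_ge0// ltW.
by rewrite muleA -EFinM mulVf ?gt_eqF// mul1e -EFinM mulrC.
Qed.

End comparison.
End oracle.

(** * Choice of the constants *)

Theorem theorem2 (R : realType) :
  exists kappa0 : R -> R -> R,
  forall (d p : nat) (M : countType) (S : M -> model R d p)
    (Kmax : nat) (Lm Lp lm lp : R),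
  (0 < p)%N -> 0 < Lm <= Lp -> 0 < lm <= lp ->
  (forall m, admissible_model Kmax (S m)) ->
  assumption_DIM S ->
  exists C : R,
  forall (x : M -> R) (Xi : R), assumption_K x Xi ->
  forall (rho C1 : R), 0 < rho < 1 -> 1 < C1 ->
  forall (n : nat) (s0 : cond_fun R d p),
  (0 < n)%N -> cond_density s0 ->
  forall (disp : measure_display) (Omega : measurableType disp)
    (P : probability Omega R)
    (X : 'I_n -> {RV P >-> cube R d}) (Y : 'I_n -> {RV P >-> p.-tuple R}),
  independent_covariates X -> cond_independent_responses X Y s0 ->
  forall (eta eta' : R), 0 <= eta -> 0 <= eta' ->
  forall shat : M -> Omega -> cond_fun R d p,
  (forall m omega, densities Lm Lp lm lp (S m) (shat m omega) /\
    ((neg_loglik X Y (shat m omega) omega)%:E <=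
     ereal_inf [set (neg_loglik X Y s omega)%:E
               | s in densities Lm Lp lm lp (S m)] + eta%:E)%E) ->
  forall (kappa : R) (pen : M -> R),
  kappa0 rho C1 < kappa ->
  (forall m, pen m = kappa * ((C + ln n%:R) * dim_model (S m) + x m)) ->
  forall mhat : Omega -> M,
  (forall omega,
    ((neg_loglik X Y (shat (mhat omega) omega) omega + pen (mhat omega))%:E <=
     ereal_inf [set (neg_loglik X Y (shat m omega) omega + pen m)%:E
               | m in [set: M]] + eta'%:E)%E) ->
  measurable_fun [set: Omega]
    (fun omega => JKLn X rho s0 (shat (mhat omega) omega)) ->
  (\int[P]_omega JKLn X rho s0 (shat (mhat omega) omega) <=
   C1%:E * ereal_inf [set
     ereal_inf [set KLn X s0 s | s in densities Lm Lp lm lp (S m)]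
     + (pen m / n%:R)%:E
     + ((kappa0 rho C1 * Xi + eta + eta') / n%:R)%:E | m in [set: M]])%E.
Proof.
(* With [a = (1 - C1^-1) (1 - rho)], the term 4 makes [a rho pen m] exceed
   [x m] plus the log-cardinality of the net of the model, and [e ^ 2 / (a rho)]
   is the factor of [Xi] in [oracle_inequality]. *)
exists (fun rho C1 => (4 + expR 2) / ((1 - C1^-1) * (1 - rho) * rho)).
move=> d p M S Kmax Lm Lp lm lp p0 /andP[Lm0 LmLp] /andP[lm0 lmlp] adm [CW [CU dim]].
exists (net_constant p Lm Lp lm lp CW CU).
set C := net_constant _ _ _ _ _ _ _.
move=> x Xi xXi rho C1 rho01 C11 n s0 n0 cs disp Omega P X Y indX XY eta eta' eta0 eta0'.
move=> shat hshat kappa pen kap penE mhat hmhat mJKL.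
set kappa0 := _ / _ in kap *; pose theta := C1^-1; pose a := (1 - theta) * (1 - rho).
have C10 : 0 < C1 by exact: lt_trans C11.
have theta01 : 0 < theta < 1 by rewrite invr_gt0 C10 invf_lt1.
have [rho0 rho1] := andP rho01.
have ar0 : 0 < a * rho.
  by case/andP: theta01 => ? ?; rewrite !mulr_gt0 ?subr_gt0.
have e2 : 0 < expR 2 :> R by exact: expR_gt0.
have kappa0E : a * rho * kappa0 = 4 + expR 2 by rewrite mulrC divfK// gt_eqF.
have akap : 4 <= a * rho * kappa.
  have : a * rho * kappa0 <= a * rho * kappa by rewrite ler_pM2l// ltW.
  rewrite kappa0E; lra.
have b_kappa0 : expR 2 / (a * rho) <= kappa0.
  by rewrite ler_pM2r ?invr_gt0//; lra.
have Xi0 : 0 <= Xi.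
  case: xXi => _; rewrite -lee_fin; apply: le_trans.
  by apply: esum_ge0 => m _; rewrite lee_fin expR_ge0.
(* A point of [Omega] provides an element in every model. *)
have [w0] : [set: Omega] !=set0.
  apply/set0P/eqP => O0; have := probability_setT P.
  by rewrite O0 measure0 => /eqP; rewrite eq_sym onee_eq0.
move=> _.
have g01 : 0 <= (0 : R) < 1 by rewrite lexx ltr01.
have F_density m s : densities Lm Lp lm lp (S m) s -> cond_density s.
  move=> /densitiesP[th Fth ->].
  have [mi i0 i1] := inflated_valid Lm0 lm0 (adm m) g01 Fth.
  by split => // y z; exact/ltW.
have F_gt0 m s : densities Lm Lp lm lp (S m) s -> forall y z, 0 < s y z.
  move=> /densitiesP[th Fth ->].
  by have [] := inflated_valid Lm0 lm0 (adm m) g01 Fth.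
have /choice[J hJ] m := upper_net p0 Lm0 lm0 lmlp (adm m) (dim m).1 (dim m).2 LmLp n0
  (ex_intro _ _ (hshat m w0).1).
have [t ht] : exists t : forall m, J m -> cond_fun R d p, forall m, _ :=
  ex_intro _ (fun m => projT1 (cid (hJ m))) (fun m => projT2 (cid (hJ m))).
have pen_ge m : x m + ln #|J m|%:R <= a * rho * pen m.
  have [_ _ J0 lnJ] := ht m.
  have xm0 : 0 <= x m by case: xXi.
  have lnJ0 : 0 <= ln #|J m|%:R :> R by rewrite ln_ge0// ler1n.
  rewrite penE mulrA; move: lnJ; set y := (_ * dim_model _) => lnJ.
  have y0 : 0 <= y by lra.
  apply: (@le_trans _ _ (4 * (y + x m))); first lra.
  by apply: ler_wpM2r => //; rewrite addr_ge0.
have shat_min m w s : densities Lm Lp lm lp (S m) s ->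
    neg_loglik X Y (shat m w) w <= neg_loglik X Y s w + eta.
  move=> Fs; rewrite -lee_fin; apply: le_trans (hshat m w).2 _.
  by rewrite EFinD leeD2r//; apply: ereal_inf_lbound; exists s.
have mhat_min m w : neg_loglik X Y (shat (mhat w) w) w + pen (mhat w) <=
    neg_loglik X Y (shat m w) w + pen m + eta'.
  rewrite -lee_fin; apply: le_trans (hmhat w) _.
  by rewrite EFinD leeD2r//; apply: ereal_inf_lbound; exists m.
have oracle m s (Fs : densities Lm Lp lm lp (S m) s) :=
  oracle_inequality cs n0 indX XY rho01 theta01 (erefl a) xXi F_density F_gt0
    (fun m => let: And4 h _ _ _ := ht m in h) (fun m => let: And4 _ h _ _ := ht m in h)
    (fun m => let: And4 _ _ h _ := ht m in h) pen_ge eta0 eta0'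
    (fun m w => (hshat m w).1) shat_min mhat_min mJKL Fs.
rewrite muleC -lee_pdivrMr//.
apply: le_ereal_inf_tmp => _ [m _ <-].
rewrite -addeA -EFinD -leeBlDr//.
apply: le_ereal_inf_tmp => _ [s Fs <-].
rewrite leeBlDr// lee_pdivrMr// muleC.
have := oracle m s Fs; rewrite /theta invrK => /le_trans; apply.
apply: lee_wpmul2l; first by rewrite lee_fin ltW.
apply: leeD2l; rewrite lee_fin -mulrDl ler_pM2r ?invr_gt0 ?ltr0n//.
have : expR 2 / (a * rho) * Xi <= kappa0 * Xi by exact: ler_wpM2r.
lra.
Qed.
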